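(* Suppose that $\nu$ is a probability measure on $\{\pm1\}^n$ of the form $$\nu(x)\propto\exp\left(\frac12\langle x,Jx\rangle+\langle h,x\rangle-\frac{\gamma}{2n}\Big(\sum_i x_i\Big)^2\right)$$ for some symmetric $J\succeq0$, $\gamma\ge0$ and $h\in\mathbb{R}^n$, and suppose that $\|J\|_{\mathrm{op}}<1/2$. Then: 1. The polarized down-operator $D^{\mathrm{pol}}$ has $\left(1-\frac{1-2\|J\|_{\mathrm{op}}}{n}\right)$-entropy contraction with respect to $\nu$. 2. Hence, the polarized walk on $\nu$ mixes within $\epsilon$ total variation distance in $O\left(\frac{1}{1-2\|J\|_{\mathrm{op}}}\,n\log(n/\epsilon)\right)$ steps. 3. Let $Q=J-\frac{\gamma}{n}\mathbf{1}\mathbf{1}^\top$ and let $d$ be the maximum number of non-diagonal nonzero entries in a row of $Q$. Each step of the polarized walk can be implemented in $O(d\log n)$ amortized time, so the polarized walk outputs a sample within $\epsilon$ total variation distance of $\nu$ in total runtime $O\left(\frac{1}{1-2\|J\|_{\mathrm{op}}}\,nd\log(n)\log(n/\epsilon)\right)$.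
   Context: $\mathbf{1}$ is the all-ones vector and $\|\cdot\|_{\mathrm{op}}$ the Euclidean operator norm. For $x\in\{\pm1\}^n$ let $x_+=\{i:x_i=+1\}$. Polarized down-operator: the Markov kernel $D^{\mathrm{pol}}$ from $\{\pm1\}^n$ to $2^{[n]}$ with $D^{\mathrm{pol}}(x,T)=\frac1n$ if $T=x_+\setminus\{i\}$ for some $i\in x_+$; $D^{\mathrm{pol}}(x,T)=\frac{n-|x_+|}{n}$ if $T=x_+$; and $0$ otherwise. (Equivalently: pick a uniformly random coordinate of $x$ and set it to $-1$.) Polarized up-operator with respect to $\nu$: the Bayes posterior kernel from $2^{[n]}$ to $\{\pm1\}^n$, $U^{\mathrm{pol}}(T,x)=\frac{\nu(x)D^{\mathrm{pol}}(x,T)}{(\nu D^{\mathrm{pol}})(T)}$, where $(\nu D^{\mathrm{pol}})(T)=\sum_x\nu(x)D^{\mathrm{pol}}(x,T)$. The polarized walk on $\nu$ is the Markov chain on $\{\pm1\}^n$ with transition operator $D^{\mathrm{pol}}U^{\mathrm{pol}}$. A Markov kernel $\kappa$ has $(1-\rho)$-entropy contraction with respect to $\nu$ if for all probability measures $\nu'$ absolutely continuous with respect to $\nu$, $\mathcal{D}_{\mathrm{KL}}(\nu'\kappa\,\|\,\nu\kappa)\le(1-\rho)\,\mathcal{D}_{\mathrm{KL}}(\nu'\,\|\,\nu)$.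
   Formalization: In item 3, n ≥ 2 is assumed and d is replaced by max(1,d), because for n = 1 or d = 0 the bound O(d log n) is literally 0; the amortized bound is read as O((n+T) max(1,d) log n) for T steps, including preprocessing. *)

(* Defs.v *)
From HB Require Import structures.
From mathcomp Require Import all_boot all_order all_algebra.
From mathcomp Require Import boolp classical_sets reals sequences exp.
Set Implicit Arguments.
Unset Strict Implicit.
Unset Printing Implicit Defensive.
Import Order.TTheory GRing.Theory Num.Theory.
Local Open Scope ring_scope.

(** * Measures and kernels on finite types *)

Section FiniteKernels.
Variable R : realType.
Implicit Types A B C : finType.

Definition is_prob A (mu : A -> R) : Prop :=
  (forall a, 0 <= mu a) /\ \sum_a mu a = 1.

Definition abs_cont A (mu nu : A -> R) : Prop :=
  forall a, nu a = 0 -> mu a = 0.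

(* Only meaningful when [abs_cont p q]; the convention 0 ln 0 = 0 holds because
   the factor [p x] vanishes. *)
Definition kl_div A (p q : A -> R) : R := \sum_x p x * ln (p x / q x).

Definition tv_dist A (p q : A -> R) : R := 2^-1 * \sum_x `|p x - q x|.

Definition dirac_mass A (a : A) : A -> R := fun b => (a == b)%:R.

Definition push A B (mu : A -> R) (K : A -> B -> R) : B -> R :=
  fun b => \sum_a mu a * K a b.

Definition kcomp A B C (K : A -> B -> R) (L : B -> C -> R) : A -> C -> R :=
  fun a c => \sum_b K a b * L b c.

(* Division by zero is 0, so the posterior vanishes off the support of
   [push nu K]. *)
Definition bayes A B (K : A -> B -> R) (nu : A -> R) : B -> A -> R :=
  fun b a => nu a * K a b / push nu K b.

Definition chain_law A (P : A -> A -> R) (a : A) (t : nat) : A -> R :=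
  iter t (fun mu => push mu P) (dirac_mass a).

(* The parameter [c] is the contraction factor "1 - rho". *)
Definition entropy_contraction A B (c : R) (K : A -> B -> R) (nu : A -> R) :=
  forall nu' : A -> R, is_prob nu' -> abs_cont nu' nu ->
    kl_div (push nu' K) (push nu K) <= c * kl_div nu' nu.

End FiniteKernels.

(** * The polarized walk *)

(* Points of {+1,-1}^n: [true] encodes +1 and [false] encodes -1. *)
Notation spins n := {ffun 'I_n -> bool}.

Section PolarizedWalk.
Variables (R : realType) (n : nat).
Implicit Types (x : spins n) (T : {set 'I_n}).

Definition plus x : {set 'I_n} := [set i | x i].

Definition Dpol x T : R :=
  if [exists i in plus x, T == plus x :\ i] then n%:R^-1
  else if T == plus x then (n%:R - #|plus x|%:R) / n%:R
  else 0.

Definition Upol (nu : spins n -> R) : {set 'I_n} -> spins n -> R :=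
  bayes Dpol nu.

Definition pol_walk (nu : spins n -> R) : spins n -> spins n -> R :=
  kcomp Dpol (Upol nu).

End PolarizedWalk.

(** * The Ising measure *)

Section Ising.
Variables (R : realType) (n : nat).

Definition l2norm (v : 'cV[R]_n) : R := Num.sqrt (\sum_i v i 0 ^+ 2).

Definition opnorm (A : 'M[R]_n) : R :=
  sup [set l2norm (A *m v) | v in [set v | l2norm v <= 1]]%classic.

Definition psd (A : 'M[R]_n) : Prop :=
  A^T = A /\ forall v : 'cV[R]_n, 0 <= (v^T *m A *m v) 0 0.

Definition spin_vec (x : spins n) : 'cV[R]_n :=
  \col_i (if x i then 1 else - 1).

Definition ising_weight (J : 'M[R]_n) (h : 'cV[R]_n) (gamma : R)
    (x : spins n) : R :=
  let v := spin_vec x in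
  expR (2^-1 * (v^T *m (J *m v)) 0 0 + (h^T *m v) 0 0
        - gamma / (2 * n%:R) * (\sum_i v i 0) ^+ 2).

Definition ising (J : 'M[R]_n) (h : 'cV[R]_n) (gamma : R) : spins n -> R :=
  fun x => ising_weight J h gamma x / \sum_y ising_weight J h gamma y.

Definition Qmat (J : 'M[R]_n) (gamma : R) : 'M[R]_n :=
  J - (gamma / n%:R) *: const_mx 1.

Definition row_degree (Q : 'M[R]_n) : nat :=
  \max_(i < n) #|[set j | (j != i) && (Q i j != 0%R)]|.

End Ising.

(** * A randomized real RAM

   Memory consists of arrays of natural numbers and arrays of real numbers,
   all indexed by natural numbers.  An array is named by a constant of the
   program, its cells are addressed by computed indices.  Real arithmetic,
   [exp] and comparisons are exact and have unit cost; integers support only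
   addition, truncated subtraction and halving (no multiplication, so that
   unit cost does not hide any super-polynomial power); randomness comes from
   biased coins, i.e. comparisons of a fresh uniform variable of [0, 1] with a
   computed real. *)

Inductive iexp : Type :=
| ICst of nat
| ILoad of nat & iexp           (* array name, index *)
| IAdd of iexp & iexp
| ISub of iexp & iexp
| IHalf of iexp.

Inductive rexp : Type :=
| ROfNat of iexp
| RLoad of nat & iexp           (* array name, index *)
| RAdd of rexp & rexp
| ROpp of rexp
| RMul of rexp & rexp
| RInv of rexp
| RExp of rexp.

Inductive bexp : Type :=
| BILe of iexp & iexp
| BRLe of rexp & rexp.

Inductive cmd : Type :=
| IStore of nat & iexp & iexp   (* array name, index, stored value *)
| RStore of nat & iexp & rexp   (* array name, index, stored value *)
| Seq of cmd & cmd
| If of bexp & cmd & cmd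
| While of bexp & cmd
| Flip of rexp & cmd & cmd.     (* bias, clamped to [0, 1] *)

Section Semantics.
Variable R : realType.

Record store := Store { imem : nat -> nat -> nat; rmem : nat -> nat -> R }.

Definition upd (T : Type) (m : nat -> nat -> T) (a k : nat) (v : T) :=
  fun a' k' => if (a' == a) && (k' == k) then v else m a' k'.

Fixpoint ieval (s : store) (e : iexp) : nat :=
  match e with
  | ICst k => k
  | ILoad a e => imem s a (ieval s e)
  | IAdd e1 e2 => (ieval s e1 + ieval s e2)%N
  | ISub e1 e2 => (ieval s e1 - ieval s e2)%N
  | IHalf e => (ieval s e)./2
  end.

Fixpoint reval (s : store) (e : rexp) : R :=
  match e with
  | ROfNat e => (ieval s e)%:R
  | RLoad a e => rmem s a (ieval s e)
  | RAdd e1 e2 => reval s e1 + reval s e2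
  | ROpp e => - reval s e
  | RMul e1 e2 => reval s e1 * reval s e2
  | RInv e => (reval s e)^-1
  | RExp e => expR (reval s e)
  end.

Definition beval (s : store) (b : bexp) : bool :=
  match b with
  | BILe e1 e2 => (ieval s e1 <= ieval s e2)%N
  | BRLe e1 e2 => reval s e1 <= reval s e2
  end.

(* Pending commands and memory; the machine has halted when nothing is
   pending. *)
Definition config : Type := (seq cmd * store)%type.

(* One unit of time: the finite list of weighted successors.  Expressions have
   a size fixed by the program, so evaluating them costs O(1). *)
Definition cstep (c : config) : seq (R * config) :=
  let: (k, s) := c in
  match k with
  | [::] => [:: (1, ([::], s))]
  | IStore a e v :: k =>
      [:: (1, (k, Store (upd (imem s) a (ieval s e) (ieval s v)) (rmem s)))]
  | RStore a e v :: k =>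
      [:: (1, (k, Store (imem s) (upd (rmem s) a (ieval s e) (reval s v))))]
  | Seq c1 c2 :: k => [:: (1, ([:: c1, c2 & k], s))]
  | If b c1 c2 :: k => [:: (1, ((if beval s b then c1 else c2) :: k, s))]
  | While b c' :: k =>
      [:: (1, (if beval s b then [:: c', While b c' & k] else k, s))]
  | Flip p c1 c2 :: k =>
      let q := Num.max 0 (Num.min 1 (reval s p)) in
      [:: (q, (c1 :: k, s)); (1 - q, (c2 :: k, s))]
  end.

Fixpoint runs (t : nat) (c : config) : seq (R * config) :=
  if t is t'.+1 then
    flatten [seq [seq (o.1 * o'.1, o'.2) | o' <- runs t' o.2] | o <- cstep c]
  else [:: (1, c)].

(* Probability that [p], started from [s], halts within [t] units of time in a
   memory satisfying [E]. *)
Definition halt_prob (p : cmd) (s : store) (t : nat) (E : pred store) : R :=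
  \sum_(o <- runs t ([:: p], s) | nilp o.2.1 && E o.2.2) o.1.

(** ** Input and output of the sampler

   Integer arrays: 0 holds [n] and the number of steps, 1 the spins (1 for +1,
   0 for -1), 2 and 3 the row pointers and column indices of the off-diagonal
   nonzero entries of Q in compressed sparse row format.  Real arrays: 0 holds
   the external field, 1 the values of the entries listed in integer array 3.
   Every other cell is 0. *)

Definition nbrs n (Q : 'M[R]_n) (i : 'I_n) : seq 'I_n :=
  [seq j <- enum 'I_n | (j != i) && (Q i j != 0)].

Definition input n (Q : 'M[R]_n) (h : 'cV[R]_n) (x : spins n) (steps : nat)
    : store :=
  Store
    (fun a k => match a with
     | 0 => nth 0%N [:: n; steps] k
     | 1 => nth 0%N [seq nat_of_bool (x i) | i <- enum 'I_n] k
     | 2 => nth 0%N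
              (mkseq (fun r => (\sum_(i < n | (i < r)%N) size (nbrs Q i))%N) n.+1)
              k
     | 3 => nth 0%N
              (flatten [seq [seq val j | j <- nbrs Q i] | i <- enum 'I_n]) k
     | _ => 0%N
     end)
    (fun a k => match a with
     | 0 => nth 0 [seq h i 0 | i <- enum 'I_n] k
     | 1 => nth 0 (flatten [seq [seq Q i j | j <- nbrs Q i] | i <- enum 'I_n]) k
     | _ => 0
     end).

Definition read_spins n (s : store) : spins n := [ffun i : 'I_n => imem s 1%N i == 1%N].

(* With probability one, [p] halts within [B] units of time, leaving in the spin array a
   configuration with law [mu]. *)
Definition outputs_within n (p : cmd) (s : store) (B : R) (mu : spins n -> R) :=
  exists t : nat, [/\ t%:R <= B, halt_prob p s t predT = 1 &
    forall y, halt_prob p s t (fun s' => read_spins n s' == y) = mu y].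

(* [init] builds a data structure and [step] performs one transition of [P] on
   it: [Rep x s] says that the memory [s] is in a valid state of the data
   structure representing [x]. *)
Definition implements_chain n (P : spins n -> spins n -> R)
    (inp : spins n -> nat -> store) (init step : cmd) :=
  exists Rep : spins n -> pred store,
    [/\ forall x s, Rep x s -> read_spins n s = x,
        forall x steps, exists t, halt_prob init (inp x steps) t (Rep x) = 1 &
        forall x s, Rep x s -> exists t,
          forall y, halt_prob step s t (Rep y) = P x y].

End Semantics.

(* Runs [init], then [step] as many times as prescribed by the counter in cell 1
   of integer array 0. *)
Definition sampler (init step : cmd) : cmd :=
  let counter := ILoad 0 (ICst 1) in
  Seq init (While (BILe (ICst 1) counter)
    (Seq step (IStore 0 (ICst 1) (ISub counter (ICst 1))))).

(* Main.v *)
Require Import Defs.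
From HB Require Import structures.
From mathcomp Require Import all_boot all_order all_algebra.
From mathcomp Require Import ring lra zify.
From mathcomp Require Import boolp classical_sets reals functions normedtype sequences derive exp.
Set Implicit Arguments.
Unset Strict Implicit.
Unset Printing Implicit Defensive.
Import Order.TTheory GRing.Theory Num.Theory.
Import numFieldNormedType.Exports.
Local Open Scope ring_scope.

(** The three assertions have separate proofs.

    _Contraction._ Without [J] the weight of [x] depends on the size of its plus
    set [S], times a product over [S]. Read [x] as a word of [n] letters in random
    order, the elements of [S] and [n - #|S|] blanks. The pair law of the last two
    letters given the others is a Lorentzian form, because the size weights are
    log-concave ([base_contraction]); the trickle-down principle carries this to
    the pair law of the next two letters after any prefix ([trickle_down],
    [lorentz_levels]); and a Lorentzian pair law makes the relative entropy of a
    prefix convex in its length ([lorentz_entropy], [level_ent_convex]). Hence the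
    last letter carries at least the fraction [1 / n] of the entropy, which is the
    contraction of the down-operator, with [rho = 1], under every external field.
    The interaction is then added by localization. Factor [J] as a sum of squares
    of linear forms [lin (v k)]; the Gaussian weight [exp (lin (v k) x ^ 2 / 2)]
    is a limit of powers of [cosh (d * lin (v k) x)], and a hyperbolic cosine is the
    average of two external fields. So each factor turns a measure into a mixture of
    measures known to contract, and costs only the entropy of the mixture weights.
    To second order in [d] this is a variance of linear functions
    ([mixture_entropy]); the contraction itself bounds such variances
    ([poincare], [transport]), and the cost is [2 * opnorm J * d ^ 2]
    ([localization_step]). After [1 / d ^ 2] steps the rate is
    [1 - 2 * opnorm J] ([localization], [ising_contracts]).

    _Mixing._ Contraction and data processing multiply the relative entropy by
    [1 - rho / n] at each step, and Pinsker's inequality ends the proof, except that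
    the entropy [- ln (nu x)] of the starting point is not bounded in terms of [n].
    A coupon-collector argument repairs this: once every letter has been
    redrawn, the current configuration has nearly maximal weight except with small
    probability ([renewal]).

    _Implementation._ Given the set [T] left by the down-step, the up-step picks
    a coordinate [j] outside [T] with probability proportional to [1 + exp (2 theta j)],
    where [theta j] is the local field, and makes it plus with probability
    [exp (2 theta j) / (1 + exp (2 theta j))] ([final_up_step]). Keeping the
    weights in a binary tree of partial sums makes the choice and each change of a
    weight cost [O(ln n)], and flipping a spin changes the local fields of its
    neighbours only ([set_spin_runs]). *)

(** * Entropy of a density under a finite measure *)

Section Entropy.
Variable R : realType.
Implicit Types (A B J : finType) (a b c : R).

(** The Bregman divergence of [a * ln a]; unlike the summands of the relative
    entropy it is non-negative term by term. *)
Definition psi a b := a * ln (a / b) - a + b.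

(** No normalization: [w] is a finite measure and [f] a density of arbitrary
    mass, so that [Ent] is homogeneous in [w]. *)
Definition Ent A (w f : A -> R) : R :=
  \sum_x w x * f x * ln (f x)
  - (\sum_x w x * f x) * ln ((\sum_x w x * f x) / \sum_x w x).

(** The entropy that a kernel [K] loses: the total entropy left inside the
    fibres of [K]. *)
Definition lost_ent A B (K : A -> B -> R) (w f : A -> R) : R :=
  \sum_y Ent (fun x => w x * K x y) f.

Lemma ln_divE a b : 0 < a -> 0 < b -> ln (a / b) = ln a - ln b.
Proof. by move=> a0 b0; rewrite ln_div. Qed.

Lemma psi_ge0 a b : 0 <= a -> 0 < b -> 0 <= psi a b.
Proof.
rewrite /psi le_eqVlt => /orP[/eqP<- b0|a0 b0].
  by rewrite mul0r oppr0 !add0r ltW.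
have : ln (b / a) <= b / a - 1.
  have -> : b / a = 1 + (b / a - 1) by ring.
  apply: (le_trans (le_ln1Dx _)); last by lra.
  by have := divr_gt0 b0 a0; lra.
rewrite -(ler_pM2l a0) mulrBr mulrCA divff ?gt_eqF// mulr1 mulr1.
by rewrite !ln_divE// => h; have := h; lra.
Qed.

Lemma psi_homo c a b : 0 < c -> psi (c * a) (c * b) = c * psi a b.
Proof.
move=> c0; rewrite /psi.
have -> : c * a / (c * b) = a / b by rewrite -mulf_div divff ?gt_eqF// mul1r.
by ring.
Qed.

(** The entropy is the least mean deviation from a constant; the excess is
    again a [psi]. *)
Lemma Ent_excess A (w f : A -> R) c :
  (forall x, 0 <= w x) -> (forall x, 0 <= f x) -> 0 < c -> 0 < \sum_x w x ->
  \sum_x w x * psi (f x) c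
    = Ent w f + psi (\sum_x w x * f x) (c * \sum_x w x).
Proof.
move=> w0 f0 c0 sw; rewrite /Ent /psi.
have -> : \sum_x w x * (f x * ln (f x / c) - f x + c) =
   \sum_x (w x * f x * ln (f x) - w x * f x * ln c - w x * f x + c * w x).
  apply: eq_bigr => x _; have := f0 x; rewrite le_eqVlt => /orP[/eqP<-|fx].
    by rewrite !(mulr0, mul0r) oppr0 !add0r mulrC.
  by rewrite ln_divE//; ring.
rewrite big_split/= big_split/= big_split/= !sumrN -mulr_sumr -mulr_suml.
set B := \sum_x w x * f x; set S := \sum_x w x.
have : 0 <= B by apply: sumr_ge0 => x _; rewrite mulr_ge0.
rewrite le_eqVlt => /orP[/eqP<-|B0]; first by rewrite !mul0r; ring.
rewrite !ln_divE ?mulr_gt0// lnM ?posrE//; ring.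
Qed.

Lemma Ent_eq0 A (w f : A -> R) : (forall x, w x * f x = 0) -> Ent w f = 0.
Proof.
move=> wf; rewrite /Ent big1; last by move=> x _; rewrite wf mul0r.
by rewrite big1 ?mul0r ?subr0.
Qed.

Lemma sum_eq0_ge0 A (g : A -> R) :
  (forall x, 0 <= g x) -> \sum_x g x = 0 -> forall x, g x = 0.
Proof.
move=> g0 /eqP; rewrite psumr_eq0// => /allP h x.
by apply/eqP/h; rewrite mem_index_enum.
Qed.

Lemma Ent_le A (w f : A -> R) c :
  (forall x, 0 <= w x) -> (forall x, 0 <= f x) -> 0 < c ->
  Ent w f <= \sum_x w x * psi (f x) c.
Proof.
move=> w0 f0 c0; have : 0 <= \sum_x w x by exact: sumr_ge0.
rewrite le_eqVlt => /orP[/eqP/esym sw|sw]; last first.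
  rewrite Ent_excess// lerDl psi_ge0 ?mulr_gt0//.
  by apply: sumr_ge0 => x _; rewrite mulr_ge0.
have w00 := sum_eq0_ge0 w0 sw.
rewrite Ent_eq0 => [|x]; last by rewrite w00 mul0r.
by rewrite sumr_ge0// => x _; rewrite w00 mul0r.
Qed.

Lemma Ent_mean A (w f : A -> R) :
  (forall x, 0 <= w x) -> (forall x, 0 <= f x) -> 0 < \sum_x w x * f x ->
  [/\ 0 < \sum_x w x, 0 < (\sum_x w x * f x) / \sum_x w x &
  Ent w f = \sum_x w x * psi (f x) ((\sum_x w x * f x) / \sum_x w x)].
Proof.
move=> w0 f0 B0; have sw : 0 < \sum_x w x.
  rewrite lt_def sumr_ge0// andbT; apply/eqP => /(sum_eq0_ge0 w0) h.
  by move: B0; rewrite big1 ?ltxx// => x _; rewrite h mul0r.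
split=> //; first by rewrite divr_gt0.
rewrite Ent_excess ?divr_gt0// divfK ?gt_eqF//.
by rewrite /psi divff ?gt_eqF// ln1 mulr0; ring.
Qed.

Lemma Ent_mean_dichotomy A (w f : A -> R) :
  (forall x, 0 <= w x) -> (forall x, 0 <= f x) ->
  (forall x, w x * f x = 0) \/
  exists2 c, 0 < c & Ent w f = \sum_x w x * psi (f x) c.
Proof.
move=> w0 f0; have wf0 x : 0 <= w x * f x by rewrite mulr_ge0.
have : 0 <= \sum_x w x * f x by exact: sumr_ge0.
rewrite le_eqVlt => /orP[/eqP/esym h|h]; first by left; exact: sum_eq0_ge0.
by right; have [_ ? ?] := Ent_mean w0 f0 h; eexists; eauto.
Qed.

Lemma Ent_ge0 A (w f : A -> R) :
  (forall x, 0 <= w x) -> (forall x, 0 <= f x) -> 0 <= Ent w f.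
Proof.
move=> w0 f0; have [/Ent_eq0->//|[c c0 ->]] := Ent_mean_dichotomy w0 f0.
by apply: sumr_ge0 => x _; rewrite mulr_ge0// psi_ge0.
Qed.

(** Comparison of measures: both sides are infima over [c] of sums with
    non-negative terms. *)
Lemma Ent_mono A (w w' f : A -> R) b :
  (forall x, 0 <= w x) -> (forall x, 0 <= w' x) -> (forall x, 0 <= f x) ->
  0 <= b -> (forall x, w x <= b * w' x) -> Ent w f <= b * Ent w' f.
Proof.
move=> w0 w'0 f0 b0 ww'.
have [h|[c c0 ->]] := Ent_mean_dichotomy w'0 f0.
  rewrite !Ent_eq0 ?mulr0// => x; apply/eqP; rewrite eq_le mulr_ge0// andbT.
  by have := ler_wpM2r (f0 x) (ww' x); rewrite -mulrA h mulr0.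
apply: (le_trans (Ent_le w0 f0 c0)); rewrite mulr_sumr.
by apply: ler_sum => x _; rewrite mulrA ler_wpM2r// psi_ge0.
Qed.

Lemma Ent_sum A J (w : J -> A -> R) (f : A -> R) :
  (forall j x, 0 <= w j x) -> (forall x, 0 <= f x) ->
  \sum_j Ent (w j) f <= Ent (fun x => \sum_j w j x) f.
Proof.
move=> w0 f0; have s0 x : 0 <= \sum_j w j x by exact: sumr_ge0.
have [h|[c c0 ->]] := Ent_mean_dichotomy s0 f0.
  rewrite Ent_eq0// big1// => j _; apply: Ent_eq0 => x.
  have : \sum_j w j x * f x = 0 by rewrite -mulr_suml h.
  by move/sum_eq0_ge0; apply => i; rewrite mulr_ge0.
under [leRHS]eq_bigr do rewrite mulr_suml.
by rewrite exchange_big/=; apply: ler_sum => j _; exact: Ent_le.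
Qed.

Lemma eq_Ent A (w w' f : A -> R) : w =1 w' -> Ent w f = Ent w' f.
Proof. by move=> h; rewrite /Ent; under eq_bigr do rewrite h;
  congr (_ - _ * ln (_ / _)); apply: eq_bigr => x _; rewrite h. Qed.

Section Kernel.
Variables (A B : finType) (K : A -> B -> R).
Hypothesis K0 : forall x y, 0 <= K x y.
Implicit Types w f : A -> R.

Lemma lost_ent_ge0 w f : (forall x, 0 <= w x) -> (forall x, 0 <= f x) ->
  0 <= lost_ent K w f.
Proof.
by move=> w0 f0; apply: sumr_ge0 => y _; apply: Ent_ge0 => // x; rewrite mulr_ge0.
Qed.

Lemma lost_ent_sum J (w : J -> A -> R) f :
  (forall j x, 0 <= w j x) -> (forall x, 0 <= f x) ->
  \sum_j lost_ent K (w j) f <= lost_ent K (fun x => \sum_j w j x) f.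
Proof.
move=> w0 f0; rewrite /lost_ent exchange_big/=; apply: ler_sum => y _.
rewrite [leRHS](eq_Ent (w' := fun x => \sum_j w j x * K x y)); last first.
  by move=> x; rewrite mulr_suml.
by apply: Ent_sum => // j x; rewrite mulr_ge0.
Qed.

Lemma lost_ent_mono w w' f b :
  (forall x, 0 <= w x) -> (forall x, 0 <= w' x) -> (forall x, 0 <= f x) ->
  0 <= b -> (forall x, w x <= b * w' x) ->
  lost_ent K w f <= b * lost_ent K w' f.
Proof.
move=> w0 w'0 f0 b0 ww'; rewrite mulr_sumr; apply: ler_sum => y _.
by apply: Ent_mono => // x; rewrite ?mulr_ge0// mulrA ler_wpM2r.
Qed.

Lemma lost_entE w f : (forall x, \sum_y K x y = 1) ->
  lost_ent K w f = \sum_x w x * f x * ln (f x)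
   - \sum_y push (fun x => w x * f x) K y
            * ln (push (fun x => w x * f x) K y / push w K y).
Proof.
move=> K1; rewrite /lost_ent /Ent sumrB; congr (_ - _).
  rewrite exchange_big/=; apply: eq_bigr => x _.
  rewrite -[RHS]mulr1 -(K1 x) mulr_sumr; apply: eq_bigr => y _; ring.
apply: eq_bigr => y _; rewrite /push.
by congr (_ * ln (_ / _)); apply: eq_bigr => x _; ring.
Qed.

End Kernel.

(** The log-sum inequality. *)
Lemma log_sum A (p q : A -> R) :
  (forall x, 0 <= p x) -> (forall x, 0 <= q x) ->
  (forall x, q x = 0 -> p x = 0) ->
  (\sum_x p x) * ln ((\sum_x p x) / \sum_x q x) <= \sum_x p x * ln (p x / q x).
Proof.
move=> p0 q0 pq; pose f x := p x / q x.
have qf x : q x * f x = p x.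
  rewrite /f; have [q00|qn] := eqVneq (q x) 0; last by rewrite mulrC divfK.
  by rewrite q00 (pq _ q00) mul0r.
have f0 x : 0 <= f x by rewrite divr_ge0.
have := Ent_ge0 q0 f0; rewrite /Ent subr_ge0.
have -> : \sum_x q x * f x = \sum_x p x by apply: eq_bigr => x _.
by move=> h; apply: (le_trans h); rewrite le_eqVlt; apply/orP; left; apply/eqP/eq_bigr => x _; rewrite qf.
Qed.

Lemma kl_div_ge0 A (p q : A -> R) : is_prob p -> is_prob q -> abs_cont p q ->
  0 <= kl_div p q.
Proof.
move=> [p0 p1] [q0 q1] pq; have := log_sum p0 q0 pq.
by rewrite p1 q1 divr1 ln1 mulr0.
Qed.

End Entropy.

(** * Calculus on the line *)

Section Calculus.
Variable R : realType.
Implicit Types (x y t e : R).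

Lemma is_derive_bigsum (I : Type) (r : seq I) (h : I -> R -> R) (dh : I -> R) (x : R) :
  (forall i, is_derive x (1 : R) (h i) (dh i)) ->
  is_derive x (1 : R) (fun t => \sum_(i <- r) h i t) (\sum_(i <- r) dh i).
Proof.
move=> H; elim: r => [|i r IH].
  rewrite big_nil (_ : (fun t => _) = cst 0).
    exact: is_derive_cst.
  by apply/funext => t; rewrite big_nil.
rewrite big_cons (_ : (fun t => _) = h i + (fun t => \sum_(j <- r) h j t)).
  exact: is_deriveD.
by apply/funext => t; rewrite big_cons.
Qed.

Lemma mean_value (f f' : R -> R) (a b : R) : a < b ->
  (forall t, a <= t <= b -> is_derive t (1 : R) f (f' t)) ->
  exists2 t, a < t < b & f b - f a = f' t * (b - a).
Proof.
move=> ab fd; have [||t tab e] := @MVT _ f f' a b ab.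
- by move=> t; rewrite in_itv/= => /andP[h1 h2]; apply: fd; rewrite !ltW.
- apply: derivable_within_continuous => t; rewrite in_itv/= => h.
  exact: (@ex_derive _ _ _ _ _ _ _ (fd t h)).
by exists t => //; rewrite -in_itv.
Qed.

Lemma expR_le_quad y : `|y| <= 2^-1 -> expR y <= 1 + y + 2 * y ^+ 2.
Proof.
move=> hy; have /andP[y1 y2] : - 2^-1 <= y <= 2^-1 by rewrite -ler_norml.
have h := expR_ge1Dx (- y).
rewrite -[y in expR y]opprK expRN -[leRHS]invrK lef_pV2 ?posrE ?expR_gt0//;
  last by rewrite invr_gt0; nra.
apply: (le_trans _ h); rewrite -[leRHS]invrK lef_pV2 ?posrE ?invr_gt0; [|nra|lra].
rewrite -[leLHS]mul1r ler_pdivrMr; last by lra.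
have := sqr_ge0 y; nra.
Qed.

(** [psi a b] is squeezed between quadratics as soon as [a / b] is close to 1. *)
Lemma is_derive_psi1 t : 0 < t -> is_derive t 1 (fun a => psi a 1) (ln t).
Proof.
move=> t0; have -> : (fun a => psi a 1) = (id : R -> R) * (@ln R) - id + cst 1.
  by apply/funext => a; rewrite /psi divr1.
have := is_derive1_ln t0 => H.
apply: is_derive_eq; rewrite /GRing.scale/= mulfV ?gt_eqF// mulr1; ring.
Qed.

Lemma is_derive_sqr1 c t :
  is_derive t 1 (fun a : R => c * (a - 1) ^+ 2) (2 * c * (t - 1)).
Proof.
have -> : (fun a : R => c * (a - 1) ^+ 2) = c *: ((id - cst 1) ^+ 2).
  by apply/funext => a; rewrite /GRing.scale/= /GRing.exp /=.
apply: is_derive_eq; rewrite /GRing.scale/= expr1 subr0 mulr1.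
rewrite -mulr_natl; rewrite -[(id - cst 1) t]/(t - 1); ring.
Qed.

Lemma min_of_deriv (f f' : R -> R) (c b : R) :
  (forall t, (c <= t <= b) || (b <= t <= c) -> is_derive t 1 f (f' t)) ->
  (forall t, (c <= t <= b) || (b <= t <= c) -> 0 <= f' t * (t - c)) ->
  f c <= f b.
Proof.
move=> fd f'0; have [cb|bc|->//] := ltgtP c b.
  have [|t /andP[t1 t2] e] := @mean_value f f' c b cb.
    by move=> t h; apply: fd; rewrite h.
  have := f'0 t; rewrite (ltW t1) (ltW t2) => /(_ isT).
  rewrite pmulr_lge0 ?subr_gt0// => h.
  by rewrite -subr_ge0 e mulr_ge0// subr_ge0 ltW.
have [|t /andP[t1 t2] e] := @mean_value f f' b c bc.
  by move=> t h; apply: fd; rewrite h orbT.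
have := f'0 t; rewrite (ltW t1) (ltW t2) orbT => /(_ isT).
rewrite nmulr_lge0 ?subr_lt0// => h.
by rewrite -subr_le0 e mulr_le0_ge0// subr_ge0 ltW.
Qed.

Lemma psi1_sandwich e a : 0 <= e < 1 -> `|a - 1| <= e ->
  (a - 1) ^+ 2 / (2 * (1 + e)) <= psi a 1 <= (a - 1) ^+ 2 / (2 * (1 - e)).
Proof.
move=> /andP[e0 e1]; rewrite ler_norml => /andP[a1 a2].
have p1 : psi 1 1 = 0 :> R by rewrite /psi divr1 ln1; ring.
have lnb (t : R) : 0 < t -> t - 1 <= t * ln t /\ ln t <= t - 1.
  move=> t0; split; last first.
    by rewrite {1}(_ : t = 1 + (t - 1)) ?le_ln1Dx//; [lra|ring].
  have : ln t^-1 <= t^-1 - 1.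
    have : 0 < t^-1 by rewrite invr_gt0.
    by move=> ?; rewrite {1}(_ : t^-1 = 1 + (t^-1 - 1)) ?le_ln1Dx//; [lra|ring].
  rewrite lnV ?posrE// -(ler_pM2l t0) mulrBr divff ?gt_eqF//; lra.
have e1' : 0 < 1 - e by lra.
have e2' : 0 < 1 + e by lra.
have rng t : (1 <= t <= a) || (a <= t <= 1) -> [/\ 0 < t, - e <= t - 1 & t - 1 <= e].
  by case/orP => /andP[? ?]; split; lra.
set cu := (2 * (1 - e))^-1; set cl := (2 * (1 + e))^-1.
have cuE : 2 * cu * (1 - e) = 1 by rewrite /cu; field; lra.
have clE : 2 * cl * (1 + e) = 1 by rewrite /cl; field; lra.
have cu0 : 0 < cu by rewrite invr_gt0; lra.
have cl0 : 0 < cl by rewrite invr_gt0; lra.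
apply/andP; split; rewrite mulrC -subr_ge0.
  have := @min_of_deriv (fun t => psi t 1 - cl * (t - 1) ^+ 2)
     (fun t => ln t - 2 * cl * (t - 1)) 1 a.
  rewrite p1 subrr expr0n mulr0 subr0; apply => t /rng[t0 t1 t2].
    by have h1 := is_derive_psi1 t0; have h2 := is_derive_sqr1 cl t; exact: is_deriveB.
  have [l1 l2] := lnb t t0.
  have [t11|t11] := leP 1 t.
    rewrite mulr_ge0//; last by lra.
    suff : 2 * cl * (t - 1) * t <= ln t * t by rewrite ler_pM2r//; lra.
    nra.
  rewrite -mulrNN mulr_ge0//; last by lra.
  by nra.
have := @min_of_deriv (fun t => cu * (t - 1) ^+ 2 - psi t 1)
     (fun t => 2 * cu * (t - 1) - ln t) 1 a.
rewrite p1 subrr expr0n mulr0 subr0; apply => t /rng[t0 t1 t2].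
  by have h1 := is_derive_psi1 t0; have h2 := is_derive_sqr1 cu t; exact: is_deriveB.
have [l1 l2] := lnb t t0.
have [t11|t11] := leP 1 t.
  rewrite mulr_ge0//; last by lra.
  nra.
rewrite -mulrNN mulr_ge0//; last by lra.
suff : 2 * cu * (t - 1) * t <= ln t * t by rewrite ler_pM2r//; lra.
nra.
Qed.

Lemma psi_le_quad e a b : 0 < b -> 0 <= e < 1 -> `|a - b| <= e * b ->
  psi a b <= (a - b) ^+ 2 / (2 * b * (1 - e)).
Proof.
move=> b0 e01 ab; have h : `|a / b - 1| <= e.
  have -> : a / b - 1 = (a - b) / b by field; rewrite lt0r_neq0.
  by rewrite normrM [`|b^-1|]gtr0_norm ?invr_gt0// ler_pdivrMr.
have /andP[_ hp] := psi1_sandwich e01 h.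
have -> : psi a b = b * psi (a / b) 1.
  by rewrite -psi_homo// mulrC divfK ?gt_eqF// mulr1.
apply: (le_trans (ler_wpM2l (ltW b0) hp)).
rewrite le_eqVlt; apply/orP; left; apply/eqP; field.
by rewrite lt0r_neq0//=; case/andP: e01 => *; lra.
Qed.

Lemma mean_value0 (f f' : R -> R) y :
  (forall t, is_derive t (1 : R) f (f' t)) -> f 0 = 0 ->
  exists2 t, `|t| <= `|y| & f y = f' t * y.
Proof.
move=> fd f0; have [y0|y0|y0] := ltgtP 0 y; last first.
- by exists 0; rewrite ?f0 ?mulr0 -?y0 ?f0 ?mulr0.
- have [t /andP[t1 t2] e] := mean_value y0 (fun t _ => fd t).
  exists t; last by move: e; rewrite f0 !sub0r mulrN => /oppr_inj.
  by rewrite !ltr0_norm// lerN2 ltW.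
have [t /andP[t1 t2] e] := mean_value y0 (fun t _ => fd t).
exists t; last by move: e; rewrite f0 !subr0.
by rewrite !gtr0_norm// ltW.
Qed.

Lemma is_derive_inv (f : R -> R) df t : f t != 0 -> is_derive t (1 : R) f df ->
  is_derive t (1 : R) (fun u => (f u)^-1) (- df / f t ^+ 2).
Proof.
move=> ft fd; have fd' := @ex_derive _ _ _ _ _ _ _ fd.
apply: DeriveDef; first exact: derivableV.
by rewrite deriveV// derive_val /GRing.scale/= mulNr mulrC mulNr.
Qed.

Definition ch y : R := (expR y + expR (- y)) / 2.
Definition sh y : R := (expR y - expR (- y)) / 2.

Lemma is_derive_expRN t : is_derive t (1 : R) (fun y : R => expR (- y)) (- expR (- t)).
Proof.
have -> : (fun y : R => expR (- y)) = expR \o (-%R : R -> R) by [].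
apply: is_derive_eq; rewrite /GRing.scale/=; ring.
Qed.

Lemma is_derive_ch t : is_derive t (1 : R) ch (sh t).
Proof.
have h := is_derive_expRN t.
have -> : ch = 2^-1 *: (expR + (fun y : R => expR (- y))).
  by apply/funext => y; rewrite /ch mulrC.
by apply: is_derive_eq; rewrite /GRing.scale/= /sh mulrC.
Qed.

Lemma is_derive_sh t : is_derive t (1 : R) sh (ch t).
Proof.
have h := is_derive_expRN t.
have -> : sh = 2^-1 *: (expR - (fun y : R => expR (- y))).
  by apply/funext => y; rewrite /sh mulrC.
by apply: is_derive_eq; rewrite /GRing.scale/= /ch opprK mulrC.
Qed.

Lemma ch0 : ch 0 = 1.
Proof. by rewrite /ch oppr0 expR0; lra. Qed.

Lemma ch_ge1 y : 1 <= ch y.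
Proof.
rewrite /ch ler_pdivlMr// mul1r expRN.
have e0 := expR_gt0 y; set a := expR y in e0 *.
have i : a * a^-1 = 1 by rewrite divff ?gt_eqF.
by rewrite -(ler_pM2l e0); have := sqr_ge0 (a - 1); nra.
Qed.

Lemma ch_le_quad y : `|y| <= 2^-1 -> ch y <= 1 + 2 * y ^+ 2.
Proof.
move=> hy; rewrite /ch ler_pdivrMr//.
have h1 := expR_le_quad hy; have := @expR_le_quad (- y).
by rewrite normrN sqrrN => /(_ hy); lra.
Qed.

Lemma sh_mean_value y : exists2 t, `|t| <= `|y| & sh y = ch t * y.
Proof.
by apply: mean_value0 is_derive_sh _; rewrite /sh oppr0 subrr mul0r.
Qed.

Lemma is_derive_half_sqr c t :
  is_derive t (1 : R) (fun y : R => c * y ^+ 2 / 2) (c * t).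
Proof.
have -> : (fun y : R => c * y ^+ 2 / 2) = (c / 2) *: ((id : R -> R) ^+ 2).
  apply/funext => y; rewrite -[RHS]/(c / 2 * (y ^+ 2)); ring.
apply: is_derive_eq; rewrite /GRing.scale/= expr1 mulr1.
by rewrite -mulr_natl; field.
Qed.

(** The two bounds on the hyperbolic cosine agree to second order, which makes
    powers of it converge to a Gaussian weight. *)
Lemma ch_ge_quad y : 1 + y ^+ 2 / 2 <= ch y.
Proof.
have := @min_of_deriv (fun t => ch t - 1 * t ^+ 2 / 2) (fun t => sh t - 1 * t) 0 y.
rewrite ch0 expr0n/= mulr0 mul0r => h.
suff : 1 - 0 <= ch y - 1 * y ^+ 2 / 2 by lra.
apply: h => t _.
  have h1 := is_derive_ch t; have h2 := is_derive_half_sqr 1 t; exact: is_deriveB.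
have [u _ ->] := sh_mean_value t.
by rewrite subr0 -mulrBl -mulrA mulr_ge0 ?subr_ge0 ?ch_ge1// -expr2 sqr_ge0.
Qed.

Lemma ch_le_sharp y : `|y| <= 2^-1 -> ch y <= 1 + (1 + 2 * y ^+ 2) * y ^+ 2 / 2.
Proof.
move=> hy; set c := 1 + 2 * y ^+ 2.
have := @min_of_deriv (fun t => c * t ^+ 2 / 2 - ch t) (fun t => c * t - sh t) 0 y.
rewrite ch0 expr0n/= mulr0 mul0r => h.
suff : 0 - 1 <= c * y ^+ 2 / 2 - ch y by lra.
apply: h => t ht.
  have h1 := is_derive_ch t; have h2 := is_derive_half_sqr c t; exact: is_deriveB.
have ty : `|t| <= `|y|.
  case/orP: ht => /andP[t1 t2].
    by rewrite !ger0_norm//; lra.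
  by rewrite !ler0_norm//; lra.
have [u ut ->] := sh_mean_value t.
rewrite subr0 -mulrBl -mulrA mulr_ge0 ?subr_ge0// -?expr2 ?sqr_ge0//.
have uy := le_trans ut ty.
apply: (le_trans (ch_le_quad (le_trans uy hy))).
by rewrite lerD2l ler_pM2l// -ler_sqrt ?sqr_ge0// !sqrtr_sqr.
Qed.

End Calculus.

(** * From variance bounds to transport inequalities *)

Section Transport.
Variables (R : realType) (A : finType).
Implicit Types (p nu g : A -> R) (s t : R).

(** Gibbs' variational principle. *)
Lemma gibbs p nu g : is_prob p -> (forall x, 0 < nu x) ->
  \sum_x p x * g x - ln (\sum_x nu x * expR (g x)) <= kl_div p nu.
Proof.
move=> [p0 p1] nu0.
have q0 x : 0 < nu x * expR (g x) by rewrite mulr_gt0 ?expR_gt0.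
have pq x : nu x * expR (g x) = 0 -> p x = 0 by move/eqP; rewrite gt_eqF.
have h := log_sum p0 (fun x => ltW (q0 x)) pq.
have Z0 : 0 < \sum_x nu x * expR (g x).
  rewrite lt_def sumr_ge0 ?andbT; last by move=> x _; exact: ltW.
  apply/eqP => /(sum_eq0_ge0 (fun x => ltW (q0 x))) z.
  move: p1; case: (pickP A) => [x _|e]; last by rewrite big_pred0// => /eqP; rewrite eq_sym oner_eq0.
  by have := q0 x; rewrite z ltxx.
move: h; rewrite p1 mul1r.
rewrite ln_divE// ln1 sub0r /kl_div.
have -> : \sum_x p x * ln (p x / (nu x * expR (g x))) =
  \sum_x p x * ln (p x / nu x) - \sum_x p x * g x; last by lra.
rewrite -sumrB; apply: eq_bigr => x _.
have := p0 x; rewrite le_eqVlt => /orP[/eqP<-|px]; first by rewrite !mul0r subr0.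
by rewrite !ln_divE// ?lnM ?posrE ?expR_gt0// expRK; ring.
Qed.

Section Tilts.
Variables (nu g : A -> R) (s : R).
Hypothesis nu_gt0 : forall x, 0 < nu x.
Hypothesis nu1 : \sum_x nu x = 1.

Let mom k t := \sum_x nu x * g x ^+ k * expR (t * g x).

Let is_derive_mom k t : is_derive t (1 : R) (mom k) (mom k.+1 t).
Proof.
apply: is_derive_bigsum => x.
have -> : (fun t : R => nu x * g x ^+ k * expR (t * g x)) =
    (nu x * g x ^+ k) *: (expR \o ( *:%R^~ (g x) : R -> R)) by [].
have h : is_derive t (1 : R) ( *:%R^~ (g x) : R -> R) (g x).
  have -> : ( *:%R^~ (g x) : R -> R) = g x *: (id : R -> R).
    by apply/funext => u; rewrite /GRing.scale/= mulrC.
  by apply: is_derive_eq; rewrite /GRing.scale/= mulr1.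
apply: is_derive_eq; rewrite /GRing.scale/= exprS; ring.
Qed.

Hypothesis var_le : forall t,
  mom 2 t * mom 0 t - mom 1 t ^+ 2 <= s * mom 0 t ^+ 2.

Let mom0_gt0 t : 0 < mom 0 t.
Proof.
rewrite lt_def sumr_ge0 ?andbT => [|x _]; last first.
  by rewrite expr0 mulr1 mulr_ge0 ?expR_ge0// ltW.
apply/eqP => /sum_eq0_ge0 h; have {}h x : nu x * g x ^+ 0 * expR (t * g x) = 0.
  by apply: h => y; rewrite expr0 mulr1 mulr_ge0 ?expR_ge0// ltW.
move: nu1; case: (pickP A) => [x _|e]; last by rewrite big_pred0// => /eqP; rewrite eq_sym oner_eq0.
by have := h x; rewrite expr0 mulr1 => /eqP; rewrite mulf_eq0 !gt_eqF// expR_gt0.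
Qed.

Let m := \sum_x nu x * g x.

(* The second derivative of the logarithm of the Laplace transform is a variance,
   and [N] is the derivative of the difference of the two sides. *)
Let log_laplace_le t : ln (mom 0 t) <= m * t + s * t ^+ 2 / 2.
Proof.
have m00 : mom 0 0 = 1.
  by rewrite -nu1; apply: eq_bigr => x _; rewrite mul0r expR0 expr0 !mulr1.
have m10 : mom 1 0 = m by apply: eq_bigr => x _; rewrite mul0r expR0 expr1 !mulr1.
pose N t := m + s * t - mom 1 t / mom 0 t.
pose N' t := s - (mom 2 t * mom 0 t - mom 1 t ^+ 2) / mom 0 t ^+ 2.
have dN u : is_derive u (1 : R) N (N' u).
  have h0 := is_derive_mom 0 u; have h1 := is_derive_mom 1 u.
  have z : mom 0 u != 0 by rewrite gt_eqF.
  have -> : N = cst m + s *: (id : R -> R) - mom 1 * (fun t => (mom 0 t)^-1) by [].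
  have hv := is_derive_inv z h0.
  have hN := is_deriveB (is_deriveD (is_derive_cst m u 1) (is_deriveZ s (is_derive_id u 1))) (is_deriveM h1 hv).
  by apply: (is_derive_eq hN); rewrite /GRing.scale/= /N' mulr1; field.
have N'0 u : 0 <= N' u.
  rewrite subr_ge0 ler_pdivrMr ?exprn_gt0//; exact: var_le.
have N0 : N 0 = 0 by rewrite /N m10 m00 mulr0 addr0 divr1 subrr.
have Ns u : 0 <= N u * u.
  have [v _ ->] := mean_value0 u dN N0.
  by rewrite -mulrA mulr_ge0// -expr2 sqr_ge0.
have := @min_of_deriv R (fun u => m * u + s * u ^+ 2 / 2 - ln (mom 0 u)) N 0 t.
rewrite m00 ln1 expr0n/= !mulr0 mul0r !addr0 subrr subr_ge0; apply=> u _.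
  have h0 := is_derive_mom 0 u.
  have h2 := is_derive_half_sqr s u.
  have hl := is_derive1_ln (mom0_gt0 u).
  have -> : (fun u => m * u + s * u ^+ 2 / 2 - ln (mom 0 u)) =
    m *: (id : R -> R) + (fun u => s * u ^+ 2 / 2) - (@ln R \o mom 0) by [].
  by apply: is_derive_eq; rewrite /GRing.scale/= mulr1 /N [_^-1 * _]mulrC.
by rewrite subr0.
Qed.

(** Testing the Gibbs principle against [t * g] and optimizing over [t]. *)
Lemma transport p : 0 <= s -> is_prob p ->
  (\sum_x p x * g x - \sum_x nu x * g x) ^+ 2 <= 2 * s * kl_div p nu.
Proof.
move=> s0 pp; rewrite -/m; set D := _ - m.
have key t : t * D - s * t ^+ 2 / 2 <= kl_div p nu.
  apply: (le_trans _ (gibbs (fun x => t * g x) pp nu_gt0)).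
  have -> : \sum_x nu x * expR (t * g x) = mom 0 t.
    by apply: eq_bigr => x _; rewrite expr0 mulr1.
  have -> : \sum_x p x * (t * g x) = t * \sum_x p x * g x.
    by rewrite mulr_sumr; apply: eq_bigr => x _; rewrite mulrCA.
  by have := log_laplace_le t; rewrite /D; lra.
have [s00|s00] := eqVneq s 0.
  rewrite s00 mulr0 mul0r; have [->|D0] := eqVneq D 0; first by rewrite expr0n.
  have := key ((kl_div p nu + 1) / D).
  by rewrite s00 !mul0r subr0 divfK//; lra.
have sp : 0 < s by rewrite lt_def s00.
have := key (D / s).
have -> : D / s * D - s * (D / s) ^+ 2 / 2 = D ^+ 2 / (2 * s) by field.
by rewrite ler_pdivrMr ?mulr_gt0// mulrC.
Qed.

End Tilts.
End Transport.

(** * Lorentzian forms and the trickle-down principle *)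

Section Lorentz.
Variables (R : realType) (I : finType).
Implicit Types (H : I -> I -> R) (u v w : I -> R) (k s : R).

Definition qf H u v : R := \sum_a u a * \sum_b H a b * v b.

Definition one : I -> R := fun=> 1.

(** At most one positive eigenvalue, tested at the all-ones vector. *)
Definition lorentz H := forall v, qf H v v * qf H one one <= qf H v one ^+ 2.

Lemma qfDl H u v w k :
  qf H (fun a => u a + k * v a) w = qf H u w + k * qf H v w.
Proof.
rewrite /qf mulr_sumr -big_split/=; apply: eq_bigr => a _; ring.
Qed.

Lemma qfDr H u v w k :
  qf H w (fun a => u a + k * v a) = qf H w u + k * qf H w v.
Proof.
rewrite /qf mulr_sumr -big_split/=; apply: eq_bigr => a _.
rewrite mulrCA -mulrDr; congr (_ * _); rewrite mulr_sumr -big_split/=.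
by apply: eq_bigr => b _; ring.
Qed.

Lemma qfC H u v : (forall a b, H a b = H b a) -> qf H u v = qf H v u.
Proof.
move=> Hs; rewrite /qf; under eq_bigr do rewrite mulr_sumr.
rewrite exchange_big/=; apply: eq_bigr => b _; rewrite mulr_sumr.
by apply: eq_bigr => a _; rewrite Hs; ring.
Qed.

Lemma bernoulli (k : R) n : 0 <= k -> 1 + n%:R * k <= (1 + k) ^+ n.
Proof.
move=> k0; elim: n => [|n IH]; first by rewrite mul0r addr0 expr0.
rewrite exprS -natr1; have h : 0 <= n%:R :> R by exact: ler0n.
by have := ler_wpM2l (_ : 0 <= 1 + k) IH => /(_ (ltac:(lra))); nra.
Qed.

Lemma le0_geometric (q x y : R) : 0 < q < 1 ->
  (forall n, x <= q ^+ n * y) -> x <= 0.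
Proof.
move=> /andP[q0 q1] h; rewrite leNgt; apply/negP => x0.
have y0 : 0 < y by have := h 0%N; rewrite expr0 mul1r; apply: lt_le_trans.
pose k := q^-1 - 1; have k0 : 0 < k by rewrite subr_gt0 invf_gt1.
pose n := (Num.truncn (y / (x * k))).+1.
have hn : y / (x * k) < n%:R by apply: truncnS_gt.

have := h n; apply/negP; rewrite -ltNge.
have -> : q = (1 + k)^-1 by rewrite /k addrC subrK invrK.
have k1 : 0 < 1 + k by lra.
rewrite exprVn mulrC ltr_pdivrMr ?exprn_gt0//.
apply: (lt_le_trans _ (ler_wpM2l (ltW x0) (bernoulli n (ltW k0)))).
move: hn; rewrite ltr_pdivrMr ?mulr_gt0// => hn.
by nra.
Qed.

(** Reversed Cauchy-Schwarz: being Lorentzian at one vector of positive square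
    is being Lorentzian at all of them. *)
Lemma lorentz_at H (e : I -> R) : (forall a b, H a b = H b a) ->
  0 < qf H e e -> 0 <= qf H one one ->
  (forall v, qf H v v * qf H e e <= qf H v e ^+ 2) -> lorentz H.
Proof.
move=> Hs e0 o0 he v.
have [v0|v0] := leP (qf H v v) 0.
  by apply: (le_trans _ (sqr_ge0 _)); rewrite mulr_le0_ge0.
have [o00|on] := eqVneq (qf H one one) 0; first by rewrite o00 mulr0 sqr_ge0.
have op : 0 < qf H one one by rewrite lt_def on.
set x := qf H v e; set y := qf H one e.
have x2 : 0 < x ^+ 2 by apply: (lt_le_trans _ (he v)); rewrite mulr_gt0.
have y2 : 0 < y ^+ 2 by apply: (lt_le_trans _ (he one)); rewrite mulr_gt0.
(* [z] is the combination of [v] and [one] orthogonal to [e]. *)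
pose w a := 0 + y * v a; pose z a := w a + (- x) * one a.
have zE : qf H z e = 0.
  rewrite qfDl qfDl -/x -/y.
  have -> : qf H (fun=> 0) e = 0 by rewrite /qf big1// => a _; rewrite mul0r.
  by ring.
have := he z; rewrite zE expr0n/= pmulr_lle0//.
rewrite /z /w !(qfDl, qfDr).
have -> : qf H (fun=> 0) (fun=> 0) = 0 by rewrite /qf big1// => a _; rewrite mul0r.
have q0l u : qf H (fun=> 0) u = 0 by rewrite /qf big1// => a _; rewrite mul0r.
have q0r u : qf H u (fun=> 0) = 0 by rewrite qfC// q0l.
rewrite !q0l !q0r (qfC one v Hs).
set V := qf H v v in v0 *; set W := qf H one one in op *; set U := qf H v one.
move=> h.
have h1 : y ^+ 2 * V + x ^+ 2 * W <= 2 * (x * y) * U by move: h; lra.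
have h0 : 0 < y ^+ 2 * V + x ^+ 2 * W by rewrite addr_gt0// mulr_gt0.
have h2 : (y ^+ 2 * V + x ^+ 2 * W) ^+ 2 <= (2 * (x * y) * U) ^+ 2.
  by rewrite ler_sqr// ?nnegrE; lra.
(* From [0 < p + q <= m] to [4 * p * q <= m ^ 2]. *)
have h3 : 4 * (x ^+ 2 * y ^+ 2) * (V * W) <= 4 * (x ^+ 2 * y ^+ 2) * U ^+ 2.
  have := sqr_ge0 (y ^+ 2 * V - x ^+ 2 * W); move: h2.
  by move=> h2 h4; lra.
by move: h3; rewrite ler_pM2l// mulr_gt0// mulr_gt0.
Qed.

(** [H] is the pair weight of two letters and [Hl c] their pair weight once the
    letter [c] has been read; the random walk with kernel [H a b / r a] is
    self-adjoint for [ip]. *)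
Section TrickleDown.
Variables (H : I -> I -> R) (Hl : I -> I -> I -> R) (c0 : R).
Hypothesis Hsym : forall a b, H a b = H b a.
Hypothesis H0 : forall a b, 0 <= H a b.
Hypothesis Hl0 : forall c a b, 0 <= Hl c a b.
Hypothesis Hl_sum : forall a b, H a b = \sum_c Hl c a b.
Hypothesis Hl_row : forall c a, \sum_b Hl c a b = H a c.
Hypothesis Hl_lorentz : forall c, lorentz (Hl c).

Let r a := \sum_b H a b.
Hypothesis c0_gt0 : 0 < c0.
Hypothesis H_gap : forall a b, a != b -> c0 * (r a * r b) <= H a b.

Let Hv v a := \sum_b H a b * v b.
Let ip v w := \sum_a r a * (v a * w a).

Let r0 a : 0 <= r a. Proof. exact: sumr_ge0. Qed.

Let ipDl u v w k : ip (fun a => u a + k * v a) w = ip u w + k * ip v w.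
Proof. by rewrite /ip mulr_sumr -big_split/=; apply: eq_bigr => a _; ring. Qed.

Let ipDr u v w k : ip w (fun a => u a + k * v a) = ip w u + k * ip w v.
Proof. by rewrite /ip mulr_sumr -big_split/=; apply: eq_bigr => a _; ring. Qed.

Let ipC u v : ip u v = ip v u.
Proof. by apply: eq_bigr => a _; ring. Qed.

Let ip_ge0 v : 0 <= ip v v.
Proof. by apply: sumr_ge0 => a _; rewrite mulr_ge0// -expr2 sqr_ge0. Qed.

Let A v a := Hv v a / r a.

Let rA v a : r a * A v a = Hv v a.
Proof.
rewrite /A; have [ra|ra] := eqVneq (r a) 0; last by rewrite mulrC divfK.
rewrite ra mul0r /Hv big1// => b _.
by rewrite (sum_eq0_ge0 (H0 a) ra) mul0r.
Qed.

Let ipA u v : ip u (A v) = qf H u v.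
Proof. by apply: eq_bigr => a _; rewrite mulrCA rA. Qed.

(** The links dominate the form: [qf H v v <= |A v|^2]. *)
Let link_bound v : qf H v v <= ip (A v) (A v).
Proof.
have -> : qf H v v = \sum_c qf (Hl c) v v.
  rewrite /qf exchange_big/=; apply: eq_bigr => a _; rewrite -mulr_sumr.
  congr (_ * _); rewrite exchange_big/=; apply: eq_bigr => b _.
  by rewrite Hl_sum mulr_suml.
apply: ler_sum => c _; have := Hl_lorentz c v.
have -> : qf (Hl c) one one = r c.
  rewrite /qf /r; apply: eq_bigr => a _; rewrite mul1r Hsym -Hl_row.
  by apply: eq_bigr => b _; rewrite mulr1.
have -> : qf (Hl c) v one = Hv v c.
  rewrite /qf /Hv; apply: eq_bigr => a _; rewrite mulrC Hsym -Hl_row.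
  by congr (_ * _); apply: eq_bigr => b _; rewrite mulr1.
have [rc|rc] := eqVneq (r c) 0; last first.
  have rp : 0 < r c by rewrite lt_def rc r0.
  rewrite -ler_pdivlMr// => h; apply: (le_trans h).
  by rewrite -expr2 /A exprMn exprVn expr2 [r c ^+ 2]expr2; rewrite le_eqVlt; apply/orP; left; apply/eqP; field.
move=> _; rewrite rc mul0r /qf big1// => a _; rewrite big1 ?mulr0// => b _.
have : Hl c a b = 0; last by move=> ->; rewrite mul0r.
apply: (sum_eq0_ge0 (Hl0 c a)); rewrite Hl_row Hsym.
exact: (sum_eq0_ge0 (H0 c) rc).
Qed.

Let qf_norm v : - ip v v <= qf H v v.
Proof.
have e : ip v v = \sum_a \sum_b H a b * (v a ^+ 2 + v b ^+ 2) / 2.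
  transitivity (\sum_a \sum_b H a b * v a ^+ 2 / 2 + \sum_a \sum_b H a b * v b ^+ 2 / 2).
    rewrite [X in _ + X]exchange_big/= -big_split/=; apply: eq_bigr => a _.
    have -> : \sum_j H j a * v a ^+ 2 / 2 = \sum_b H a b * v a ^+ 2 / 2.
      by apply: eq_bigr => b _; rewrite Hsym.
    by rewrite -!mulr_suml -/(r a); field.
  rewrite -big_split/=; apply: eq_bigr => a _.
  by rewrite -big_split/=; apply: eq_bigr => b _; field.
rewrite e -sumrN; apply: ler_sum => a _; rewrite -sumrN mulr_sumr.
apply: ler_sum => b _; have := H0 a b; have := sqr_ge0 (v a + v b) => h1 h2.
by have := mulr_ge0 h2 h1; lra.
Qed.

Let orth v := \sum_a r a * v a = 0.

Let orthA v : orth v -> orth (A v).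
Proof.
rewrite /orth => h; under eq_bigr do rewrite rA.
rewrite /Hv exchange_big/= -[RHS]h; apply: eq_bigr => b _.
by rewrite -mulr_suml; congr (_ * _); apply: eq_bigr => a _; rewrite Hsym.
Qed.

Let orthD u v k : orth u -> orth v -> orth (fun a => u a + k * v a).
Proof.
rewrite /orth => hu hv; under eq_bigr do rewrite mulrDr mulrCA.
by rewrite big_split/= -mulr_sumr hu hv mulr0 addr0.
Qed.

Let bounded s := forall v, orth v -> qf H v v <= s * ip v v.

(** Since eigenvalues [l] satisfy [l <= l ^ 2], none lies strictly between 0
    and 1; quantitatively, a bound [s < 1] on the spectrum can be lowered. *)
Let bounded_improve s : 0 <= s <= 1 -> bounded s ->
  bounded (s * (1 - (1 - s) / 3)).
Proof.
move=> /andP[s0 s1] hs v ov.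
pose z a := (fun=> 0) a + s * v a.
have oz : orth z.
  by apply: orthD => //; rewrite /orth big1// => a _; rewrite mulr0.
pose w a := z a + (-1) * A v a.
have ow : orth w by apply: orthD => //; exact: orthA.
have q0 u : ip (fun=> 0) u = 0 by rewrite /ip big1// => a _; rewrite mul0r mulr0.
have p0 u : qf H (fun=> 0) u = 0 by rewrite /qf big1// => a _; rewrite mul0r.
set N := ip v v; set Q := qf H v v.
have vw : ip v w = s * N - Q by rewrite ipDr ipDr ipC q0 ipA -/N -/Q; ring.
have AA : ip (A v) (A v) = s ^+ 2 * N - 2 * s * ip v w + ip w w.
  have -> : ip w w = ip w z - ip w (A v) by rewrite {2}/w ipDr; ring.
  have -> : ip w z = s * ip v w by rewrite ipC {1}/z ipDl q0 add0r.
  have -> : ip w (A v) = s * Q - ip (A v) (A v).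
    by rewrite /w ipDl /z ipDl q0 ipA -/Q; ring.
  by rewrite vw; ring.
have PW : s * ip w w - qf H w w <= 2 * ip w w.
  by have := qf_norm w; have := ip_ge0 w; nra.
have PVW : s * ip v w - qf H v w = ip w w.
  have -> : ip w w = ip z w - ip (A v) w by rewrite {1}/w ipDl; ring.
  have -> : ip z w = s * ip v w by rewrite /z ipDl q0 add0r.
  by rewrite [ip (A v) w]ipC ipA (qfC w v Hsym).
(* With [w = (s - A) v], the form [s - H] is non-negative at [v - w / 2]. *)
clearbody w; have := hs (fun a => v a + (- 2^-1) * w a) (orthD _ ov ow).
rewrite qfDl !qfDr ipDl !ipDr (qfC w v Hsym) (ipC w v) -/N -/Q => P.
have ww : ip w w <= 2 * (s * N - Q) by lra.
have lb := link_bound v; rewrite AA vw -/Q in lb.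
have e0 : 0 <= s * N - Q by have := hs v ov; rewrite -/N -/Q; lra.
have se0 : 0 <= s * (s * N - Q) by rewrite mulr_ge0.
by lra.
Qed.

(** Some gap exists because all off-diagonal entries charged by [r] are positive:
    compare the Dirichlet form of [H] with that of the complete graph. *)
Let gap : exists2 s, 0 < s < 1 & bounded s.
Proof.
set T := \sum_a r a.
have T0 : 0 <= T by exact: sumr_ge0.
have dirichlet v : \sum_a \sum_b H a b * (v a - v b) ^+ 2 / 2 = ip v v - qf H v v.
  have -> : ip v v - qf H v v = (\sum_a \sum_b H a b * v a ^+ 2 / 2 +
      \sum_a \sum_b H a b * v b ^+ 2 / 2) - qf H v v.
    congr (_ - _); rewrite [X in _ + X]exchange_big/= -big_split/=.
    apply: eq_bigr => a _.
    have -> : \sum_j H j a * v a ^+ 2 / 2 = \sum_b H a b * v a ^+ 2 / 2.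
      by apply: eq_bigr => b _; rewrite Hsym.
    by rewrite -!mulr_suml -/(r a); field.
  rewrite /qf -big_split/= -sumrB; apply: eq_bigr => a _.
  rewrite -big_split/= mulr_sumr -sumrB.
  by apply: eq_bigr => b _; field.
have poincare v : orth v ->
    \sum_a \sum_b r a * r b * (v a - v b) ^+ 2 / 2 = T * ip v v.
  move=> ov.
  transitivity (\sum_a \sum_b (r a * v a ^+ 2 / 2 * r b + r b * v b ^+ 2 / 2 * r a
      - r a * v a * (r b * v b))).
    by apply: eq_bigr => a _; apply: eq_bigr => b _; field.
  transitivity (\sum_a (r a * v a ^+ 2 / 2 * T + (ip v v) / 2 * r a)).
    apply: eq_bigr => a _; rewrite sumrB big_split/= -!mulr_sumr ov mulr0 subr0.
    rewrite -!mulr_suml; congr (_ + _ / 2 * _).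
  rewrite big_split/= -!mulr_suml -mulr_sumr -/T.
  have -> : \sum_i r i * v i ^+ 2 = ip v v by apply: eq_bigr => b _; rewrite expr2.
  by field.
have lower v : c0 * (\sum_a \sum_b r a * r b * (v a - v b) ^+ 2 / 2)
    <= ip v v - qf H v v.
  rewrite -dirichlet mulr_sumr; apply: ler_sum => a _; rewrite mulr_sumr.
  apply: ler_sum => b _; have [->|/H_gap h] := eqVneq a b.
    by rewrite subrr expr0n/= !mulr0 mul0r mulr0.
  by have := sqr_ge0 (v a - v b); nra.
have [T00|Tn] := eqVneq T 0.
  exists 2^-1; first by lra.
  move=> v ov; have := lower v; rewrite poincare// T00 mul0r mulr0.
  suff -> : ip v v = 0 by rewrite mulr0 sub0r oppr_ge0.
  by rewrite /ip big1// => a _; rewrite (sum_eq0_ge0 r0 T00) mul0r.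
have Tp : 0 < T by rewrite lt_def Tn.
have cT : 0 < c0 * T by rewrite mulr_gt0.
have m1 : Num.min 2^-1 (c0 * T) <= 2^-1 by rewrite ge_min lexx.
have m2 : Num.min 2^-1 (c0 * T) <= c0 * T by rewrite ge_min lexx orbT.
have m0 : 0 < Num.min 2^-1 (c0 * T) by rewrite lt_min cT invr_gt0 ltr0n.
exists (1 - Num.min 2^-1 (c0 * T)); first by lra.
move=> v ov; have := lower v; rewrite poincare// mulrA.
by have := ler_wpM2r (ip_ge0 v) m2; lra.
Qed.

(** Iterating the improvement drives the spectral bound on the orthogonal
    complement of [one] to 0. *)
Lemma trickle_down : lorentz H.
Proof.
have [s0 s01 hs0] := gap.
pose q := 1 - (1 - s0) / 3.
have q01 : 0 < q < 1 by rewrite /q; lra.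
have hq n : bounded (s0 * q ^+ n).
  elim: n => [|n IH]; first by rewrite expr0 mulr1.
  have sn : 0 <= s0 * q ^+ n <= s0.
    rewrite mulr_ge0 ?exprn_ge0//=; [|lra|lra].
    by rewrite ler_piMr ?exprn_ile1//; lra.
  move=> v ov; have := bounded_improve (ltac:(lra) : 0 <= s0 * q ^+ n <= 1) IH ov.
  move/le_trans; apply; rewrite ler_wpM2r// exprSr mulrA ler_wpM2l//; rewrite /q; lra.
have neg v : orth v -> qf H v v <= 0.
  move=> ov; apply: (le0_geometric q01 (y := s0 * ip v v)) => n.
  by rewrite mulrCA mulrA; exact: hq.
move=> v; set T := qf H one one.
have oneE u : qf H u one = \sum_a r a * u a.
  by apply: eq_bigr => a _; rewrite mulrC; congr (_ * _); apply: eq_bigr => b _; rewrite mulr1.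
have [->|Tn] := eqVneq T 0; first by rewrite mulr0 sqr_ge0.
have T0 : 0 < T.
  by rewrite lt_def Tn /T oneE sumr_ge0// => a _; rewrite mulr1.
set x := qf H v one; have := neg (fun a => v a + (- (x / T)) * one a).
rewrite qfDl !qfDr (qfC one v Hsym) -/x -/T => /(_ _) h.
have {h} : qf H v v + - (x / T) * x + - (x / T) * (x + - (x / T) * T) <= 0.
  apply: h; have := oneE (fun a => v a + (- (x / T)) * one a).
  by rewrite qfDl -/x -/T => h; rewrite /orth -h; field.
have -> : qf H v v + - (x / T) * x + - (x / T) * (x + - (x / T) * T) =
  qf H v v - x ^+ 2 / T by field.
by rewrite subr_le0 ler_pdivlMr.
Qed.

End TrickleDown.
End Lorentz.

(** * Entropy decay for Lorentzian exchangeable laws *)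

Section PairEntropy.
Variables (R : realType) (I : finType).

(** A Lorentzian pair law contracts relative entropy by one half under taking a
    marginal. By log-sum, the gap between the two sides is at least
    [- t * ln (qf H y y * qf H 1 1 / t ^ 2)], where [y] is the ratio of
    the marginals, and Lorentzianity says that this logarithm is [<= 0]. *)
Lemma lorentz_entropy (H H' : I -> I -> R) :
  (forall a b, H a b = H b a) -> (forall a b, H' a b = H' b a) ->
  (forall a b, 0 <= H a b) -> (forall a b, 0 <= H' a b) ->
  (forall a b, H a b = 0 -> H' a b = 0) -> lorentz H ->
  2 * (\sum_a (\sum_b H' a b) * ln ((\sum_b H' a b) / \sum_b H a b)) <=
  \sum_a \sum_b H' a b * ln (H' a b / H a b) +
  (\sum_a \sum_b H' a b) * ln ((\sum_a \sum_b H' a b) / \sum_a \sum_b H a b).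
Proof.
move=> Hs Hs' H0 H'0 HH' HL.
set r := fun a => \sum_b H a b; set r' := fun a => \sum_b H' a b.
set t := \sum_a \sum_b H a b; set t' := \sum_a \sum_b H' a b.
have r0 a : 0 <= r a by exact: sumr_ge0.
have r'0 a : 0 <= r' a by exact: sumr_ge0.
have [t'0|t'n] := eqVneq t' 0.
  have z a : r' a = 0 by apply: (sum_eq0_ge0 r'0 t'0).
  have z2 a b : H' a b = 0 by apply: (sum_eq0_ge0 (H'0 a) (z a)).
  rewrite t'0 mul0r addr0 big1 ?mulr0 => [|a _]; last by rewrite -/(r' a) z mul0r.
  by rewrite big1// => a _; rewrite big1// => b _; rewrite z2 mul0r.
have t'p : 0 < t' by rewrite lt_def t'n /=; apply: sumr_ge0 => a _; exact: r'0.
have rr' a : r a = 0 -> r' a = 0.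
  by move=> ra; rewrite /r' big1// => b _; apply: HH'; exact: (sum_eq0_ge0 (H0 a) ra).
pose y a := r' a / r a.
have ry a : r a * y a = r' a.
  rewrite /y; have [ra|ra] := eqVneq (r a) 0; last by rewrite mulrC divfK.
  by rewrite ra mul0r rr'.
have y0 a : 0 <= y a by rewrite divr_ge0.
have H'pos a b : H' a b != 0 -> [/\ 0 < H a b, 0 < y a & 0 < y b].
  move=> h; have hp : 0 < H' a b by rewrite lt_def h H'0.
  have Hp : 0 < H a b by rewrite lt_def H0 andbT; apply: contra h => /eqP/HH'->.
  have pos (G : I -> I -> R) c d : (forall a b, 0 <= G a b) -> 0 < G c d -> 0 < \sum_b G c b.
    by move=> G0 g; rewrite (bigD1 d)//= ltr_pwDl//; apply: sumr_ge0.
  split=> //; apply: divr_gt0; rewrite ?(pos H' a b) ?(pos H a b)//.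
    by apply: (pos H' b a) => //; rewrite Hs'.
  by apply: (pos H b a) => //; rewrite Hs.
(* Compare [H'] with the pair law [H a b * y a * y b], which has nearly the same
   marginals. *)
have ls := @log_sum R (I * I)%type (fun p => H' p.1 p.2)
  (fun p => H p.1 p.2 * (y p.1 * y p.2)) (fun p => H'0 _ _)
  (fun p => mulr_ge0 (H0 _ _) (mulr_ge0 (y0 _) (y0 _))).
have qp (p : I * I) : H p.1 p.2 * (y p.1 * y p.2) = 0 -> H' p.1 p.2 = 0.
  move=> h; apply/eqP; apply: contraTT isT => /H'pos[h1 h2 h3].
  have hq : 0 < H p.1 p.2 * (y p.1 * y p.2) by do 2?apply: mulr_gt0.
  by move: hq; rewrite h ltxx.
have {ls} := ls qp.
rewrite -(pair_bigA _ H') /= -/t'.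
rewrite -(pair_bigA _ (fun a b => H a b * (y a * y b))) /=.
rewrite -(pair_bigA _ (fun a b => H' a b * ln (H' a b / (H a b * (y a * y b))))) /=.
set Y := \sum_a \sum_b H a b * _ => ls.
have YE : Y = qf H y y.
  by apply: eq_bigr => a _; rewrite mulr_sumr; apply: eq_bigr => b _; ring.
have Y0 : 0 <= Y.
  apply: sumr_ge0 => a _; apply: sumr_ge0 => b _. by do 2?apply: mulr_ge0.
have Yp : 0 < Y.
  rewrite lt_def Y0 andbT; apply: contra t'n => /eqP Yz.
  rewrite /t' big1// => a _; rewrite big1// => b _; apply: (qp (a, b)) => /=.
  move: Yz; rewrite /Y => /sum_eq0_ge0 h.
  have {}h c : \sum_b H c b * (y c * y b) = 0.
    by apply: h => d; apply: sumr_ge0 => e _; do 2?apply: mulr_ge0.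
  by have := h a => /sum_eq0_ge0; apply => d; do 2?apply: mulr_ge0.
have tp : 0 < t.
  rewrite lt_def /t sumr_ge0 ?andbT => [|a _]; last exact: sumr_ge0.
  apply: contra t'n => /eqP/(sum_eq0_ge0 r0) h.
  by rewrite /t' big1// => a _; exact: rr'.
have Yle : Y * t <= t' ^+ 2.
  have := HL y; rewrite -YE.
  have -> : qf H (@one _ I) (@one _ I) = t.
    by apply: eq_bigr => a _; rewrite mul1r; apply: eq_bigr => b _; rewrite mulr1.
  have -> // : qf H y (@one _ I) = t'.
  apply: eq_bigr => a _; rewrite -[RHS]/(r' a) -ry mulrC.
  by congr (_ * _); apply: eq_bigr => b _; rewrite mulr1.
have lnY : ln Y + ln t <= 2 * ln t'.
  rewrite -lnM ?posrE//; have -> : 2 * ln t' = ln (t' ^+ 2).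
    by rewrite lnXn// mulr_natl.
  by rewrite ler_ln ?posrE ?mulr_gt0// exprn_gt0.
have split : \sum_a \sum_b H' a b * ln (H' a b / (H a b * (y a * y b))) =
   \sum_a \sum_b H' a b * ln (H' a b / H a b) - 2 * \sum_a r' a * ln (r' a / r a).
  transitivity (\sum_a \sum_b (H' a b * ln (H' a b / H a b)
      - H' a b * ln (y a) - H' b a * ln (y b))).
    apply: eq_bigr => a _; apply: eq_bigr => b _; rewrite (Hs' b a).
    have [->|/[dup] h /H'pos[h1 h2 h3]] := eqVneq (H' a b) 0; first by rewrite !mul0r !subr0.
    have hp : 0 < H' a b by rewrite lt_def h H'0.
    rewrite (ln_divE hp h1) (ln_divE hp (mulr_gt0 h1 (mulr_gt0 h2 h3))).
    have -> : ln (H a b * (y a * y b)) = ln (H a b) + (ln (y a) + ln (y b)).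
      rewrite (lnM h1); last by rewrite posrE mulr_gt0.
      by congr (_ + _); rewrite (lnM h2).
    by ring.
  have e1 : \sum_a \sum_b H' a b * ln (y a) = \sum_a r' a * ln (r' a / r a).
    by apply: eq_bigr => a _; rewrite -mulr_suml.
  have e2 : \sum_a \sum_b H' b a * ln (y b) = \sum_a r' a * ln (r' a / r a).
    by rewrite exchange_big/= -e1; apply: eq_bigr.
  under eq_bigr do rewrite !sumrB.
  by rewrite !sumrB e1 e2; ring.
rewrite split ln_divE// in ls; rewrite ln_divE//.
by have := ler_wpM2l (ltW t'p) lnY; lra.
Qed.

End PairEntropy.

(** A finite minimum of ratios. *)
Lemma gap_exists (R : realType) (J : finType) (F G : J -> R) :
  (forall j, 0 <= F j) -> (forall j, 0 <= G j) ->
  (forall j, 0 < G j -> 0 < F j) -> exists2 c, 0 < c & forall j, c * G j <= F j.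
Proof.
move=> F0 G0 GF; pose d j := G j / F j.
have d0 j : 0 <= d j by rewrite divr_ge0.
have s0 : 0 <= \sum_j d j by exact: sumr_ge0.
exists (1 + \sum_j d j)^-1; first by rewrite invr_gt0; lra.
move=> j; rewrite mulrC ler_pdivrMr; last by lra.
have := G0 j; rewrite le_eqVlt => /orP[/eqP<-|Gp].
  by rewrite mulr_ge0//; lra.
have Fp := GF j Gp.
have -> : G j = F j * d j by rewrite /d mulrC divfK ?gt_eqF.
rewrite ler_pM2l// (bigD1 j)//=.
have : 0 <= \sum_(i | i != j) d i by exact: sumr_ge0.
by lra.
Qed.

Lemma big_option (R : realType) (I : finType) (F : option I -> R) :
  \sum_a F a = F None + \sum_i F (Some i).
Proof.
rewrite (bigD1 None)//=; congr (_ + _).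
rewrite (reindex_omap Some id)//=; last by case.
by apply: eq_bigl => i; rewrite eqxx.
Qed.

(** * Exchangeable words and their prefixes *)

(** A configuration with plus set [S] is read as a word of [n] letters in random
   order, the letters being the elements of [S] and [n - #|S|] copies of a
   blank, written [None]. The set of non-blank letters of a prefix is all that
   matters about it; [None] marks an impossible prefix, where a letter
   repeats. *)

Section Letters.
Variables (R : realType) (n : nat).
Implicit Types (T S : {set 'I_n}) (a b c : option 'I_n) (o : option {set 'I_n}).

Definition add o a : option {set 'I_n} :=
  match o, a with
  | None, _ => None
  | Some T, None => Some T
  | Some T, Some i => if i \in T then None else Some (i |: T)
  end.

Lemma addAC o a b : add (add o a) b = add (add o b) a.
Proof.
case: o => [T|//]; case: a => [i|]; case: b => [j|] //=.
- case: (boolP (i \in T)) => iT; case: (boolP (j \in T)) => jT //=.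
  + by rewrite !inE iT orbT.
  + by rewrite !inE jT orbT.
  rewrite !inE (negbTE iT) (negbTE jT) !orbF eq_sym; case: (i =P j) => // _.
  by rewrite finset.setUCA.
- by case: ifP.
- by case: ifP.
Qed.

Lemma add_neq o a b : a != b -> add o a != None -> add o b != None ->
  add (add o a) b != None.
Proof.
case: o => [T|//]; case: a => [i|]; case: b => [j|] //=.
- case: ifPn => // iT ab _; case: ifPn => // jT _ /=.
  rewrite !inE (negbTE jT) orbF; case: (j =P i) => // e.
  by move: ab; rewrite e eqxx.
- by move=> _; case: ifP.
Qed.

(** [level mu r] is the weight of a prefix that [r] letters complete, when
    [mu] is the weight of complete words. *)
Fixpoint level (mu : {set 'I_n} -> R) r o : R :=
  if r is r'.+1 then \sum_a level mu r' (add o a) else oapp mu 0 o.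

Section Levels.
Variable mu : {set 'I_n} -> R.

Lemma level_None r : level mu r None = 0.
Proof. by elim: r => //= r IH; rewrite big1. Qed.

Hypothesis mu0 : forall T, 0 <= mu T.

Lemma level_ge0 r o : 0 <= level mu r o.
Proof.
by elim: r o => [[T|]|r IH o] //=; apply: sumr_ge0.
Qed.

End Levels.

Lemma level_gt0 mu r T : (forall T, 0 < mu T) -> 0 < level mu r (Some T).
Proof.
move=> mu0; elim: r => //= r IH; rewrite big_option/=.
by rewrite ltr_pwDl// sumr_ge0// => i _; apply: level_ge0 => S; exact: ltW.
Qed.

Definition link mu r o a b := level mu r (add (add o a) b).

Lemma linkC mu r o a b : link mu r o a b = link mu r o b a.
Proof. by rewrite /link addAC. Qed.

(** Only links of prefixes of length [n - 2] need to be inspected. *)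
Lemma lorentz_levels mu : (forall T, 0 < mu T) ->
  (forall T, (#|T| + 2 <= n)%N -> lorentz (link mu 0 (Some T))) ->
  forall r T, (#|T| + 2 + r <= n)%N -> lorentz (link mu r (Some T)).
Proof.
move=> mu0 base; have muW T := ltW (mu0 T); elim=> [|r IH] T hT.
  by apply: base; rewrite addn0 in hT.
pose H := link mu r.+1 (Some T).
pose Hl c := link mu r (add (Some T) c).
have rE a : \sum_b H a b = level mu r.+2 (add (Some T) a) by [].
(* Pairs of distinct letters that can both follow can follow each other, so the
   entries [H a b] dominate [r a * r b] off the diagonal. *)
have [|||c c0 hc] := @gap_exists R (option 'I_n * option 'I_n)%type
  (fun p => if p.1 != p.2 then H p.1 p.2 else 1)
  (fun p => if p.1 != p.2 then (\sum_b H p.1 b) * (\sum_b H p.2 b) else 0).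
- by move=> [a b]/=; case: ifP => // _; exact: level_ge0.
- move=> [a b]/=; case: ifP => // _.
  by rewrite mulr_ge0//; apply: sumr_ge0 => d _; exact: level_ge0.
- move=> [a b]/=; case: ifPn => // ab; rewrite !rE => h.
  have [na|na] := eqVneq (add (Some T) a) None.
    by move: h; rewrite na level_None mul0r ltxx.
  have [nb|nb] := eqVneq (add (Some T) b) None.
    by move: h; rewrite nb level_None mulr0 ltxx.
  rewrite /H /link; case e: (add _ b) => [S|]; first exact: level_gt0.
  by have := add_neq ab na nb; rewrite e.
apply: (@trickle_down R _ H Hl c) => //.
- by move=> a b; exact: linkC.
- by move=> a b; exact: level_ge0.
- by move=> d a b; exact: level_ge0.
- move=> a b; apply: eq_bigr => d _; rewrite /Hl /link.
  by rewrite (addAC (add _ a)) (addAC _ a d).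
- by move=> d a; rewrite -[LHS]/(link mu r.+1 (Some T) d a) linkC.
- move=> d; rewrite /Hl; case e: (add (Some T) d) => [S|]; last first.
    move=> v; rewrite /qf; have z a b : link mu r None a b = 0 by exact: level_None.
    rewrite big1 ?mul0r ?sqr_ge0// => a _; rewrite big1 ?mulr0// => b _.
    by rewrite z mul0r.
  apply: IH; move: e => /=; case: d => [i|[<-]]; last by apply: leq_trans hT; rewrite leq_add2l.
  by case: ifPn => // iT [<-]; apply: leq_trans hT; rewrite cardsU1 iT /= add1n addSn addSnnS -addSnnS addSn.
by move=> a b ab; have := hc (a, b); rewrite /= ab.
Qed.

(** Summing over prefixes with [m] letters, each counted with its number of
    orderings, then over the next letter. *)
Lemma level_collapse (g : option {set 'I_n} -> R) k : g None = 0 ->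
  \sum_(T : {set 'I_n}) (k ^_ #|T|)%:R * (\sum_a g (add (Some T) a))
    = \sum_(T : {set 'I_n}) (k.+1 ^_ #|T|)%:R * g (Some T).
Proof.
move=> g0.
transitivity (\sum_(T : {set 'I_n}) ((k ^_ #|T|)%:R * g (Some T) +
   \sum_i (if i \notin T then (k ^_ #|T|)%:R * g (Some (i |: T)) else 0))).
  apply: eq_bigr => T _; rewrite big_option/= mulrDr mulr_sumr; congr (_ + _).
  by apply: eq_bigr => i _; case: ifP => //=; rewrite g0 mulr0.
rewrite big_split/= exchange_big/=.
have -> : \sum_i \sum_(T : {set 'I_n})
     (if i \notin T then (k ^_ #|T|)%:R * g (Some (i |: T)) else 0) =
   \sum_i \sum_(S : {set 'I_n} | i \in S) (k ^_ #|S|.-1)%:R * g (Some S).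
  apply: eq_bigr => i _; rewrite -big_mkcond/=.
  rewrite (reindex_onto (fun S : {set 'I_n} => S :\ i) (fun T => i |: T))/=; last first.
    by move=> T iT; rewrite finset.setU1K.
  apply: eq_big => [S|S]; first by rewrite finset.setD11/=; apply/eqP/idP => [<-|/finset.setD1K//]; rewrite finset.setU11.
  move=> /andP[_ /eqP e]; have iS : i \in S by rewrite -e finset.setU11.
  by rewrite e (cardsD1 i S) iS.
rewrite [X in _ + X](exchange_big_dep predT)//= -big_split/=.
apply: eq_bigr => T _; rewrite sumr_const -(mulr_natl (_ * _)) mulrA -mulrDl.
congr (_ * _); rewrite -natrM -natrD; congr (_%:R).
case: (#|T|) => [|m]; first by rewrite mul0n addn0.
rewrite ffactSS ffactnSr /=; case: (leqP m k) => h; last by rewrite ffact_small// !muln0.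
by rewrite mulnC -mulnDl; congr (_ * _)%N; lia.
Qed.

Section Convexity.
Variables mu mu' : {set 'I_n} -> R.
Hypothesis mu0 : forall T, 0 < mu T.
Hypothesis mu'0 : forall T, 0 <= mu' T.
Hypothesis base : forall T, (#|T| + 2 <= n)%N -> lorentz (link mu 0 (Some T)).

(** The relative entropy of the laws of the first [n - r] letters. *)
Let g r o := level mu' r o * ln (level mu' r o / level mu r o).
Definition level_ent r := \sum_(T : {set 'I_n}) ((n - r) ^_ #|T|)%:R * g r (Some T).

Let gN r : g r None = 0. Proof. by rewrite /g level_None mul0r. Qed.

Lemma level_ent_convex r : (r + 2 <= n)%N ->
  2 * level_ent r.+1 <= level_ent r + level_ent r.+2.
Proof.
move=> rn; have n1 : (n - r)%N = (n - r.+2).+2 by lia.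
have n2 : (n - r.+1)%N = (n - r.+2).+1 by lia.
rewrite /level_ent n1 n2 -(level_collapse _ (gN r)) -(level_collapse _ (gN r.+1)).
rewrite -(@level_collapse (fun o => \sum_b g r (add o b))); last first.
  by rewrite big1// => a _; exact: gN.
rewrite mulr_sumr -big_split/=; apply: ler_sum => T _.
rewrite mulrCA -mulrDr; have [h|h] := leqP #|T| (n - r.+2); last first.
  by rewrite ffact_small// !mul0r.
rewrite ler_wpM2l ?ler0n//.
have := @lorentz_entropy R _ (link mu r (Some T)) (link mu' r (Some T)).
apply.
- by move=> a b; exact: linkC.
- by move=> a b; exact: linkC.
- by move=> a b; apply: level_ge0 => S; exact: ltW.
- by move=> a b; exact: level_ge0.
- move=> a b; rewrite /link; case: (add _ b) => [S|]; last by rewrite !level_None.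
  by move/eqP; rewrite gt_eqF// level_gt0.
by apply: lorentz_levels => //; lia.
Qed.

(** The increments of a convex sequence increase, so the last one is at least
    the average. *)
Lemma level_ent_drop : (0 < n)%N ->
  level_ent 0 - level_ent n <= n%:R * (level_ent 0 - level_ent 1).
Proof.
move=> n0; have h r : (r < n)%N -> level_ent r - level_ent r.+1 <= level_ent 0 - level_ent 1.
  elim: r => [//|r IH] rn; have := level_ent_convex (r := r) ltac:(lia).
  by have := IH ltac:(lia); lra.
have tele k : (k <= n)%N -> level_ent 0 - level_ent k <= k%:R * (level_ent 0 - level_ent 1).
  elim: k => [_|k IH kn]; first by rewrite subrr mul0r.
  by have := IH ltac:(lia); have := h k kn; rewrite -natr1 mulrDl mul1r; lra.
exact: tele.
Qed.

End Convexity.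
End Letters.

(** * The polarized down-operator *)

Section Down.
Variables (R : realType) (n : nat).
Hypothesis n_gt0 : (0 < n)%N.
Implicit Types (T S : {set 'I_n}) (x y : spins n).

Definition sp T : spins n := [ffun i => i \in T].

Lemma spK : cancel sp (@plus n).
Proof. by move=> T; apply/setP => i; rewrite !inE ffunE. Qed.

Lemma plusK : cancel (@plus n) sp.
Proof. by move=> x; apply/ffunP => i; rewrite ffunE inE. Qed.

Lemma big_sp (F : spins n -> R) : \sum_x F x = \sum_(T : {set 'I_n}) F (sp T).
Proof. by rewrite (reindex sp)//; exists (@plus n) => ? _; rewrite ?spK ?plusK. Qed.

Let nR : (n%:R : R) != 0. Proof. by rewrite pnatr_eq0 -lt0n. Qed.

Lemma setD1_notin (T : {set 'I_n}) i : i \notin T -> T :\ i = T.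
Proof.
by move=> iT; apply/setP => j; rewrite !inE; case: eqP => // ->; rewrite (negbTE iT).
Qed.

Lemma DpolE x T : Dpol R x T = n%:R^-1 * \sum_i (T == plus x :\ i)%:R.
Proof.
rewrite /Dpol; case: existsP => [[i /andP[ix /eqP e]]|h].
  rewrite (bigD1 i)//= e eqxx big1 ?addr0 ?mulr1// => j ji.
  case: eqP => // /setP/(_ i); rewrite !inE eqxx/= eq_sym ji.
  by move: ix; rewrite inE => ->.
case: eqP => [e|ne]; last first.
  rewrite big1 ?mulr0// => i _; case: eqP => // e; case: h; exists i.
  rewrite e eqxx andbT; apply/negPn/negP => ix; apply: ne; rewrite e.
  by rewrite setD1_notin.
have -> : \sum_i (T == plus x :\ i)%:R = \sum_(i in ~: plus x) 1 :> R.
  rewrite [RHS]big_mkcond/=; apply: eq_bigr => i _.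
  have -> : (T == plus x :\ i) = (i \in ~: plus x); last by case: ifP.
  rewrite inE; apply/eqP/idP => [eT|ix].
    apply/negP => ix; case: h; exists i; rewrite ix; exact/eqP.
  by rewrite e setD1_notin.
have e' : #|~: plus x|%:R = n%:R - #|plus x|%:R :> R.
  have := cardsC (plus x); rewrite card_ord => /(congr1 (fun k => k%:R : R)).
  by rewrite natrD => <-; rewrite addrAC subrr add0r.
by rewrite sumr_const e' mulrC.
Qed.

Lemma Dpol_sum x (G : {set 'I_n} -> R) :
  \sum_T Dpol R x T * G T = n%:R^-1 * \sum_i G (plus x :\ i).
Proof.
under eq_bigr do rewrite DpolE -mulrA mulr_suml.
rewrite -mulr_sumr; congr (_ * _); rewrite exchange_big/=; apply: eq_bigr => i _.
rewrite (bigD1 (plus x :\ i))//= eqxx mul1r big1 ?addr0// => T /negbTE->.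
by rewrite mul0r.
Qed.

Lemma Dpol_adj (F : spins n -> R) T :
  \sum_x F x * Dpol R x T
    = n%:R^-1 * \sum_(i | i \notin T) (F (sp T) + F (sp (i |: T))).
Proof.
under eq_bigr do rewrite DpolE mulrCA mulr_sumr.
rewrite -mulr_sumr; congr (_ * _); rewrite exchange_big/= [RHS]big_mkcond/=.
apply: eq_bigr => i _; rewrite big_sp; case: ifPn => iT; last first.
  rewrite big1// => S _; rewrite spK; case: eqP => [e|]; last by rewrite mulr0.
  by move: iT; rewrite e !inE eqxx.
have ne : T != i |: T by apply/eqP => /setP/(_ i); rewrite !inE eqxx (negbTE iT).
rewrite (bigD1 T)//= (bigD1 (i |: T)) ?(eq_sym _ T)//= big1 => [|S /andP[S1 S2]].
  rewrite !spK; have -> : T == T :\ i.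
    by rewrite setD1_notin.
  by rewrite finset.setU1K// eqxx !mulr1 addr0.
rewrite spK; case: eqP => [e|]; last by rewrite mulr0.
have [iS|iS] := boolP (i \in S).
  by move: S2; rewrite e finset.setD1K ?eqxx.
move: S1; rewrite e; rewrite setD1_notin//.
by rewrite eqxx.
Qed.

Lemma Dpol_ge0 x T : 0 <= Dpol R x T.
Proof.
by rewrite DpolE mulr_ge0 ?invr_ge0// sumr_ge0.
Qed.

Lemma Dpol_total x : \sum_T Dpol R x T = 1.
Proof.
transitivity (\sum_T Dpol R x T * 1); first by apply: eq_bigr => T _; rewrite mulr1.
by rewrite Dpol_sum sumr_const card_ord mulVf.
Qed.

Section Base.
Variables (om : nat -> R) (lam : 'I_n -> R) (w : spins n -> R).
Hypothesis om_gt0 : forall k, 0 < om k.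
Hypothesis om_logconcave : forall k, om k * om k.+2 <= om k.+1 ^+ 2.
Hypothesis lam_gt0 : forall i, 0 < lam i.
Hypothesis wE : forall x, w x = om #|plus x| * \prod_(i in plus x) lam i.

Lemma base_weight_gt0 x : 0 < w x.
Proof. by rewrite wE mulr_gt0// prodr_gt0. Qed.

(* The weight of a set is shared among its orderings: the letters of [T] can be
   placed in [n ^_ #|T|] ways, the blanks being indistinguishable. *)
Let word (v : spins n -> R) T : R := v (sp T) / (n ^_ #|T|)%:R.

Let ffact_pos k T : (#|T| <= k)%N -> 0 < (k ^_ #|T|)%:R :> R.
Proof. by move=> h; rewrite ltr0n ffact_gt0. Qed.

Let cardT T : (#|T| <= n)%N.
Proof. by rewrite -[leqRHS]card_ord max_card. Qed.

(** The link of a prefix using all but two letters. Divide by the weight of the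
    prefix: with [N] letters left the form is
    [a z ^ 2 + 2 b z s + c (s ^ 2 - sum_i (lam_i v_i) ^ 2)], where
    [s = sum_i lam_i v_i]; it is Lorentzian at the blank letter [z] because
    [sum_i (lam_i v_i) ^ 2 >= s ^ 2 / N] and [om] is log-concave. *)
Let link_lorentz T : (#|T| + 2 <= n)%N -> lorentz (link (word w) 0 (Some T)).
Proof.
move=> hT; set s := #|T|; pose N : R := (n - s)%:R.
have N2 : 2 <= N by rewrite ler_nat /s; lia.
pose L : R := (\prod_(i in T) lam i) / (n ^_ s)%:R.
have L0 : 0 < L by rewrite divr_gt0 ?prodr_gt0// ffact_pos.
have fS : (n ^_ s.+1)%:R = (n ^_ s)%:R * N :> R by rewrite ffactnSr natrM.
have fSS : (n ^_ s.+2)%:R = (n ^_ s)%:R * (N * (N - 1)) :> R.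
  rewrite ffactnSr natrM fS -mulrA; congr (_ * (_ * _)).
  by rewrite /N -[1]/(1%:R) -natrB; [congr (_%:R); lia|lia].
have fp : 0 < (n ^_ s)%:R :> R by exact: ffact_pos.
pose a := om s; pose b := om s.+1 / N; pose c := om s.+2 / (N * (N - 1)).
have a0 : 0 < a := om_gt0 s.
pose H := link (word w) 0 (Some T).
have HC (p q : option 'I_n) : H p q = H q p by exact: linkC.
have Hzz : H None None = L * a.
  rewrite /H /link /= /word wE spK /L -/s /a; field; exact: lt0r_neq0.
have Hzi i : H None (Some i) = if i \in T then 0 else L * (b * lam i).
  rewrite /H /link /=; case: ifPn => //= iT.
  rewrite /word wE spK cardsU1 iT add1n -/s fS big_setU1//= /L /b.
  by field; rewrite !lt0r_neq0//; lra.
have Hij i j : H (Some i) (Some j) =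
    if (i \in T) || (j \in T) || (i == j) then 0 else L * (c * (lam i * lam j)).
  rewrite /H /link /=; case: ifPn => //= iT; rewrite !inE (eq_sym i).
  have [->|ji]/= := eqVneq j i; first by rewrite orbT.
  rewrite orbF; case: ifPn => //= jT.
  rewrite /word wE spK !cardsU1 !inE (negbTE ji)/= iT jT !add1n -/s fSS.
  rewrite big_setU1 ?inE ?negb_or ?ji//= big_setU1//= /L /c.
  by field; rewrite !lt0r_neq0//; lra.
pose u i : R := if i \in T then 0 else lam i.
have qE v v' : qf H v v' = L * (a * v None * v' None
    + b * v None * (\sum_i u i * v' (Some i)) + b * v' None * (\sum_i u i * v (Some i))
    + c * ((\sum_i u i * v (Some i)) * (\sum_i u i * v' (Some i))
           - \sum_i (u i ^+ 2 * (v (Some i) * v' (Some i))))).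
  rewrite /qf big_option big_option Hzz.
  have e1 (x : 'I_n -> R) : \sum_i H None (Some i) * x i = L * b * (\sum_i u i * x i).
    rewrite mulr_sumr; apply: eq_bigr => i _; rewrite Hzi /u.
    by case: ifP => _; ring.
  have -> : \sum_i v (Some i) * (\sum_b0 H (Some i) b0 * v' b0) =
     \sum_i (L * b * v' None * (u i * v (Some i)) + L * c *
        (u i * v (Some i) * (\sum_j u j * v' (Some j)) - u i ^+ 2 * (v (Some i) * v' (Some i)))).
    apply: eq_bigr => i _; rewrite big_option (HC (Some i) None) Hzi.
    have -> : \sum_j H (Some i) (Some j) * v' (Some j) =
       L * c * (u i * (\sum_j u j * v' (Some j)) - u i ^+ 2 * v' (Some i)).
      rewrite (bigD1 i)//= Hij eqxx orbT mul0r add0r.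
      rewrite [\sum_j u j * _](bigD1 i)//=.
      transitivity (L * c * (u i * \sum_(j | j != i) u j * v' (Some j))); last by ring.
      rewrite !mulr_sumr; apply: eq_bigr => j ji; rewrite Hij eq_sym (negbTE ji) orbF /u.
      by case: (i \in T); case: (j \in T) => /=; ring.
    by rewrite /u; case: ifP => _; ring.
  rewrite e1 big_split/= -!mulr_sumr sumrB -mulr_suml; ring.
have Nn : \sum_i (u i ^+ 2 * (1 * 1)) = \sum_i u i ^+ 2 by apply: eq_bigr => i _; rewrite !mulr1.
(* The blank letter is the test vector. *)
apply: (@lorentz_at _ _ H (fun p : option 'I_n => (p == None)%:R)).
- exact: HC.
- rewrite qE /= !big1; [|by move=> i _; rewrite !mulr0..].
  by rewrite !mulr0 subr0 !mulr0 !addr0 !mulr1 mulr_gt0.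
- apply: sumr_ge0 => x _; rewrite mul1r; apply: sumr_ge0 => y _.
  rewrite mulr1; apply: level_ge0 => S; rewrite divr_ge0// ltW//.
  exact: base_weight_gt0.
move=> v; rewrite !qE /=.
set sg := \sum_i u i * v (Some i).
have z1 : \sum_i u i * 0 = 0 :> R by rewrite big1// => i _; rewrite mulr0.
have z2 : \sum_i u i ^+ 2 * (0 * 0) = 0 :> R by rewrite big1// => i _; rewrite !mulr0.
have z3 : \sum_i u i ^+ 2 * (v (Some i) * 0) = 0 :> R by rewrite big1// => i _; rewrite !mulr0.
rewrite !z1 z2 z3; set q := \sum_i u i ^+ 2 * (v (Some i) * v (Some i)).
have cs : sg ^+ 2 <= N * q.
  have qE' : q = \sum_(i in ~: T) (u i * v (Some i)) ^+ 2.
    rewrite [RHS]big_mkcond/=; apply: eq_bigr => i _; rewrite inE /u.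
    by case: ifP => _ /=; rewrite ?expr0n ?mul0r//; ring.
  have sE : sg = \sum_(i in ~: T) (u i * v (Some i)).
    rewrite [RHS]big_mkcond/=; apply: eq_bigr => i _; rewrite inE /u.
    by case: ifP => _ /=; rewrite ?mul0r.
  have NE : N = \sum_(i in ~: T) 1.
    rewrite sumr_const /N; congr (_%:R); have := cardsC T; rewrite card_ord -/s; lia.
  have : 0 <= \sum_(i in ~: T) \sum_(j in ~: T) (u i * v (Some i) - u j * v (Some j)) ^+ 2.
    by apply: sumr_ge0 => i _; apply: sumr_ge0 => j _; exact: sqr_ge0.
  have -> : \sum_(i in ~: T) \sum_(j in ~: T) (u i * v (Some i) - u j * v (Some j)) ^+ 2
     = N * q + N * q - 2 * sg ^+ 2.
    transitivity (\sum_(i in ~: T) ((u i * v (Some i)) ^+ 2 * N + q - 2 * sg * (u i * v (Some i)))).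
      apply: eq_bigr => i _; rewrite NE qE' {1}sE !mulr_sumr mulr_suml -sumrN -!big_split/=.
      by apply: eq_bigr => j _; ring.
    rewrite sumrB big_split/= -mulr_suml -mulr_sumr -qE' -sE.
    have -> : \sum_(i in ~: T) q = N * q by rewrite NE mulr_suml; apply: eq_bigr => i _; rewrite mul1r.
    by ring.
  by lra.
have acb : a * c * (sg ^+ 2 - q) <= b ^+ 2 * sg ^+ 2.
  have N1 : 0 < N - 1 by lra.
  have N0 : 0 < N by lra.
  have acb1 : a * c * (N * (N - 1)) <= b ^+ 2 * N ^+ 2.
    have -> : a * c * (N * (N - 1)) = om s * om s.+2.
      by rewrite /a /c; field; rewrite !lt0r_neq0.
    have -> // : b ^+ 2 * N ^+ 2 = om s.+1 ^+ 2.
    by rewrite /b; field; rewrite lt0r_neq0.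
  have ac0 : 0 <= a * c by rewrite mulr_ge0 ?divr_ge0 ?mulr_ge0// ltW.
  have h1 : a * c * (N * (sg ^+ 2 - q)) <= a * c * ((N - 1) * sg ^+ 2).
    by rewrite ler_wpM2l//; lra.
  have h2 : a * c * (N * (N - 1)) * sg ^+ 2 <= b ^+ 2 * N ^+ 2 * sg ^+ 2.
    by rewrite ler_wpM2r ?sqr_ge0.
  rewrite -(ler_pM2l (mulr_gt0 N0 N0)).
  have h3 := ler_wpM2l (ltW N0) h1.
  by lra.
have -> : L * (a * v None * v None + b * v None * sg + b * v None * sg + c * (sg * sg - q)) *
  (L * (a * 1 * 1 + b * 1 * 0 + b * 1 * 0 + c * (0 * 0 - 0))) =
  L ^+ 2 * ((a * v None + b * sg) ^+ 2 - b ^+ 2 * sg ^+ 2 + a * c * (sg ^+ 2 - q)) by ring.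
have -> : (L * (a * v None * 1 + b * v None * 0 + b * 1 * sg + c * (sg * 0 - 0))) ^+ 2 =
  L ^+ 2 * (a * v None + b * sg) ^+ 2 by ring.
by rewrite ler_pM2l ?exprn_gt0//; lra.
Qed.

(** The law of the first [n - 1] letters, forgetting their order, is the image of
    [w] under the down-operator: forgetting a uniformly random letter replaces it
    by a blank. *)
Lemma base_contraction f : (forall x, 0 <= f x) ->
  Ent w f <= n%:R * lost_ent (Dpol R (n := n)) w f.
Proof.
move=> f0; pose w' x := w x * f x.
have w0 x := base_weight_gt0 x.
have w'0 x : 0 <= w' x by rewrite mulr_ge0// ltW.
have mu0 T : 0 < word w T by rewrite divr_gt0// ffact_pos.
have mu'0 T : 0 <= word w' T by rewrite divr_ge0// ltW// ffact_pos.
have := level_ent_drop mu0 mu'0 link_lorentz n_gt0.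
have mass (v : spins n -> R) r : (r <= n)%N -> \sum_(T : {set 'I_n}) ((n - r) ^_ #|T|)%:R * level (word v) r (Some T) = \sum_x v x.
  elim: r => [_|r IH rn].
    rewrite big_sp subn0; apply: eq_bigr => T _ /=.
    by rewrite /word mulrC divfK// lt0r_neq0// ffact_pos.
  rewrite -IH ?(ltnW rn)//; have -> : (n - r)%N = (n - r.+1).+1 by lia.
  by rewrite -level_collapse// level_None.
have emptyE (g : {set 'I_n} -> R) : \sum_(T : {set 'I_n}) ((n - n) ^_ #|T|)%:R * g T = g finset.set0.
  rewrite (bigD1 finset.set0)//= cards0 subnn mul1r big1 ?addr0// => T.
  by rewrite -cards_eq0 -lt0n => h; rewrite ffact_small// mul0r.
have -> : level_ent (word w) (word w') n =
    (\sum_x w' x) * ln ((\sum_x w' x) / \sum_x w x).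
  by rewrite /level_ent emptyE -(mass w n)// -(mass w' n)// !emptyE.
have -> : level_ent (word w) (word w') 0 = \sum_x w x * f x * ln (f x).
  rewrite /level_ent big_sp subn0; apply: eq_bigr => T _ /=; rewrite /word.
  have h := ffact_pos (cardT T).
  rewrite mulrA [_ * (_ / _)]mulrC divfK ?lt0r_neq0//; congr (_ * ln _).
  rewrite /w'; field; rewrite !lt0r_neq0//.
have -> : level_ent (word w) (word w') 1 = \sum_T push w' (Dpol R (n := n)) T *
    ln (push w' (Dpol R (n := n)) T / push w (Dpol R (n := n)) T).
  have lev v T : (#|T| < n)%N -> ((n - 1) ^_ #|T|)%:R * level (word v) 1 (Some T)
      = push v (Dpol R (n := n)) T.
    move=> hT; rewrite /push Dpol_adj big_split/= sumr_const /= big_option/=.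
    have -> : \sum_i oapp (word v) 0 (if i \in T then None else Some (i |: T)) =
        \sum_(i | i \notin T) v (sp (i |: T)) / (n ^_ #|T|.+1)%:R.
      rewrite [RHS]big_mkcond/=; apply: eq_bigr => i _.
      by case: ifPn => //= iT; rewrite /word cardsU1 iT.
    rewrite -mulr_suml mulrDr.
    have eS : (n ^_ #|T|.+1)%:R = n%:R * ((n - 1) ^_ #|T|)%:R :> R.
      by rewrite ffactnS subn1 natrM.
    have eS' : (n ^_ #|T|.+1)%:R = (n ^_ #|T|)%:R * (n - #|T|)%:R :> R.
      by rewrite ffactnSr natrM.
    have p1 := ffact_pos (k := n - 1) (T := T) ltac:(lia).
    have p2 := ffact_pos (cardT T).
    have -> : #|[pred i | i \notin T]| = (n - #|T|)%N.
      have := cardsC T; rewrite card_ord.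
      have -> : #|[pred i | i \notin T]| = #|~: T| by apply: eq_card => i; rewrite !inE.
      by move=> e; apply/eqP; rewrite -(eqn_add2l #|T|) e subnKC.
    rewrite -mulr_natl mulrDr; congr (_ + _); rewrite ?eS.
      rewrite /word; have -> : ((n - 1) ^_ #|T|)%:R = (n ^_ #|T|)%:R * (n - #|T|)%:R / n%:R :> R.
        by rewrite -eS' eS; field.
      by field; rewrite nR lt0r_neq0.
    by field; rewrite nR lt0r_neq0.
  apply: eq_bigr => T _; have [hT|hT] := ltnP #|T| n; last first.
    rewrite ffact_small ?mul0r; last by lia.
    have -> : T = [set: 'I_n] by apply/eqP; rewrite eqEcard finset.subsetT cardsT card_ord.
    by rewrite /push Dpol_adj big_pred0 ?mulr0 ?mul0r// => i; rewrite inE.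
  have p1 := ffact_pos (k := n - 1) (T := T) ltac:(lia).
  rewrite -!lev// mulrA; congr (_ * ln _).
  by rewrite -mulf_div divff ?mul1r ?lt0r_neq0.
by rewrite -(lost_entE _ _ Dpol_total).
Qed.

End Base.
End Down.

(** * Linearization: a Poincare inequality for linear functions *)

Lemma le_of_small (R : realType) (x y K e0 : R) : 0 < e0 -> 0 <= K ->
  (forall e, 0 < e <= e0 -> x <= y + e * K) -> x <= y.
Proof.
move=> e00 K0 h; rewrite leNgt; apply/negP => xy.
pose e := Num.min e0 ((x - y) / (2 * (K + 1))).
have d0 : 0 < (x - y) / (2 * (K + 1)) by rewrite divr_gt0 ?subr_gt0//; lra.
have ee : 0 < e <= e0 by rewrite lt_min e00 d0 ge_min lexx.
have : e <= (x - y) / (2 * (K + 1)) by rewrite ge_min lexx orbT.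
rewrite ler_pdivlMr; last by lra.
by have := h e ee; case/andP: ee => *; nra.
Qed.

Section Spins.
Variables (R : realType) (n : nat).
Hypothesis n_gt0 : (0 < n)%N.
Implicit Types (x y : spins n) (h th : 'I_n -> R) (c w f : spins n -> R).

Definition sg x i : R := if x i then 1 else -1.
Definition lin th x : R := \sum_i th i * sg x i.
Definition tilt c h x : R := c x * expR (lin h x).
Definition nrm2 th : R := \sum_i th i ^+ 2.

Definition mean w (g : spins n -> R) : R := (\sum_x w x * g x) / \sum_x w x.

(** Entropy contraction by [1 - rho / n], stated for unnormalized weights and as a
    lower bound on the loss of entropy: this form is homogeneous
    in the weights and survives mixtures and comparisons. *)
Definition contracts rho w := forall f, (forall x, 0 <= f x) ->
  rho * Ent w f <= n%:R * lost_ent (Dpol R (n := n)) w f.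

(** Contraction under every external field, the hypothesis that the localization
    steps propagate. *)
Definition contr rho c := forall h, contracts rho (tilt c h).

Definition flip x : spins n := [ffun i => ~~ x i].

Lemma flipK : involutive flip.
Proof. by move=> x; apply/ffunP => i; rewrite !ffunE negbK. Qed.

Lemma sg_flip x i : sg (flip x) i = - sg x i.
Proof. by rewrite /sg ffunE; case: (x i); rewrite ?opprK. Qed.

Lemma lin_flip th x : lin th (flip x) = - lin th x.
Proof. by rewrite /lin -sumrN; apply: eq_bigr => i _; rewrite sg_flip mulrN. Qed.

Lemma linN th x : lin (fun i => - th i) x = - lin th x.
Proof. by rewrite /lin -sumrN; apply: eq_bigr => i _; rewrite mulNr. Qed.

Lemma linD h th t x : lin (fun i => h i + t * th i) x = lin h x + t * lin th x.
Proof. by rewrite /lin mulr_sumr -big_split/=; apply: eq_bigr => i _; ring. Qed.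

Lemma sum_flip (F : spins n -> R) : \sum_x F (flip x) = \sum_x F x.
Proof. by rewrite [RHS](reindex flip)//; exists flip => ? _; rewrite flipK. Qed.

Lemma spins_pos (w : spins n -> R) : (forall x, 0 < w x) -> 0 < \sum_x w x.
Proof.
move=> w0; rewrite (bigD1 [ffun=> true])//= ltr_pwDl// sumr_ge0// => x _.
exact: ltW.
Qed.

Lemma lin_down th x i : x i ->
  lin th x - lin th (sp (plus x :\ i)) = 2 * th i.
Proof.
move=> xi; rewrite /lin -sumrB (bigD1 i)//= big1 => [|j ji].
  by rewrite /sg !ffunE !inE eqxx xi /=; ring.
by rewrite /sg !ffunE !inE ji/=; rewrite subrr.
Qed.

(** Applying the contraction to [1 + e * g] with [g] linear and centred, and
    letting [e] tend to 0. *)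
Lemma one_sided_poincare rho w th :
  (forall x, 0 < w x) -> 0 <= rho -> contracts rho w ->
  rho * \sum_x w x * (lin th x - mean w (lin th)) ^+ 2
    <= 4 * \sum_i th i ^+ 2 * \sum_(x : spins n | x i) w x.
Proof.
move=> w0 rho0 cw; set m := mean _ _; set V := \sum_x _; set Y := \sum_i _; pose g x := lin th x - m.
have Z0 := spins_pos w0; set Z := \sum_x w x in Z0.
have V0 : 0 <= V.
  by apply: sumr_ge0 => x _; apply: mulr_ge0; [exact: ltW|exact: sqr_ge0].
have Y0 : 0 <= Y.
  apply: sumr_ge0 => i _; apply: mulr_ge0; first exact: sqr_ge0.
  by apply: sumr_ge0 => x _; exact: ltW.
pose G := 1 + \sum_x `|g x|.
have gG x : `|g x| <= G.
  rewrite /G (bigD1 x)//= addrCA lerDl addr_ge0// sumr_ge0//.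
have G0 : 0 < G by rewrite /G ltr_pwDl// sumr_ge0.
have gw : \sum_x w x * g x = 0.
  rewrite /g; under eq_bigr do rewrite mulrBr; rewrite sumrB -mulr_suml -/Z /m /mean -/Z.
  by rewrite mulrCA divff ?gt_eqF// mulr1 subrr.
apply: (@le_of_small _ _ _ (5 * (rho * V) + 4 * Y) 10^-1).
- by rewrite invr_gt0.
- by apply: addr_ge0; apply: mulr_ge0 => //; exact: mulr_ge0.
move=> e /andP[e0 e1]; have {}e1 : 10 * e <= 1 by move: e1; lra.
pose ep := e / G; have ep0 : 0 < ep by rewrite divr_gt0.
pose f x := 1 + ep * g x.
have fe x : `|f x - 1| <= e.
  rewrite /f addrC addKr normrM gtr0_norm// /ep mulrAC ler_pdivrMr//.
  by rewrite ler_wpM2l// ltW.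
have fr x : 1 - e <= f x <= 1 + e by have := fe x; rewrite ler_norml; lra.
have f0 x : 0 < f x by have := fr x; lra.
have lower : ep ^+ 2 / (2 * (1 + e)) * V <= Ent w f.
  have fZ : \sum_x w x * f x = Z.
    rewrite /f; under eq_bigr do rewrite mulrDr mulr1 mulrCA.
    by rewrite big_split/= -mulr_sumr gw mulr0 addr0.
  have [|_ _ ->] := Ent_mean (fun x => ltW (w0 x)) (fun x => ltW (f0 x)).
    by rewrite fZ.
  rewrite fZ -/Z divff ?gt_eqF// mulr_sumr; apply: ler_sum => x _.
  have /andP[h _] := @psi1_sandwich R e (f x) (ltac:(lra)) (fe x).
  rewrite mulrCA ler_wpM2l ?(ltW (w0 x))//; apply: le_trans h.
  have -> : f x - 1 = ep * g x by rewrite /f; ring.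
  by rewrite [(ep * g x) ^+ 2]exprMn mulrAC.
have upper : n%:R * lost_ent (Dpol R (n := n)) w f
    <= 2 * ep ^+ 2 / (1 - 5 * e) * Y.
  have h1 : lost_ent (Dpol R (n := n)) w f <=
     \sum_x w x * \sum_T Dpol R x T * psi (f x) (f (sp T)).
    rewrite /lost_ent; under [leRHS]eq_bigr do rewrite mulr_sumr.
    rewrite exchange_big/=; apply: ler_sum => T _.
    apply: (le_trans (Ent_le _ _ (f0 (sp T)))) => [x|x|].
    - by rewrite mulr_ge0 ?Dpol_ge0// ltW.
    - exact: ltW.
    - by apply: ler_sum => x _; rewrite mulrA.
  (* A coordinate that is already minus contributes nothing. *)
  have h2 x i : psi (f x) (f (sp (plus x :\ i))) <=
      if x i then 2 * ep ^+ 2 / (1 - 5 * e) * th i ^+ 2 else 0.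
    case: ifPn => xi; last first.
      rewrite setD1_notin ?inE// plusK /psi divff ?gt_eqF// ln1 mulr0.
      by rewrite le_eqVlt; apply/orP; left; apply/eqP; ring.
    set b := f (sp _); set a := f x.
    have ab : a - b = 2 * ep * th i.
      transitivity (ep * (lin th x - lin th (sp (plus x :\ i)))).
        by rewrite /a /b /f /g; ring.
      by rewrite lin_down//; ring.
    have b0 : 0 < b by exact: f0.
    have br := fr (sp (plus x :\ i)); have ar := fr x; rewrite -/a -/b in ar br.
    have hab : `|a - b| <= 4 * e * b by rewrite ler_norml; nra.
    apply: (le_trans (psi_le_quad b0 (ltac:(lra) : 0 <= 4 * e < 1) hab)).
    rewrite ab; have -> : 2 * ep ^+ 2 / (1 - 5 * e) * th i ^+ 2 =
       (2 * ep * th i) ^+ 2 / (2 * (1 - 5 * e)) by field; lra.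
    rewrite ler_wpM2l ?sqr_ge0// lef_pV2 ?posrE ?mulr_gt0//; [nra|lra|lra].
  apply: (le_trans (ler_wpM2l (ler0n _ _) h1)); rewrite mulr_sumr.
  apply: (@le_trans _ _ (\sum_x w x * \sum_(i | x i) 2 * ep ^+ 2 / (1 - 5 * e) * th i ^+ 2)).
    apply: ler_sum => x _; rewrite mulrCA ler_wpM2l ?(ltW (w0 x))//.
    rewrite Dpol_sum// mulVKf ?pnatr_eq0 -?lt0n// [leRHS]big_mkcond/=.
    exact: ler_sum.
  rewrite le_eqVlt; apply/orP; left; apply/eqP.
  rewrite /Y [RHS]mulr_sumr; under [LHS]eq_bigr do rewrite mulr_sumr.
  rewrite (exchange_big_dep predT)//=; apply: eq_bigr => i _.
  by rewrite [RHS]mulrA [RHS]mulr_sumr; apply: eq_bigr => x _; exact: mulrC.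
have := le_trans (le_trans (ler_wpM2l rho0 lower) (cw f (fun x => ltW (f0 x)))) upper.
have -> : rho * (ep ^+ 2 / (2 * (1 + e)) * V) =
  ep ^+ 2 * ((rho * V) / (2 * (1 + e))) by ring.
have -> : 2 * ep ^+ 2 / (1 - 5 * e) * Y = ep ^+ 2 * (2 * Y / (1 - 5 * e)) by ring.
rewrite ler_pM2l ?exprn_gt0// ler_pdivrMr; last by lra.
rewrite mulrAC ler_pdivlMr; last by lra.
by lra.
Qed.

(** For an even weight the down-operator and its mirror image, which sets
    coordinates to plus, contract at the same rate: adding the two bounds replaces
    the probabilities of a plus by 1. *)
Lemma poincare rho c h th :
  (forall x, 0 < c x) -> (forall x, c (flip x) = c x) -> 0 <= rho ->
  contr rho c ->
  rho * \sum_x tilt c h x * (lin th x - mean (tilt c h) (lin th)) ^+ 2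
    <= 2 * nrm2 th * \sum_x tilt c h x.
Proof.
move=> c0 ceven rho0 cc; set w := tilt c h; set m := mean _ _.
have w0 g x : 0 < tilt c g x by rewrite mulr_gt0 ?expR_gt0.
have p1 := one_sided_poincare th (w0 h) rho0 (cc h).
have p2 := one_sided_poincare th (w0 (fun i => - h i)) rho0 (cc _).
have wf x : tilt c (fun i => - h i) (flip x) = w x.
  by rewrite /tilt ceven linN lin_flip opprK.
move: p1 p2; rewrite -/w -/m /mean.
have -> : \sum_x tilt c (fun i => - h i) x = \sum_x w x.
  by rewrite -sum_flip; apply: eq_bigr => x _; rewrite wf.
have -> : \sum_x tilt c (fun i => - h i) x * lin th x = - \sum_x w x * lin th x.
  by rewrite -sum_flip -sumrN; apply: eq_bigr => x _; rewrite wf lin_flip mulrN.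
rewrite mulNr -/(mean w (lin th)) -/m.
have -> : \sum_x tilt c (fun i => - h i) x * (lin th x - - m) ^+ 2 =
    \sum_x w x * (lin th x - m) ^+ 2.
  rewrite -sum_flip; apply: eq_bigr => x _; rewrite wf lin_flip.
  by congr (_ * _); ring.
have e : \sum_i th i ^+ 2 * (\sum_(x : spins n | x i) w x) +
   \sum_i th i ^+ 2 * (\sum_(x : spins n | x i) tilt c (fun i => - h i) x) = nrm2 th * \sum_x w x.
  rewrite -big_split/= /nrm2 mulr_suml; apply: eq_bigr => i _; rewrite -mulrDr.
  congr (_ * _); rewrite [RHS](bigID (fun x : spins n => x i))/=; congr (_ + _).
  rewrite big_mkcond -sum_flip [RHS]big_mkcond/=; apply: eq_bigr => x _.
  by rewrite wf ffunE.
by move=> p1 p2; move: e p1 p2; set A1 := \sum_i _ * _; set A2 := \sum_i _ * _; lra.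
Qed.

End Spins.

(** * Stochastic localization in small discrete steps *)

Section Core.
Variables (R : realType) (A J : finType).

Lemma Ent_scale (w f : A -> R) (p : R) : 0 < p ->
  Ent (fun x => p * w x) f = p * Ent w f.
Proof.
move=> p0; rewrite /Ent.
have -> : \sum_x p * w x * f x = p * \sum_x w x * f x.
  by rewrite mulr_sumr; apply: eq_bigr => x _; rewrite mulrA.
rewrite -mulr_sumr -mulf_div divff ?gt_eqF// mul1r mulrBr; congr (_ - _).
  by rewrite mulr_sumr; apply: eq_bigr => x _; rewrite !mulrA.
by rewrite mulrA.
Qed.

Lemma kl_Ent (w f : A -> R) : (forall x, 0 < w x) -> (forall x, 0 <= f x) ->
  0 < \sum_x w x * f x ->
  kl_div (fun x => w x * f x / \sum_y w y * f y) (fun x => w x / \sum_y w y)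
    = Ent w f / \sum_y w y * f y.
Proof.
move=> w0 f0 B0; have [Z0 BZ _] := Ent_mean (fun x => ltW (w0 x)) f0 B0.
move: BZ; set B := \sum_y w y * f y; set Z := \sum_y w y => BZ.
rewrite /kl_div /Ent -/B -/Z.
transitivity (\sum_x (w x * f x * ln (f x) / B - w x * f x * (ln (B / Z) / B))).
  apply: eq_bigr => x _; have := f0 x; rewrite le_eqVlt => /orP[/eqP<-|fx].
    by rewrite mulr0 !mul0r subr0.
  have -> : w x * f x / B / (w x / Z) = f x / (B / Z).
    by field; rewrite !lt0r_neq0.
  rewrite ln_divE//; field; exact: lt0r_neq0.
rewrite sumrB -mulr_suml -mulr_suml -/B mulrBl; congr (_ - _); exact: mulrA.
Qed.

(** The variance of a function bounded by [r0] is at most [r0 ^ 2] under every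
    tilt. *)
Lemma bounded_transport (nu P r : A -> R) (r0 : R) :
  (forall x, 0 < nu x) -> \sum_x nu x = 1 -> is_prob P ->
  (forall x, `|r x| <= r0) ->
  (\sum_x P x * r x - \sum_x nu x * r x) ^+ 2 <= 2 * r0 ^+ 2 * kl_div P nu.
Proof.
move=> nu0 nu1 PP hr; apply: transport => //; last exact: sqr_ge0.
move=> t; apply: (@le_trans _ _ ((\sum_x nu x * r x ^+ 2 * expR (t * r x)) *
  (\sum_x nu x * r x ^+ 0 * expR (t * r x)))); first by rewrite gerBl sqr_ge0.
rewrite [X in _ <= _ * X]expr2 [leRHS]mulrA; apply: ler_wpM2r.
  by apply: sumr_ge0 => x _; rewrite expr0 mulr1 mulr_ge0 ?expR_ge0// ltW.
rewrite mulr_sumr; apply: ler_sum => x _.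
have -> : r0 ^+ 2 * (nu x * r x ^+ 0 * expR (t * r x)) = nu x * r0 ^+ 2 * expR (t * r x) by ring.
apply: ler_wpM2r; first exact: expR_ge0.
apply: ler_wpM2l; first exact: ltW.
rewrite -[r x ^+ 2]real_normK ?num_real// ler_sqr ?nnegrE//.
exact: (le_trans (normr_ge0 _) (hr x)).
Qed.

Lemma abs_cont_pos (P nu : A -> R) : (forall x, 0 < nu x) -> abs_cont P nu.
Proof. by move=> nu0 x /eqP; rewrite gt_eqF. Qed.

Variables (nu P : A -> R) (p : J -> R) (u r : J -> A -> R) (eta r0 a t : R).
Hypothesis nu0 : forall x, 0 < nu x.
Hypothesis nu1 : \sum_x nu x = 1.
Hypothesis PP : is_prob P.
Hypothesis p0 : forall j, 0 < p j.
Hypothesis p1 : \sum_j p j = 1.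
Hypothesis s1 : forall x, \sum_j p j * (1 + (u j x + r j x)) = 1.
Hypothesis eta0 : 0 <= eta.
Hypothesis eta1 : 10 * eta <= 1.
Hypothesis ur : forall j x, `|u j x + r j x| <= eta.
Hypothesis rr : forall j x, `|r j x| <= r0.
Hypothesis t0 : 0 < t.

Let E (q g : A -> R) := \sum_x q x * g x.
Hypothesis ua :
  \sum_j p j * (E P (u j) - E nu (u j)) ^+ 2 <= a * kl_div P nu.

Let s j x := p j * (1 + (u j x + r j x)).

(** Mixing almost equal pieces [s j]: to leading order, the entropy of the
    mixture weights is half the variance of the masses of the pieces, and only
    the linear parts [u] of the pieces matter. *)
Lemma mixture_entropy :
  \sum_j E P (s j) * ln (E P (s j) / E nu (s j))
  <= ((1 + t) * a + (1 + t^-1) * (2 * r0 ^+ 2)) / (2 * (1 - 5 * eta)) * kl_div P nu.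
Proof.
set K := kl_div P nu; case: (PP) => P0 P1.
have [h_eta0 h_eta1 h_t0] := And3 eta0 eta1 t0.
have avg (q g : A -> R) c : (forall x, 0 <= q x) -> \sum_x q x = 1 ->
    (forall x, `|g x| <= c) -> `|E q g| <= c.
  move=> q0 q1 gc; apply: (le_trans (ler_norm_sum _ _ _)).
  rewrite -[leRHS]mul1r -q1 mulr_suml; apply: ler_sum => x _.
  by rewrite normrM ger0_norm// ler_wpM2l.
have Es (q : A -> R) j : \sum_x q x = 1 ->
    E q (s j) = p j * (1 + E q (fun x => u j x + r j x)).
  move=> q1; transitivity (\sum_x (q x * p j + p j * (q x * (u j x + r j x)))).
    by apply: eq_bigr => x _; rewrite /s; ring.
  by rewrite big_split/= -mulr_suml q1 mul1r -mulr_sumr mulrDr mulr1.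
have nuW x := ltW (nu0 x).
pose al j := E nu (fun x => u j x + r j x); pose be j := E P (fun x => u j x + r j x).
have alb j : - eta <= al j <= eta by rewrite -ler_norml avg.
have beb j : - eta <= be j <= eta by rewrite -ler_norml avg.
have tot (q : A -> R) : \sum_x q x = 1 -> \sum_j E q (s j) = 1.
  move=> q1; rewrite exchange_big/= -[RHS]q1; apply: eq_bigr => x _.
  by rewrite -mulr_sumr s1 mulr1.
have apos j : 0 < E nu (s j).
  by rewrite Es// -/(al j) mulr_gt0//; have := alb j; lra.
have -> : \sum_j E P (s j) * ln (E P (s j) / E nu (s j)) =
    \sum_j psi (E P (s j)) (E nu (s j)).
  rewrite /psi big_split/= sumrB !tot//; ring.
pose D j := be j - al j.
have h1 j : psi (E P (s j)) (E nu (s j)) <= p j * D j ^+ 2 / (2 * (1 - 5 * eta)).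
  have dE : E P (s j) - E nu (s j) = p j * D j.
    by rewrite !Es// -/(al j) -/(be j) /D; ring.
  have ab := alb j; have bb := beb j; have pj := p0 j.
  apply: (le_trans (psi_le_quad (apos j) (ltac:(lra) : 0 <= 4 * eta < 1) _)).
    rewrite dE Es// -/(al j) normrM gtr0_norm// mulrCA; apply: ler_wpM2l; first exact: ltW.
    by rewrite /D ler_norml; nra.
  rewrite dE Es// -/(al j).
  have -> : p j * D j ^+ 2 / (2 * (1 - 5 * eta)) =
     (p j * D j) ^+ 2 / (2 * p j * (1 - 5 * eta)) by field; rewrite lt0r_neq0//=; lra.
  have q1 : 0 < 2 * p j * (1 - 5 * eta) by do 2?[apply: mulr_gt0 => //]; lra.
  have q2 : 0 < 2 * (p j * (1 + al j)) * (1 - 4 * eta).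
    by do 3?[apply: mulr_gt0 => //]; lra.
  rewrite ler_wpM2l ?sqr_ge0// lef_pV2 ?posrE//.
  have -> : 2 * (p j * (1 + al j)) * (1 - 4 * eta) = 2 * p j * ((1 + al j) * (1 - 4 * eta)) by ring.
  rewrite ler_pM2l ?mulr_gt0//; nra.
apply: (le_trans (ler_sum _ (fun j _ => h1 j))); rewrite -mulr_suml [leRHS]mulrAC.
apply: ler_wpM2r; first by rewrite invr_ge0; lra.
have DE j : D j = (E P (u j) - E nu (u j)) + (E P (r j) - E nu (r j)).
  have sp q : E q (fun x => u j x + r j x) = E q (u j) + E q (r j).
    by rewrite /E -big_split/=; apply: eq_bigr => x _; rewrite mulrDr.
  by rewrite /D /al /be !sp; ring.
(* Young's inequality separates the linear parts from the remainders [r]. *)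
have h2 j : p j * D j ^+ 2 <= (1 + t) * (p j * (E P (u j) - E nu (u j)) ^+ 2)
    + p j * ((1 + t^-1) * (2 * r0 ^+ 2 * K)).
  have hr := bounded_transport nu0 nu1 PP (rr j); rewrite -/K in hr.
  rewrite DE.
  set x := E P (u j) - _; set y := E P (r j) - _ in hr *.
  have -> : (1 + t) * (p j * x ^+ 2) + p j * ((1 + t^-1) * (2 * r0 ^+ 2 * K)) =
    p j * ((1 + t) * x ^+ 2 + (1 + t^-1) * (2 * r0 ^+ 2 * K)) by ring.
  apply: ler_wpM2l; first exact: ltW.
  have ti : 0 < t^-1 by rewrite invr_gt0.
  have : (1 + t^-1) * y ^+ 2 <= (1 + t^-1) * (2 * r0 ^+ 2 * K) by rewrite ler_wpM2l//; lra.
  have -> : (x + y) ^+ 2 =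
      (1 + t) * x ^+ 2 + (1 + t^-1) * y ^+ 2 - t^-1 * (t * x - y) ^+ 2.
    by field; rewrite lt0r_neq0.
  have := mulr_ge0 (ltW ti) (sqr_ge0 (t * x - y)); lra.
apply: (le_trans (ler_sum _ (fun j _ => h2 j))).
rewrite big_split/= -mulr_sumr -mulr_suml p1 mul1r mulrDl -!mulrA.
have t1 : 0 <= 1 + t by lra.
by have := ler_wpM2l t1 ua; rewrite -/K; lra.
Qed.

End Core.

Section Localization.
Variables (R : realType) (n m : nat) (v : 'I_m -> 'I_n -> R) (L lam : R).
Hypothesis n_gt0 : (0 < n)%N.
Hypothesis m_gt0 : (0 < m)%N.
Hypothesis L1 : 1 <= L.
Hypothesis vL : forall k (x : spins n), `|lin (v k) x| <= L.
Hypothesis lam0 : 0 <= lam.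
Hypothesis lam_le : 2 * lam <= 1.
Hypothesis v_lam : forall th : 'I_n -> R,
  m%:R^-1 * \sum_k (\sum_i v k i * th i) ^+ 2 <= lam * nrm2 th.
Implicit Types (x : spins n) (d e rho : R) (c f : spins n -> R).

(** Averaging over the directions [v k], rather than treating them one after
    the other, is what makes the cost depend on the operator norm [lam] of the
    interaction instead of its trace. *)
Definition phi d x : R := m%:R^-1 * \sum_k ch (d * lin (v k) x).


Let mR : 0 < m%:R :> R. Proof. by rewrite ltr0n. Qed.

Let avg_le (g : 'I_m -> R) (b : R) : (forall k, g k <= b) -> m%:R^-1 * \sum_k g k <= b.
Proof.
move=> gb; rewrite mulrC ler_pdivrMr//; apply: (le_trans (ler_sum _ (fun k _ => gb k))).
by rewrite sumr_const card_ord mulr_natr.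
Qed.

Let avg_ge (g : 'I_m -> R) (b : R) : (forall k, b <= g k) -> b <= m%:R^-1 * \sum_k g k.
Proof.
move=> gb; rewrite mulrC ler_pdivlMr//; apply: (le_trans _ (ler_sum _ (fun k _ => gb k))).
by rewrite sumr_const card_ord mulr_natr.
Qed.

Lemma phi_ge1 d x : 1 <= phi d x.
Proof. by apply: avg_ge => k; exact: ch_ge1. Qed.

Lemma phi_gt0 d x : 0 < phi d x.
Proof. exact: lt_le_trans ltr01 (phi_ge1 d x). Qed.

Let dl d k x : 0 < d -> `|d * lin (v k) x| <= d * L.
Proof. by move=> d0; rewrite normrM gtr0_norm// ler_wpM2l// ltW. Qed.

Lemma phi_le d x : 0 < d -> d * L <= 2^-1 -> phi d x <= 1 + 2 * (d * L) ^+ 2.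
Proof.
move=> d0 dL; apply: avg_le => k; have h := dl k x d0.
apply: (le_trans (ch_le_quad (le_trans h dL))).
rewrite lerD2l ler_pM2l// -[leLHS]real_normK ?num_real// ler_sqr ?nnegrE//.
exact: le_trans (normr_ge0 _) h.
Qed.

Lemma phi_flip d x : phi d (flip x) = phi d x.
Proof.
congr (_ * _); apply: eq_bigr => k _; rewrite lin_flip mulrN /ch opprK.
by congr (_ / _); rewrite addrC.
Qed.

(** Reweighting by [phi] keeps the variance bound up to its oscillation. *)
Lemma tilt_variance d t rho c h th :
  (forall x, 0 < c x) -> (forall x, c (flip x) = c x) -> 0 < rho ->
  contr rho c -> 0 < t -> (forall x, phi d x <= 1 + t) ->
  forall w, w = tilt (fun x => phi d x * c x) h ->
  (\sum_x w x * lin th x ^+ 2) * (\sum_x w x) - (\sum_x w x * lin th x) ^+ 2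
   <= (2 / rho * (1 + t) * nrm2 th) * (\sum_x w x) ^+ 2.
Proof.
move=> c0 ce rho0 cc t0 pt w wdef.
set w0 := tilt c h; set mu := mean w0 (lin th).
have w0p x : 0 < w0 x by rewrite mulr_gt0 ?expR_gt0.
have wE x : w x = phi d x * w0 x by rewrite wdef /tilt mulrA.
have wp x : 0 < w x by rewrite wE mulr_gt0 ?phi_gt0.
set Z := \sum_x w x; set S1 := \sum_x w x * lin th x; set S2 := \sum_x w x * lin th x ^+ 2.
have Z0 : 0 < Z by exact: spins_pos.
have e : \sum_x w x * (lin th x - mu) ^+ 2 = S2 - 2 * mu * S1 + mu ^+ 2 * Z.
  rewrite /S2 /S1 /Z !mulr_sumr -sumrB -big_split/=.
  by apply: eq_bigr => x _; ring.
have h1 : \sum_x w x * (lin th x - mu) ^+ 2 <=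
    (1 + t) * \sum_x w0 x * (lin th x - mu) ^+ 2.
  rewrite mulr_sumr; apply: ler_sum => x _; rewrite wE [leRHS]mulrA.
  apply: ler_wpM2r; first exact: sqr_ge0.
  by apply: ler_wpM2r; first exact: ltW.
have p := poincare n_gt0 h th c0 ce (ltW rho0) cc; rewrite -/w0 -/mu in p.
have h2 : \sum_x w0 x * (lin th x - mu) ^+ 2 <= 2 / rho * nrm2 th * \sum_x w0 x.
  by rewrite -(ler_pM2l rho0); apply: (le_trans p); rewrite le_eqVlt; apply/orP; left; apply/eqP; field; exact: lt0r_neq0.
have n0 : 0 <= nrm2 th by apply: sumr_ge0 => i _; exact: sqr_ge0.
have q0 : 0 <= 2 / rho * nrm2 th by rewrite mulr_ge0 ?divr_ge0// ltW.
have h3 : \sum_x w0 x <= Z.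
  by apply: ler_sum => x _; rewrite wE ler_peMl ?phi_ge1// ltW.
have h4 : \sum_x w x * (lin th x - mu) ^+ 2 <= (2 / rho * (1 + t) * nrm2 th) * Z.
  apply: (le_trans h1); have -> : 2 / rho * (1 + t) * nrm2 th * Z = (1 + t) * (2 / rho * nrm2 th * Z) by ring.
  apply: ler_wpM2l; first by lra.
  by apply: (le_trans h2); apply: ler_wpM2l.
rewrite e in h4; have := ler_wpM2l (ltW Z0) h4; have := sqr_ge0 (S1 - mu * Z).
by lra.
Qed.

Let sgn (b : bool) : R := if b then 1 else -1.
Let uj d (j : 'I_m * bool) x := d * sgn j.2 * lin (v j.1) x.
Let pj : R := (2 * m%:R)^-1.

Let pj0 : 0 < pj. Proof. by rewrite invr_gt0 mulr_gt0. Qed.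

Let sum_pairs (F : 'I_m * bool -> R) :
  \sum_j pj * F j = m%:R^-1 * \sum_k ((F (k, true) + F (k, false)) / 2).
Proof.
transitivity (\sum_(j : 'I_m * bool) pj * F (j.1, j.2)); first by apply: eq_bigr => -[].
rewrite -(pair_bigA _ (fun k b => pj * F (k, b)))/= mulr_sumr.
apply: eq_bigr => k _; rewrite big_bool/= /pj; field; exact: lt0r_neq0.
Qed.

Let phi_mix d x : phi d x = \sum_j pj * expR (uj d j x).
Proof.
rewrite (sum_pairs (fun j => expR (uj d j x))) /phi; congr (_ * _).
apply: eq_bigr => k _; rewrite /ch /uj/= mulr1 mulrN1 mulNr //.
Qed.

(** One step: tilting by [phi d] costs [2 * lam * d ^ 2] of the contraction
    rate, up to an error [2 * e * d ^ 2]. *)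
Lemma localization_step d e rho c :
  0 < d -> 0 < e <= 1 -> 100 * (d * L ^+ 2) <= e -> 0 < rho <= 1 ->
  (forall x, 0 < c x) -> (forall x, c (flip x) = c x) -> contr rho c ->
  contr (rho - 2 * (lam + e) * d ^+ 2) (fun x => phi d x * c x).
Proof.
move=> d0 /andP[e0 e1] dLe /andP[rho0 rho1] c0 ce cc h f f0.
have [h_L1 h_lam0 h_lam] := And3 L1 lam0 lam_le.
set w := tilt _ h.
have wp x : 0 < w x.
  by apply: mulr_gt0; [apply: mulr_gt0 => //; exact: phi_gt0|exact: expR_gt0].
have wW x := ltW (wp x).
pose y := d * L.
have y0 : 0 < y by rewrite mulr_gt0//; lra.
have Ly : 100 * (L * y) <= e by rewrite /y; lra.
have ye : 100 * y <= e by apply: le_trans Ly; nra.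
(* [t] is the oscillation allowed to [phi], and the parameter of Young's
   inequality. *)
pose t := e / 8; have t0 : 0 < t by rewrite divr_gt0.
(* The pieces of [w]: fields shifted by [d * v k] or by [- d * v k]. *)
pose wj j := tilt c (fun i => h i + (d * sgn j.2) * v j.1 i).
have wjE j x : pj * wj j x = w x * (pj * expR (uj d j x) / phi d x).
  rewrite /wj /w /tilt linD expRD -/(uj d j x); field; exact/lt0r_neq0/phi_gt0.
have wsum x : w x = \sum_j pj * wj j x.
  under eq_bigr do rewrite wjE; rewrite -mulr_sumr -mulr_suml -phi_mix divff ?mulr1//.
  exact/lt0r_neq0/phi_gt0.
have wjp j x : 0 < wj j x by rewrite mulr_gt0 ?expR_gt0.
have pwj j x : 0 <= pj * wj j x by apply: mulr_ge0; exact: ltW.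
have pieces : rho * (\sum_j Ent (fun x => pj * wj j x) f) <= n%:R * lost_ent (Dpol R (n := n)) w f.
  have -> : lost_ent (Dpol R (n := n)) w f = lost_ent (Dpol R (n := n)) (fun x => \sum_j pj * wj j x) f.
    by apply: eq_bigr => T _; apply: eq_Ent => x; rewrite wsum.
  have hs := lost_ent_sum (@Dpol_ge0 R n) pwj f0.
  apply: (le_trans _ (ler_wpM2l (ler0n R n) hs)).
  rewrite !mulr_sumr; apply: ler_sum => j _; rewrite Ent_scale// mulrCA.
  apply: (le_trans (ler_wpM2l (ltW pj0) (cc _ f f0))); rewrite mulrCA ler_wpM2l//.
  rewrite /lost_ent mulr_sumr le_eqVlt; apply/orP; left; apply/eqP.
  apply: eq_bigr => T _; rewrite -Ent_scale//; apply: eq_Ent => x; exact: mulrA.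
have [wf0|[cst_ _ _]] := Ent_mean_dichotomy wW f0.
  rewrite (Ent_eq0 wf0) mulr0 mulr_ge0//; apply: lost_ent_ge0 => // x T.
  exact: Dpol_ge0.
have [B0|Bn] := leP (\sum_x w x * f x) 0.
  have wf0 x : w x * f x = 0.
    have h0 z : 0 <= w z * f z by apply: mulr_ge0.
    by apply: (sum_eq0_ge0 h0); apply/eqP; rewrite eq_le B0; apply: sumr_ge0.
  rewrite (Ent_eq0 wf0) mulr0 mulr_ge0//; apply: lost_ent_ge0 => // x T.
  exact: Dpol_ge0.
have Z0 : 0 < \sum_x w x by exact: spins_pos.
set B := \sum_x w x * f x in Bn; set Z := \sum_x w x in Z0.
pose nu x := w x / Z; pose P x := w x * f x / B.
have nu0 x : 0 < nu x by rewrite divr_gt0.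
have nu1 : \sum_x nu x = 1 by rewrite -mulr_suml divff ?gt_eqF.
have PP : is_prob P.
  split=> [x|]; first by apply: divr_ge0; [apply: mulr_ge0|exact: ltW].
  by rewrite -mulr_suml divff ?gt_eqF.
have KE : kl_div P nu = Ent w f / B by exact: kl_Ent.
set K := kl_div P nu in KE.
have K0 : 0 <= K.
  apply: kl_div_ge0 => //; last exact: abs_cont_pos.
  by split=> // x; exact: ltW.
have phib x : 1 <= phi d x <= 1 + 2 * y ^+ 2.
  by rewrite phi_ge1 phi_le//; have := ye; rewrite -/y; lra.
have phit x : phi d x <= 1 + t.
  by case/andP: (phib x) => _ /le_trans; apply; rewrite /t; nra.
pose r j x := expR (uj d j x) / phi d x - 1 - uj d j x.
have ub j x : `|uj d j x| <= y.
  rewrite /uj mulrAC normrM; have -> : `|sgn j.2| = 1 by rewrite /sgn; case: ifP => _; rewrite ?normrN normr1.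
  by rewrite mulr1; exact: dl.
have rb j x : `|r j x| <= 4 * y ^+ 2.
  have hu := ub j x; set uu := uj d j x in hu *.
  have hu2 : `|uu| <= 2^-1 by apply: (le_trans hu); lra.
  have eu := expR_le_quad hu2; have el := expR_ge1Dx uu.
  have uy : uu ^+ 2 <= y ^+ 2.
    by rewrite -[uu ^+ 2]real_normK ?num_real// ler_sqr ?nnegrE// ltW.
  move: hu; rewrite ler_norml => /andP[hu3 hu4].
  have /andP[p1 p2] := phib x; have pp : 0 < phi d x by exact: phi_gt0.
  rewrite /r -/uu; set q := expR uu in eu el *; set ph := phi d x in p1 p2 pp *.
  have q0 : 0 < q by exact: expR_gt0.
  have a1 : q / ph <= q by rewrite ler_pdivrMr// ler_peMr// ltW.
  have a2 : (1 + uu) * (1 - 2 * y ^+ 2) <= q / ph.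
    rewrite ler_pdivlMr//.
    have yy : 0 <= y ^+ 2 by exact: sqr_ge0.
    have b1 : (1 - 2 * y ^+ 2) * ph <= 1.
      have b0 : 0 <= 1 - 2 * y ^+ 2 by nra.
      by apply: (le_trans (ler_wpM2l b0 p2)); nra.
    have b2 : 0 <= 1 + uu by lra.
    by have := ler_wpM2l b2 b1; lra.
  rewrite ler_norml; nra.
have urb j x : `|uj d j x + r j x| <= 3 * y.
  apply: (le_trans (ler_normD _ _)); have := ub j x; have := rb j x; nra.
pose dm i := \sum_x P x * sg R x i - \sum_x nu x * sg R x i.
have Elin (q : spins n -> R) th : \sum_x q x * lin th x = \sum_i th i * \sum_x q x * sg R x i.
  under eq_bigr do rewrite mulr_sumr; rewrite exchange_big/=; apply: eq_bigr => i _.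
  by rewrite mulr_sumr; apply: eq_bigr => x _; ring.
have dlin th : \sum_x P x * lin th x - \sum_x nu x * lin th x = \sum_i th i * dm i.
  by rewrite !Elin -sumrB; apply: eq_bigr => i _; rewrite -mulrBr.
(* Transport applied to the linear function whose coefficients are the mean
   differences [dm] themselves: the square of [nrm2 dm] is at most
   proportional to [nrm2 dm]. *)
have dm_le : nrm2 dm <= 4 / rho * (1 + t) * K.
  have nn : 0 <= nrm2 dm by apply: sumr_ge0 => i _; exact: sqr_ge0.
  have := @transport R _ nu (lin dm) (2 / rho * (1 + t) * nrm2 dm) nu0 nu1 _ P.
  rewrite dlin -/K; have -> : \sum_i dm i * dm i = nrm2 dm by apply: eq_bigr => i _; rewrite expr2.
  have s0 : 0 <= 2 / rho * (1 + t) * nrm2 dm.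
    apply: mulr_ge0 => //; apply: mulr_ge0; last by lra.
    by apply: divr_ge0 => //; exact: ltW.
  move=> tr; have {tr} : nrm2 dm ^+ 2 <= 2 * (2 / rho * (1 + t) * nrm2 dm) * K.
    apply: tr => // u.
    have := @tilt_variance d t rho c (fun i => h i + u * dm i) dm c0 ce rho0 cc t0 phit.
    move=> /(_ _ erefl); set W := tilt _ _.
    have WE x : nu x * expR (u * lin dm x) = W x / Z.
      by rewrite /nu /w /W /tilt linD expRD; ring.
    have mE k : \sum_x nu x * lin dm x ^+ k * expR (u * lin dm x) = (\sum_x W x * lin dm x ^+ k) / Z.
      by rewrite mulr_suml; apply: eq_bigr => x _; rewrite mulrAC WE; ring.
    have m0 : \sum_x W x * lin dm x ^+ 0 = \sum_x W x.
      by apply: eq_bigr => x _; rewrite expr0 mulr1.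
    have m1 : \sum_x W x * lin dm x ^+ 1 = \sum_x W x * lin dm x.
      by apply: eq_bigr => x _; rewrite expr1.
    rewrite !mE m0 m1.
    set s2 := \sum_x W x * lin dm x ^+ 2; set s1 := \sum_x W x * lin dm x; set s0' := \sum_x W x.
    move=> hv.
    have -> : s2 / Z * (s0' / Z) - (s1 / Z) ^+ 2 = (s2 * s0' - s1 ^+ 2) / Z ^+ 2 by field; exact: lt0r_neq0.
    have -> : 2 / rho * (1 + t) * nrm2 dm * (s0' / Z) ^+ 2 = 2 / rho * (1 + t) * nrm2 dm * s0' ^+ 2 / Z ^+ 2.
      by field; rewrite !lt0r_neq0.
    by apply: ler_wpM2r => //; rewrite invr_ge0 sqr_ge0.
  have [->|nz] := eqVneq (nrm2 dm) 0.
    move=> _; apply: mulr_ge0 => //; apply: mulr_ge0; last by lra.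
    by apply: divr_ge0 => //; exact: ltW.
  have np : 0 < nrm2 dm by rewrite lt_def nz.
  move=> hh; rewrite -(ler_pM2l np) -expr2; apply: (le_trans hh).
  by rewrite le_eqVlt; apply/orP; left; apply/eqP; field; exact: lt0r_neq0.
have ua : \sum_j pj * (\sum_x P x * uj d j x - \sum_x nu x * uj d j x) ^+ 2
    <= (4 / rho * (1 + t) * lam * d ^+ 2) * K.
  have ue j : \sum_x P x * uj d j x - \sum_x nu x * uj d j x = d * sgn j.2 * \sum_i v j.1 i * dm i.
    rewrite -dlin mulrBr !mulr_sumr; congr (_ - _); apply: eq_bigr => x _; rewrite /uj; ring.
  under eq_bigr do rewrite ue.
  rewrite (sum_pairs (fun j => (d * sgn j.2 * \sum_i v j.1 i * dm i) ^+ 2)).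
  have -> : \sum_k (((d * sgn true * \sum_i v k i * dm i) ^+ 2 + (d * sgn false * \sum_i v k i * dm i) ^+ 2) / 2)
     = d ^+ 2 * \sum_k (\sum_i v k i * dm i) ^+ 2.
    by rewrite mulr_sumr; apply: eq_bigr => k _; rewrite /sgn; field.
  rewrite mulrCA; apply: (le_trans (ler_wpM2l (sqr_ge0 d) (v_lam dm))).
  have := ler_wpM2l (mulr_ge0 (sqr_ge0 d) lam0) dm_le; lra.
have smix x : \sum_j pj * (1 + (uj d j x + r j x)) = 1.
  have e2 j : 1 + (uj d j x + r j x) = expR (uj d j x) / phi d x by rewrite /r; ring.
  under eq_bigr do rewrite e2 mulrA; rewrite -mulr_suml -phi_mix divff//.
  exact/lt0r_neq0/phi_gt0.
have p1 : \sum_(j : 'I_m * bool) pj = 1.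
  rewrite sumr_const card_prod card_ord card_bool -[pj *+ _]mulr_natr natrM /pj; field; exact: lt0r_neq0.
have eta1 : 10 * (3 * y) <= 1 by lra.
have eta0 : 0 <= 3 * y by lra.
have := mixture_entropy nu0 nu1 PP (fun j => pj0) p1 smix eta0 eta1 urb rb t0 ua.
rewrite -/K; set X := \sum_j _; set cf := (_ + _) / (2 * _) => hX.
(* The chain rule for entropy. *)
have XE : Ent w f - \sum_j Ent (fun x => pj * wj j x) f = B * X.
  have e2 j x : pj * (1 + (uj d j x + r j x)) = pj * expR (uj d j x) / phi d x by rewrite /r; ring.
  have bE j : \sum_x P x * (pj * (1 + (uj d j x + r j x))) = (\sum_x pj * wj j x * f x) / B.
    by rewrite mulr_suml; apply: eq_bigr => x _; rewrite e2 wjE /P; ring.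
  have aE j : \sum_x nu x * (pj * (1 + (uj d j x + r j x))) = (\sum_x pj * wj j x) / Z.
    by rewrite mulr_suml; apply: eq_bigr => x _; rewrite e2 wjE /nu; ring.
  rewrite /X; under [X in _ * X]eq_bigr do rewrite bE aE.
  have -> : Ent w f = \sum_j (\sum_x pj * wj j x * f x * ln (f x) - (\sum_x pj * wj j x * f x) * ln (B / Z)).
    rewrite sumrB -mulr_suml exchange_big/= /Ent -/B -/Z; congr (_ - _ * _).
      by apply: eq_bigr => x _; rewrite wsum !mulr_suml.
    by rewrite exchange_big/=; apply: eq_bigr => x _; rewrite wsum mulr_suml.
  rewrite -sumrB mulr_sumr; apply: eq_bigr => j _; rewrite /Ent.
  set b := \sum_x pj * wj j x * f x; set al := \sum_x pj * wj j x.
  have al0 : 0 < al by apply: spins_pos => x; rewrite mulr_gt0.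
  have : 0 <= b by apply: sumr_ge0 => x _; rewrite mulr_ge0.
  rewrite le_eqVlt => /orP[/eqP<-|bp]; first by rewrite !mul0r mulr0 !subr0 subrr.
  rewrite (ln_divE (divr_gt0 bp Bn) (divr_gt0 al0 Z0)) !ln_divE//; field; exact: lt0r_neq0.
(* The leading term is [4 * lam * d ^ 2 / rho / 2]; the rest is absorbed by [e]. *)
have cfle : cf <= 2 * (lam + e) * d ^+ 2 / rho.
  rewrite /cf ler_pdivrMr; last by lra.
  rewrite [leRHS]mulrAC ler_pdivlMr//.
  have -> : ((1 + t) * (4 / rho * (1 + t) * lam * d ^+ 2) + (1 + t^-1) * (2 * (4 * y ^+ 2) ^+ 2)) * rho
    = (1 + t) ^+ 2 * 4 * lam * d ^+ 2 + rho * ((1 + t^-1) * (32 * y ^+ 4)) by field; rewrite !lt0r_neq0.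
  have t2 : (1 + t) ^+ 2 <= 1 + e / 2 by rewrite /t; nra.
  have b1 : (1 + t^-1) * (32 * y ^+ 4) <= (3 / 100) * e * d ^+ 2.
    have -> : y ^+ 4 = d ^+ 2 * (L * y) ^+ 2 by rewrite /y; ring.
    have l2 : 10000 * (L * y) ^+ 2 <= e ^+ 2.
      have : 0 <= L * y by rewrite mulr_ge0 ?(ltW y0)//; lra.
      by move: Ly; set z := L * y; move=> *; nra.
    have ti : (1 + t^-1) * e <= 9.
      rewrite /t mulrDl invf_div divfK ?gt_eqF// mul1r.
      by have -> : 9 = 1 + 8 :> R; [ring | rewrite lerD2r].
    have d2 : 0 <= d ^+ 2 by exact: sqr_ge0.
    have ti1 : 0 < t^-1 by rewrite invr_gt0.
    have ti0 : 0 <= 1 + t^-1 by rewrite addr_ge0// ltW.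
    have s1 := ler_wpM2l (mulr_ge0 ti0 d2) l2.
    have s3 := mulr_ge0 (ltW e0) d2.
    have s2 := ler_wpM2r s3 ti.
    clearbody y t; lra.
  have b2 : rho * ((1 + t^-1) * (32 * y ^+ 4)) <= (3 / 100) * e * d ^+ 2.
    have ti1 : 0 < t^-1 by rewrite invr_gt0.
    apply: le_trans b1; apply: ler_piMl => //; apply: mulr_ge0; first by lra.
    by apply: mulr_ge0 => //; apply: exprn_ge0; exact: ltW.
  have d2 : 0 <= d ^+ 2 by exact: sqr_ge0.
  have b3 := ler_wpM2r (mulr_ge0 lam0 d2) t2.
  have le1 : (lam + e) * (5 * (3 * y)) <= (9 / 40) * e.
    have : lam + e <= 3 / 2 by lra.
    by nra.
  have b4 := ler_wpM2r d2 le1.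
  have b5 : lam * e * d ^+ 2 <= e * d ^+ 2 / 2.
    by have := ler_wpM2r (mulr_ge0 (ltW e0) d2) h_lam; lra.
  have b6 := mulr_ge0 (ltW e0) d2.
  move: b2 b3 b4 b5 b6; set X1 := rho * _; set X2 := (1 + t) ^+ 2; move=> *.
  lra.
have hEX : Ent w f = B * K by rewrite KE mulrC divfK ?gt_eqF.
have hX2 : rho * (B * X) <= 2 * (lam + e) * d ^+ 2 * Ent w f.
  rewrite hEX; have s1 := ler_wpM2r K0 cfle; have s2 := le_trans hX s1.
  have s3 := ler_wpM2l (mulr_ge0 (ltW rho0) (ltW Bn)) s2.
  rewrite mulrA; apply: (le_trans s3); rewrite le_eqVlt; apply/orP; left; apply/eqP.
  field; exact: lt0r_neq0.
by move: pieces hX2; rewrite -XE; lra.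
Qed.

End Localization.

(** ** The limit of small steps *)

Section Limit.
Variables (R : realType) (n m : nat) (v : 'I_m -> 'I_n -> R) (L lam : R).
Hypothesis n_gt0 : (0 < n)%N.
Hypothesis m_gt0 : (0 < m)%N.
Hypothesis L1 : 1 <= L.
Hypothesis vL : forall k (x : spins n), `|lin (v k) x| <= L.
Hypothesis lam0 : 0 <= lam.
Hypothesis lam_lt : 2 * lam < 1.
Hypothesis v_lam : forall th : 'I_n -> R,
  m%:R^-1 * \sum_k (\sum_i v k i * th i) ^+ 2 <= lam * nrm2 th.
Implicit Types (x : spins n) (d e rho : R) (c f : spins n -> R).

Lemma localization_iter d e c N :
  0 < d -> 0 < e <= 1 -> 100 * (d * L ^+ 2) <= e ->
  2 * (lam + e) * (N%:R * d ^+ 2) < 1 ->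
  (forall x, 0 < c x) -> (forall x, c (flip x) = c x) -> contr 1 c ->
  contr (1 - 2 * (lam + e) * (N%:R * d ^+ 2)) (fun x => phi v d x ^+ N * c x).
Proof.
move=> d0 e01 dLe + c0 ce cc; have [h_lam0 h_lam] := conj lam0 lam_lt.
have e0 : 0 < e by case/andP: e01.
have d2 : 0 < d ^+ 2 by rewrite exprn_gt0.
have le0 : 0 <= lam + e by lra.
elim: N => [_|N IH hN].
  rewrite mul0r mulr0 subr0; have -> // : (fun x => phi v d x ^+ 0 * c x) = c.
  by apply/funext => x; rewrite expr0 mul1r.
have hN' : 2 * (lam + e) * (N%:R * d ^+ 2) + 2 * (lam + e) * d ^+ 2 =
    2 * (lam + e) * (N.+1%:R * d ^+ 2) by rewrite -natr1; ring.
have p1 : 0 <= 2 * (lam + e) * d ^+ 2 by rewrite mulr_ge0 ?mulr_ge0// ltW.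
have p2 : 0 <= 2 * (lam + e) * (N%:R * d ^+ 2).
  by rewrite mulr_ge0 ?mulr_ge0// ?ler0n// ltW.
have lt1 : 2 * (lam + e) * (N%:R * d ^+ 2) < 1 by lra.
have -> : 1 - 2 * (lam + e) * (N.+1%:R * d ^+ 2) =
  (1 - 2 * (lam + e) * (N%:R * d ^+ 2)) - 2 * (lam + e) * d ^+ 2 by rewrite -hN'; ring.
have -> : (fun x => phi v d x ^+ N.+1 * c x) = (fun x => phi v d x * (phi v d x ^+ N * c x)).
  by apply/funext => x; rewrite exprS mulrA.
apply: (localization_step n_gt0 m_gt0 L1 vL lam0 _ v_lam) => //.
- by lra.
- by lra.
- by move=> x; rewrite mulr_gt0// exprn_gt0// (phi_gt0 v m_gt0).
- by move=> x; rewrite phi_flip ce.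
- exact: IH.
Qed.

Definition energy x : R := m%:R^-1 * \sum_k lin (v k) x ^+ 2.

Lemma expR_quad_le (z : R) : 0 <= z -> expR (z - z ^+ 2) <= 1 + z.
Proof.
move=> z0; have h := expR_ge1Dx (- (z - z ^+ 2)).
rewrite -[z - z ^+ 2]opprK expRN -[leRHS]invrK lef_pV2 ?posrE ?expR_gt0 ?invr_gt0//; last by lra.
apply: le_trans h; rewrite -[leLHS]mul1r ler_pdivrMr; last by lra.
have : 0 <= z ^+ 3 by rewrite exprn_ge0.
by lra.
Qed.

(** With [N = 1 / d ^ 2] steps the product of the cosh weights is the Gaussian
    interaction up to a factor tending to 1. *)
Lemma phi_pow_energy d N x : 0 < d -> d * L <= 2^-1 -> N%:R * d ^+ 2 = 1 ->
  expR (energy x / 2 - (d * L ^+ 2) ^+ 2) <= phi v d x ^+ N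
    <= expR (energy x / 2 + (d * L ^+ 2) ^+ 2).
Proof.
move=> d0 dL Nd; have h_L1 : 1 <= L := L1.
have m0 : 0 < m%:R^-1 :> R by rewrite invr_gt0 ltr0n.
set q := energy x.
have q0 : 0 <= q by rewrite mulr_ge0 ?(ltW m0)// sumr_ge0// => k _; rewrite sqr_ge0.
have l2 k : lin (v k) x ^+ 2 <= L ^+ 2.
  by rewrite -[leLHS]real_normK ?num_real// ler_sqr ?nnegrE// ?vL//; lra.
have qL : q <= L ^+ 2.
  rewrite /q /energy mulrC ler_pdivrMr ?ltr0n//.
  apply: (le_trans (ler_sum _ (fun k _ => l2 k))).
  by rewrite sumr_const card_ord [leRHS]mulr_natr.
have d2 : 0 < d ^+ 2 by rewrite exprn_gt0.
pose z := d ^+ 2 * q / 2.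
have z0 : 0 <= z by rewrite divr_ge0// mulr_ge0// ltW.
have lo : 1 + z <= phi v d x.
  have -> : 1 + z = m%:R^-1 * \sum_k (1 + (d * lin (v k) x) ^+ 2 / 2).
    rewrite big_split/= sumr_const card_ord mulrDr mulVf ?pnatr_eq0 -?lt0n//.
    congr (_ + _); rewrite /z /q /energy !mulr_sumr mulr_suml.
    by apply: eq_bigr => k _; ring.
  by apply: (ler_wpM2l (ltW m0)); apply: ler_sum => k _; exact: ch_ge_quad.
have up : phi v d x <= 1 + (1 + 2 * (d * L) ^+ 2) * z.
  have -> : 1 + (1 + 2 * (d * L) ^+ 2) * z =
     m%:R^-1 * \sum_k (1 + (1 + 2 * (d * L) ^+ 2) * (d * lin (v k) x) ^+ 2 / 2).
    rewrite big_split/= sumr_const card_ord mulrDr mulVf ?pnatr_eq0 -?lt0n//.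
    congr (_ + _); rewrite /z /q /energy !mulr_sumr mulr_suml mulr_sumr.
    by apply: eq_bigr => k _; ring.
  apply: (ler_wpM2l (ltW m0)); apply: ler_sum => k _.
  have h : `|d * lin (v k) x| <= d * L by rewrite normrM gtr0_norm// ler_wpM2l// ltW.
  apply: (le_trans (ch_le_sharp (le_trans h dL))).
  have h2 : (d * lin (v k) x) ^+ 2 <= (d * L) ^+ 2.
    by rewrite -[leLHS]real_normK ?num_real// ler_sqr ?nnegrE// (le_trans _ h).
  have h3 := sqr_ge0 (d * lin (v k) x).
  by nra.
have Nz : N%:R * z = q / 2.
  have -> : N%:R * z = (N%:R * d ^+ 2) * (q / 2) by rewrite /z; ring.
  by rewrite Nd mul1r.
have qq : q ^+ 2 <= (L ^+ 2) ^+ 2 by rewrite ler_sqr ?nnegrE// exprn_ge0//; lra.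
apply/andP; split.
  have Nz2 : N%:R * z ^+ 2 <= (d * L ^+ 2) ^+ 2.
    have -> : N%:R * z ^+ 2 = d ^+ 2 * q ^+ 2 / 4.
      have -> : N%:R * z ^+ 2 = (N%:R * z) * z by ring.
      by rewrite Nz /z; field.
    by have := ler_wpM2l (ltW d2) qq; have := mulr_ge0 (ltW d2) (sqr_ge0 q); lra.
  apply: (@le_trans _ _ (expR (N%:R * (z - z ^+ 2)))).
    by rewrite ler_expR mulrBr Nz; lra.
  rewrite expRM_natl lerXn2r ?nnegrE ?expR_ge0//.
    by apply: le_trans lo; lra.
  exact: le_trans (expR_quad_le z0) lo.
apply: (@le_trans _ _ (expR (N%:R * ((1 + 2 * (d * L) ^+ 2) * z)))).
  rewrite expRM_natl lerXn2r ?nnegrE ?expR_ge0//.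
    by apply: le_trans lo; lra.
  by apply: (le_trans up); exact: expR_ge1Dx.
rewrite ler_expR mulrCA Nz.
have := ler_wpM2l (sqr_ge0 (d * L)) qL.
have -> : (d * L) ^+ 2 * L ^+ 2 = (d * L ^+ 2) ^+ 2 by ring.
lra.
Qed.

(** Adding a positive semidefinite interaction of norm [lam] multiplies the
    contraction rate by [1 - 2 * lam] at worst. *)
Lemma localization c : (forall x, 0 < c x) -> (forall x, c (flip x) = c x) ->
  contr 1 c -> contr (1 - 2 * lam) (fun x => c x * expR (energy x / 2)).
Proof.
move=> c0 ce cc h f f0.
have [h_lam0 h_lam h_L] := And3 lam0 lam_lt L1.
set w := tilt _ h.
have wp x : 0 < w x by rewrite /w /tilt; do 2?apply: mulr_gt0 => //; exact: expR_gt0.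
have E0 : 0 <= Ent w f by apply: Ent_ge0 => // x; exact: ltW.
have D0 : 0 <= n%:R * lost_ent (Dpol R (n := n)) w f.
  apply: mulr_ge0 => //; apply: lost_ent_ge0 => // x; last exact: ltW.
  by move=> T; exact: Dpol_ge0.
set E := Ent w f in E0 *; set D := n%:R * _ in D0 *.
pose e0 := Num.min (4^-1) ((1 - 2 * lam) / 4).
apply: (@le_of_small _ _ _ (2 * E + 4 * D) e0).
- by rewrite lt_min invr_gt0 ltr0n divr_gt0//; lra.
- by lra.
move=> e /andP[ep]; rewrite /e0 le_min => /andP[e4 el].
have L2 : 1 <= L ^+ 2 by nra.
(* The step [d = 1 / k] is small enough for [localization_step] with error [e]. *)
pose k := (Num.truncn (100 * L ^+ 2 / e)).+1.
have kk : 100 * L ^+ 2 / e < k%:R by exact: truncnS_gt.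
have k0 : 0 < k%:R :> R by rewrite ltr0n.
pose d : R := k%:R^-1.
have d0 : 0 < d by rewrite invr_gt0.
have dLe : 100 * (d * L ^+ 2) <= e.
  move: kk; rewrite ltr_pdivrMr// => kk.
  rewrite /d mulrCA mulrC ler_pdivrMr//; lra.
have Nd : (k * k)%:R * d ^+ 2 = 1 by rewrite natrM /d; field; exact: lt0r_neq0.
have dL : d * L <= 2^-1.
  have : d * L <= d * L ^+ 2 by apply: (ler_wpM2l (ltW d0)); nra.
  lra.
have cN := @localization_iter d e c (k * k) d0 (ltac:(lra)) dLe.
rewrite Nd mulr1 in cN; have {cN} := cN (ltac:(lra)) c0 ce cc h f f0.
set wN := tilt _ h => cN.
set ka := (d * L ^+ 2) ^+ 2.
have kae : ka <= e.
  have : 0 <= d * L ^+ 2 by rewrite mulr_ge0 ?(ltW d0)//; lra.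
  by rewrite /ka; set z := d * L ^+ 2 in dLe *; nra.
have wNp x : 0 < wN x.
  rewrite /wN /tilt mulr_gt0 ?expR_gt0// mulr_gt0// exprn_gt0//.
  exact: (phi_gt0 v m_gt0).
have cmp1 x : w x <= expR ka * wN x.
  rewrite /w /wN /tilt mulrA; apply: ler_wpM2r; first exact: expR_ge0.
  rewrite mulrA mulrC; apply: ler_wpM2r; first exact: ltW.
  have /andP[h1 _] := phi_pow_energy x d0 dL Nd.
  apply: (le_trans _ (ler_wpM2l (expR_ge0 ka) h1)).
  by rewrite -expRD ler_expR -/ka; lra.
have cmp2 x : wN x <= expR ka * w x.
  rewrite /w /wN /tilt mulrA; apply: ler_wpM2r; first exact: expR_ge0.
  rewrite mulrCA mulrC; apply: ler_wpM2l; first exact: ltW.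
  have /andP[_ h1] := phi_pow_energy x d0 dL Nd.
  by apply: (le_trans h1); rewrite -expRD ler_expR -/ka; lra.
have i1 : E <= expR ka * Ent wN f.
  by apply: Ent_mono => // [x|x|]; rewrite ?expR_ge0//; exact: ltW.
have i2 : lost_ent (Dpol R (n := n)) wN f <= expR ka * lost_ent (Dpol R (n := n)) w f.
  apply: lost_ent_mono => // [x T|x|x|]; rewrite ?expR_ge0//; [exact: Dpol_ge0|exact: ltW|exact: ltW].
have rN0 : 0 <= 1 - 2 * (lam + e) by lra.
have i3 : (1 - 2 * (lam + e)) * E <= expR ka * (expR ka * D).
  apply: (le_trans (ler_wpM2l rN0 i1)); rewrite mulrCA; apply: ler_wpM2l; first exact: expR_ge0.
  apply: (le_trans cN); rewrite /D mulrCA; apply: ler_wpM2l => //.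
have ex : expR ka * expR ka <= 1 + 4 * e.
  rewrite -expRD; apply: (@le_trans _ _ (expR (2 * e))); first by rewrite ler_expR; lra.
  have : `|2 * e| <= 2^-1 by rewrite ger0_norm; lra.
  by move/expR_le_quad; nra.
have := ler_wpM2r D0 ex; move: i3; rewrite mulrA; lra.
Qed.

End Limit.

(** * Positive semidefinite matrices and the operator norm *)

Section Psd.
Variables (R : realType) (n : nat).
Implicit Types (A : 'I_n -> 'I_n -> R) (u : 'I_n -> R).

(** Symmetric elimination, one row at a time: subtracting
    [A p i * A p j / A p p] keeps the form non-negative. *)
Lemma psd_factor_rows k A : (forall i j, A i j = A j i) ->
  (forall u, 0 <= qf A u u) -> (forall i j : 'I_n, (k <= i)%N -> A i j = 0) ->
  exists a : 'I_n -> 'I_n -> R,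
    (forall i j, A i j = \sum_l a l i * a l j) /\
    (forall l j : 'I_n, (k <= l)%N -> a l j = 0).
Proof.
elim: k A => [|k IH] A As Ap Az.
  exists (fun _ _ => 0); split=> // i j; rewrite Az// big1// => l _.
  by rewrite mul0r.
have [kn|kn] := ltnP k n; last first.
  have [|a [a1 a2]] := IH A As Ap.
    by move=> i j ki; have := ltn_ord i; rewrite ltnNge (leq_trans kn ki).
  by exists a; split=> // l j kl; apply: a2; exact: ltnW.
pose p := Ordinal kn; pose ep i : R := (i == p)%:R.
have epE u : qf A ep u = \sum_j A p j * u j.
  rewrite /qf (bigD1 p)//= /ep eqxx mul1r [X in _ + X]big1 ?addr0// => i /negbTE->.
  by rewrite mul0r.
have epp : qf A ep ep = A p p.
  rewrite epE (bigD1 p)//= /ep eqxx mulr1 [X in _ + X]big1 ?addr0// => i /negbTE->.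
  by rewrite mulr0.
have App : 0 <= A p p by rewrite -epp.
have geP (i : 'I_n) : (k <= i)%N -> i = p \/ (k < i)%N.
  by rewrite leq_eqVlt => /orP[/eqP e|]; [left; apply: val_inj|right].
(* A zero diagonal entry of a non-negative form forces its row to vanish. *)
have [Ap0|Apn] := eqVneq (A p p) 0.
  have Apj j : A p j = 0.
    apply/eqP; apply/negPn/negP => nz.
    pose ej i : R := (i == j)%:R.
    have ejE u : qf A u ej = \sum_i A i j * u i.
      apply: eq_bigr => i _; rewrite (bigD1 j)//= /ej eqxx mulr1 [X in _ + X]big1 ?addr0 1?mulrC// => l /negbTE->.
      by rewrite mulr0.
    have cross : qf A ep ej = A p j.
      rewrite ejE (bigD1 p)//= /ep eqxx mulr1 [X in _ + X]big1 ?addr0// => i /negbTE->.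
      by rewrite mulr0.
    have := Ap (fun i => ej i + (- (qf A ej ej + 1) / (2 * A p j)) * ep i).
    rewrite !(qfDl, qfDr) epp Ap0 (qfC ej ep As) cross.
    set t := qf A ej ej; have -> : t + - (t + 1) / (2 * A p j) * A p j +
      - (t + 1) / (2 * A p j) * (A p j + - (t + 1) / (2 * A p j) * 0) = -1.
      by field.
    by rewrite ler0N1.
  have [|a [a1 a2]] := IH A As Ap.
    by move=> i j /geP[->//|]; exact: Az.
  by exists a; split=> // l j kl; apply: a2; exact: ltnW.
have Appp : 0 < A p p by rewrite lt_def Apn.
pose s := Num.sqrt (A p p).
have s0 : 0 < s by rewrite sqrtr_gt0.
have s2 : s ^+ 2 = A p p by rewrite sqr_sqrtr.
pose b j := A p j / s.
pose A' i j := A i j - b i * b j.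
have [|||a [a1 a2]] := IH A'.
- by move=> i j; rewrite /A' As mulrC.
- move=> u; pose c := - (qf A ep u / A p p).
  have := Ap (fun i => u i + c * ep i).
  rewrite !(qfDl, qfDr) epp (qfC u ep As).
  suff -> : qf A' u u = qf A u u - (qf A ep u) ^+ 2 / A p p.
    set t := qf A u u; set r := qf A ep u.
    have -> : t + c * r + c * (r + c * A p p) = t - r ^+ 2 / A p p by rewrite /c -/r; field.
    by [].
  have bE : \sum_i b i * u i = qf A ep u / s.
    by rewrite epE mulr_suml; apply: eq_bigr => i _; rewrite /b; ring.
  transitivity (qf A u u - (\sum_i b i * u i) ^+ 2); last first.
    by rewrite bE -s2; field; exact: lt0r_neq0.
  rewrite expr2 mulr_suml -sumrB; apply: eq_bigr => i _.
  rewrite -mulrA [b i * _]mulrCA -mulrBr; congr (_ * _); rewrite mulr_sumr -sumrB.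
  by apply: eq_bigr => j _; rewrite /A'; ring.
- move=> i j /geP[->|ki]; rewrite /A' /b.
    by rewrite -s2; field; exact: lt0r_neq0.
  by rewrite Az// (As p i) Az// !mul0r subrr.
exists (fun l => if l == p then b else a l); split=> [i j|l j kl].
  rewrite (bigD1 p)//= eqxx; have -> : A i j = b i * b j + A' i j by rewrite /A'; ring.
  congr (_ + _); rewrite a1 (bigD1 p)//= !a2// mul0r add0r.
  by apply: eq_bigr => l /negbTE->.
case: eqP => [e|_]; first by move: kl; rewrite e ltnn.
exact/a2/ltnW.
Qed.

Lemma l2norm_sqr (u : 'cV[R]_n) : l2norm u ^+ 2 = \sum_i u i 0 ^+ 2.
Proof. by rewrite sqr_sqrtr// sumr_ge0// => i _; rewrite sqr_ge0. Qed.

Lemma opnorm_ub (J : 'M[R]_n) (u : 'cV[R]_n) : l2norm u <= 1 ->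
  l2norm (J *m u) <= opnorm J.
Proof.
move=> u1; apply: ub_le_sup; last by exists u.
exists (Num.sqrt (\sum_i (\sum_j `|J i j|) ^+ 2)) => _ [z /= z1 <-].
rewrite ler_wsqrtr//; apply: ler_sum => i _.
rewrite -[leLHS]real_normK ?num_real// ler_sqr ?nnegrE ?normr_ge0// ?sumr_ge0//.
rewrite mxE; apply: (le_trans (ler_norm_sum _ _ _)); apply: ler_sum => j _.
rewrite normrM ler_piMr//; apply: (le_trans _ z1).
rewrite -(@ler_sqr _ `|_|) ?nnegrE ?sqrtr_ge0// real_normK ?num_real// l2norm_sqr.
by rewrite (bigD1 j)//= lerDl sumr_ge0// => l _; rewrite sqr_ge0.
Qed.

Lemma opnorm_ge0 (J : 'M[R]_n) : 0 <= opnorm J.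
Proof.
apply: (le_trans _ (@opnorm_ub J 0 _)); first exact: sqrtr_ge0.
by rewrite /l2norm big1 ?sqrtr0// => i _; rewrite mxE expr0n.
Qed.

Lemma opnorm_quad (J : 'M[R]_n) u : qf (fun i j => J i j) u u <= opnorm J * nrm2 u.
Proof.
have n0 : 0 <= nrm2 u by apply: sumr_ge0 => i _; exact: sqr_ge0.
set o := opnorm J; have o0 : 0 <= o := opnorm_ge0 J.
have [un|un] := eqVneq (nrm2 u) 0.
  have u0 i : u i = 0.
    have h0 j : 0 <= u j ^+ 2 by exact: sqr_ge0.
    by apply/eqP; rewrite -sqrf_eq0; apply/eqP; exact: (sum_eq0_ge0 h0 un).
  by rewrite un mulr0 /qf big1// => i _; rewrite u0 mul0r.
have up : 0 < nrm2 u by rewrite lt_def un.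
pose s := Num.sqrt (nrm2 u); have s0 : 0 < s by rewrite sqrtr_gt0.
have s2 : s ^+ 2 = nrm2 u by rewrite sqr_sqrtr.
pose z : 'cV[R]_n := \col_i (u i / s).
have z1 : \sum_i z i 0 ^+ 2 = 1.
  transitivity (nrm2 u / s ^+ 2); last by rewrite s2 divff.
  by rewrite /nrm2 mulr_suml; apply: eq_bigr => i _; rewrite mxE exprMn exprVn.
have zl : l2norm z <= 1 by rewrite /l2norm z1 sqrtr1.
have y2 : \sum_i (J *m z) i 0 ^+ 2 <= o ^+ 2.
  by rewrite -l2norm_sqr ler_sqr ?nnegrE ?sqrtr_ge0// opnorm_ub.
have qz : qf (fun i j => J i j) u u = s ^+ 2 * \sum_i z i 0 * (J *m z) i 0.
  rewrite /qf mulr_sumr; apply: eq_bigr => i _; rewrite !mxE.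
  have -> : \sum_j J i j * z j 0 = (\sum_j J i j * u j) / s.
    by rewrite mulr_suml; apply: eq_bigr => j _; rewrite mxE mulrA.
  by field; exact: lt0r_neq0.
rewrite qz s2 mulrC ler_wpM2r//.
have [o00|on] := eqVneq o 0.
  have y0 i : (J *m z) i 0 = 0.
    have h0 j : 0 <= (J *m z) j 0 ^+ 2 by exact: sqr_ge0.
    apply/eqP; rewrite -sqrf_eq0; apply/eqP; apply: (sum_eq0_ge0 h0).
    by apply/eqP; rewrite eq_le sumr_ge0// andbT; move: y2; rewrite o00 expr0n.
  by rewrite o00 big1// => i _; rewrite y0 mulr0.
have op : 0 < o by rewrite lt_def on.
(* Cauchy-Schwarz, in the form [2 o z y <= o ^ 2 z ^ 2 + y ^ 2]. *)
have : \sum_i (2 * o * (z i 0 * (J *m z) i 0)) <= \sum_i (o ^+ 2 * z i 0 ^+ 2 + (J *m z) i 0 ^+ 2).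
  by apply: ler_sum => i _; have := sqr_ge0 (o * z i 0 - (J *m z) i 0); lra.
rewrite -mulr_sumr big_split/= -mulr_sumr z1 mulr1 => h.
rewrite -(ler_pM2l op); lra.
Qed.

End Psd.

(** * Entropy contraction for Ising measures *)

Section Ising.
Variables (R : realType) (n : nat).
Hypothesis n_gt0 : (0 < n)%N.
Implicit Types (x : spins n).

Lemma contracts_kl (rho : R) (w nu' : spins n -> R) :
  (forall x, 0 < w x) -> contracts rho w ->
  is_prob nu' -> let nu x := w x / \sum_y w y in
  kl_div (push nu' (Dpol R (n := n))) (push nu (Dpol R (n := n)))
    <= (1 - rho / n%:R) * kl_div nu' nu.
Proof.
move=> wp cw [p0 p1] /=; set Z := \sum_y w y; set nu := fun x => _.
have Z0 : 0 < Z := spins_pos wp.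
have nR : 0 < n%:R :> R by rewrite ltr0n.
pose f x := nu' x / nu x.
have nu0 x : 0 < nu x by rewrite divr_gt0.
have nuf x : nu x * f x = nu' x by rewrite /f mulrC divfK// lt0r_neq0.
have nufE : (fun x => nu x * f x) = nu' by apply/funext.
have f0 x : 0 <= f x by apply: divr_ge0 => //; exact: ltW.
have nuE : nu =1 (fun x => Z^-1 * w x) by move=> x; rewrite mulrC.
have cnu : rho * Ent nu f <= n%:R * lost_ent (Dpol R (n := n)) nu f.
  rewrite (eq_Ent f nuE) Ent_scale ?invr_gt0// mulrCA.
  have -> : lost_ent (Dpol R (n := n)) nu f = Z^-1 * lost_ent (Dpol R (n := n)) w f.
    rewrite /lost_ent mulr_sumr; apply: eq_bigr => T _.
    by rewrite -Ent_scale ?invr_gt0//; apply: eq_Ent => x; rewrite nuE mulrA.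
  rewrite [leRHS]mulrCA; apply: ler_wpM2l; first by rewrite invr_ge0 ltW.
  exact: cw.
have nu1 : \sum_x nu x = 1 by rewrite -mulr_suml divff// lt0r_neq0.
have EE : Ent nu f = kl_div nu' nu.
  rewrite /Ent; under [X in _ - X * _]eq_bigr do rewrite nuf.
  rewrite p1 nu1; under [X in X / _]eq_bigr do rewrite nuf.
  rewrite p1 divr1 ln1 mulr0 subr0; apply: eq_bigr => x _.
  by rewrite nuf.
move: cnu; rewrite lost_entE; last exact: Dpol_total.
rewrite nufE -/(kl_div (push nu' (Dpol R (n := n))) (push nu (Dpol R (n := n)))).
have -> : \sum_x nu x * f x * ln (f x) = kl_div nu' nu.
  by apply: eq_bigr => x _; rewrite nuf.
rewrite EE; set K := kl_div nu' nu; set K' := kl_div _ _ => h.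
rewrite -(ler_pM2l nR); have -> : n%:R * ((1 - rho / n%:R) * K) = n%:R * K - rho * K.
  by field; exact: lt0r_neq0.
by lra.
Qed.

Variables (J : 'M[R]_n) (h : 'cV[R]_n) (gamma : R).
Hypothesis Jpsd : psd J.
Hypothesis gamma0 : 0 <= gamma.

(** The Ising weight without the positive interaction and the external field. *)
Definition repulsion x : R :=
  expR (- (gamma / (2 * n%:R) * (\sum_i sg R x i) ^+ 2)).

(** The constant [exp (- sum g)] normalizes the field at the empty plus set. *)
Definition size_weight (g : 'I_n -> R) k : R :=
  expR (- (\sum_i g i) - gamma / (2 * n%:R) * (2 * k%:R - n%:R) ^+ 2).

Lemma repulsionE g x : tilt repulsion g x =
  size_weight g #|plus x| * \prod_(i in plus x) expR (2 * g i).
Proof.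
have sumE (c : 'I_n -> R) : \sum_i c i * sg R x i = 2 * (\sum_(i in plus x) c i) - \sum_i c i.
  rewrite mulr_sumr [X in _ = X - _]big_mkcond/= -sumrB; apply: eq_bigr => i _.
  by rewrite inE /sg; case: (x i); ring.
rewrite /tilt /repulsion -expRD /size_weight -expR_sum -expRD; congr expR.
rewrite /lin sumE.
have -> : \sum_i sg R x i = 2 * #|plus x|%:R - n%:R.
  transitivity (\sum_i 1 * sg R x i); first by apply: eq_bigr => i _; rewrite mul1r.
  by rewrite sumE !sumr_const card_ord.
by rewrite -mulr_sumr; ring.
Qed.

Let ga : 0 <= gamma / (2 * n%:R).
Proof. by rewrite divr_ge0// mulr_ge0. Qed.

(** [(2 k - n) ^ 2] is convex in [k]. *)
Lemma size_weight_exch g a b : (a < b)%N ->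
  size_weight g a * size_weight g b <= size_weight g a.+1 * size_weight g b.-1.
Proof.
case: b => // b; rewrite ltnS => ab /=.
rewrite /size_weight -!expRD ler_expR -[a.+1%:R]natr1 -[b.+1%:R]natr1.
have : 0 <= gamma / (2 * n%:R) * (b%:R - a%:R) by rewrite mulr_ge0// subr_ge0 ler_nat.
by set c := gamma / _; set y := b%:R; set z := a%:R; set k := n%:R; lra.
Qed.

Lemma repulsion_contr : contr 1 repulsion.
Proof.
move=> g f f0; rewrite mul1r.
apply: (@base_contraction R n n_gt0 (size_weight g) (fun i => expR (2 * g i))) => //.
- by move=> k; exact: expR_gt0.
- by move=> k; rewrite [leRHS]expr2; have := @size_weight_exch g k k.+2 (leqW (leqnn _)).
- by move=> i; exact: expR_gt0.
- exact: repulsionE.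
Qed.

Lemma spin_vecE x i : spin_vec R x i 0 = sg R x i.
Proof. by rewrite mxE. Qed.

Lemma weightE x : ising_weight J h gamma x =
  expR (qf (fun i j => J i j) (sg R x) (sg R x) / 2 + lin (fun i => h i 0) x
     - gamma / (2 * n%:R) * (\sum_i sg R x i) ^+ 2).
Proof.
set v := spin_vec R x.
have e1 : (v^T *m (J *m v)) 0 0 = qf (fun i j => J i j) (sg R x) (sg R x).
  rewrite mxE; apply: eq_bigr => i _; rewrite mxE spin_vecE; congr (_ * _).
  by rewrite mxE; apply: eq_bigr => j _; rewrite spin_vecE.
have e2 : (h^T *m v) 0 0 = lin (fun i => h i 0) x.
  by rewrite mxE; apply: eq_bigr => i _; rewrite mxE spin_vecE.
have e3 : \sum_i v i 0 = \sum_i sg R x i by apply: eq_bigr => i _; rewrite spin_vecE.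
by rewrite /ising_weight -/v e1 e2 e3 [2^-1 * _]mulrC.
Qed.

Lemma weight_gt0 x : 0 < ising_weight J h gamma x.
Proof. exact: expR_gt0. Qed.

Lemma weight_split x : ising_weight J h gamma x =
  tilt repulsion (fun i => h i 0) x * expR (qf (fun i j => J i j) (sg R x) (sg R x) / 2).
Proof. by rewrite weightE /tilt /repulsion -!expRD; congr expR; ring. Qed.

Lemma psd_qf_ge0 u : 0 <= qf (fun i j => J i j) u u.
Proof.
case: Jpsd => _ Jp; have := Jp (\col_i u i); rewrite -mulmxA mxE.
set S := \sum_i _; suff -> : S = qf (fun i j => J i j) u u by [].
apply: eq_bigr => i _; rewrite !mxE; congr (_ * _).
by apply: eq_bigr => j _; rewrite mxE.
Qed.

Hypothesis Jnorm : opnorm J < 2^-1.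

Lemma ising_contracts : contracts (1 - 2 * opnorm J) (ising_weight J h gamma).
Proof.
case: Jpsd => Jt _; have Jop := Jnorm.
have Js i j : J i j = J j i by rewrite -{1}Jt mxE.
have Jq := psd_qf_ge0.
have [a [aE _]] : exists a : 'I_n -> 'I_n -> R,
    (forall i j, J i j = \sum_l a l i * a l j) /\
    (forall l j : 'I_n, (n <= l)%N -> a l j = 0).
  by apply: psd_factor_rows => // i j; rewrite leqNgt ltn_ord.
have nR : 0 < n%:R :> R by rewrite ltr0n.
pose s : R := Num.sqrt n%:R.
have s2 : s ^+ 2 = n%:R by rewrite sqr_sqrtr// ltW.
(* [energy] averages over the [n] directions, hence the factor [sqrt n]. *)
pose v k i := s * a k i.
have quad u : n%:R^-1 * \sum_k (\sum_i v k i * u i) ^+ 2 = qf (fun i j => J i j) u u.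
  transitivity (\sum_k (\sum_i a k i * u i) ^+ 2).
    rewrite mulr_sumr; apply: eq_bigr => k _.
    have -> : \sum_i v k i * u i = s * \sum_i a k i * u i.
      by rewrite mulr_sumr; apply: eq_bigr => i _; rewrite mulrA.
    by rewrite exprMn s2 mulrA mulVf ?mul1r// lt0r_neq0.
  transitivity (\sum_k \sum_i \sum_j u i * (a k i * a k j * u j)).
    apply: eq_bigr => k _; rewrite expr2 mulr_suml; apply: eq_bigr => i _.
    by rewrite mulr_sumr; apply: eq_bigr => j _; ring.
  rewrite exchange_big/=; apply: eq_bigr => i _; rewrite exchange_big/= mulr_sumr.
  by apply: eq_bigr => j _; rewrite -mulr_sumr -mulr_suml aE.
pose L : R := 1 + \sum_k \sum_i `|v k i|.
have L0 : 0 <= \sum_k \sum_i `|v k i| by apply: sumr_ge0 => k _; apply: sumr_ge0.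
have vL k x : `|lin (v k) x| <= L.
  apply: (@le_trans _ _ (\sum_i `|v k i|)).
    apply: (le_trans (ler_norm_sum _ _ _)); apply: ler_sum => i _.
    by rewrite normrM /sg; case: (x i); rewrite ?normrN normr1 mulr1.
  rewrite /L [X in _ <= 1 + X](bigD1 k)//= addrCA lerDl addr_ge0//.
  by apply: sumr_ge0 => l _; exact: sumr_ge0.
have := @localization R n n v L (opnorm J) n_gt0 n_gt0 _ vL (opnorm_ge0 J).
move=> /(_ (ltac:(rewrite /L; lra)) (ltac:(lra))) loc.
have {}loc := loc (fun th => _) repulsion (fun x => expR_gt0 _) _ repulsion_contr.
have {loc} := loc _ _ (fun i => h i 0).
move=> loc; have -> : ising_weight J h gamma =
   tilt (fun x => repulsion x * expR (energy v x / 2)) (fun i => h i 0).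
  apply/funext => x; rewrite weightE /tilt /repulsion -!expRD; congr expR.
  by rewrite -quad /energy /lin; ring.
apply: loc => [th|x].
  by rewrite quad; exact: opnorm_quad.
rewrite /repulsion; congr (expR (- (_ * _))).
under eq_bigr do rewrite sg_flip.
by rewrite sumrN sqrrN.
Qed.

End Ising.

(** * Markov chains on finite types *)

Local Arguments chain_law : simpl never.

Section Chains.
Variables (R : realType) (A : finType).
Implicit Types (P : A -> A -> R) (mu p q : A -> R).

Definition stochastic (B : finType) (K : A -> B -> R) :=
  (forall a b, 0 <= K a b) /\ (forall a, \sum_b K a b = 1).

Lemma push_dirac P a : push (dirac_mass R a) P =1 P a.
Proof.
move=> b; rewrite /push (bigD1 a)//= /dirac_mass eqxx mul1r big1 ?addr0// => c.
by rewrite eq_sym => /negbTE->; rewrite mul0r.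
Qed.

Lemma chain_lawS P a t b : chain_law P a t.+1 b = \sum_c chain_law P a t c * P c b.
Proof. by []. Qed.

Lemma chain_law_add P a s t b :
  chain_law P a (s + t) b = \sum_c chain_law P a s c * chain_law P c t b.
Proof.
elim: t b => [|t IH] b.
  rewrite addn0 (bigD1 b)//= /chain_law /= /dirac_mass eqxx mulr1 big1 ?addr0// => c.
  by move=> /negbTE->; rewrite mulr0.
rewrite addnS chain_lawS; under eq_bigr do rewrite IH mulr_suml.
rewrite exchange_big/=; apply: eq_bigr => c _; rewrite chain_lawS mulr_sumr.
by apply: eq_bigr => d _; rewrite mulrA.
Qed.

Lemma chain_law_first P a t b :
  chain_law P a t.+1 b = \sum_c P a c * chain_law P c t b.
Proof.
rewrite -add1n chain_law_add; apply: eq_bigr => c _; congr (_ * _).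
exact: push_dirac.
Qed.

Lemma chain_law_prob P a t : stochastic P -> is_prob (chain_law P a t).
Proof.
move=> [P0 P1]; elim: t => [|t [IH0 IH1]].
  split=> [b|]; first by rewrite /chain_law/= ler0n.
  rewrite (bigD1 a)//= /chain_law /= /dirac_mass eqxx big1 ?addr0// => b.
  by rewrite eq_sym => /negbTE->.
split=> [b|]; first by rewrite chain_lawS; apply: sumr_ge0 => c _; exact: mulr_ge0.
under eq_bigr do rewrite chain_lawS.
rewrite exchange_big/= -[RHS]IH1; apply: eq_bigr => c _.
by rewrite -mulr_sumr P1 mulr1.
Qed.

Lemma tv_le1 p q : is_prob p -> is_prob q -> tv_dist p q <= 1.
Proof.
move=> [p0 p1] [q0 q1]; rewrite /tv_dist mulrC ler_pdivrMr// mul1r.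
apply: (@le_trans _ _ (\sum_x (p x + q x))).
  by apply: ler_sum => x _; apply: (le_trans (ler_normB _ _)); rewrite !ger0_norm.
by rewrite big_split/= p1 q1.
Qed.

(** The transport inequality for the sign of [p - q]. *)
Lemma pinsker p q : is_prob p -> (forall x, 0 < q x) -> \sum_x q x = 1 ->
  2 * tv_dist p q ^+ 2 <= kl_div p q.
Proof.
move=> pp q0 q1; pose g x := Num.sg (p x - q x).
have := bounded_transport (r := g) (r0 := 1) q0 q1 pp.
have -> : \sum_x p x * g x - \sum_x q x * g x = 2 * tv_dist p q.
  rewrite -sumrB /tv_dist mulrA divff ?mul1r ?pnatr_eq0//; apply: eq_bigr => x _.
  by rewrite -mulrBl mulrC -normrEsg.
rewrite expr1n mulr1 => h; have := h (fun x => _); rewrite exprMn => {}h.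
suff : 2 ^+ 2 * tv_dist p q ^+ 2 <= 2 * kl_div p q by lra.
by apply: h => x; rewrite /g normr_sg; case: (_ != 0).
Qed.

Lemma tv_mix (J : finType) (m : J -> R) (p : J -> A -> R) q : is_prob m ->
  tv_dist (fun x => \sum_j m j * p j x) q <= \sum_j m j * tv_dist (p j) q.
Proof.
move=> [m0 m1]; rewrite /tv_dist.
under [leRHS]eq_bigr do rewrite mulrCA mulr_sumr.
rewrite -mulr_sumr exchange_big/= ler_wpM2l ?invr_ge0//.
apply: ler_sum => x _.
have -> : \sum_j m j * p j x - q x = \sum_j m j * (p j x - q x).
  by under [RHS]eq_bigr do rewrite mulrBr; rewrite sumrB -mulr_suml m1 mul1r.
apply: (le_trans (ler_norm_sum _ _ _)); apply: ler_sum => j _.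
by rewrite normrM ger0_norm.
Qed.

(** The data processing inequality. *)
Lemma data_processing (B : finType) (K : B -> A -> R) (p q : B -> R) :
  (forall b a, 0 <= K b a) -> (forall b, 0 <= p b) -> (forall b, 0 <= q b) ->
  (forall b, q b = 0 -> p b = 0) ->
  (forall b, p b != 0 -> \sum_a K b a = 1) ->
  kl_div (push p K) (push q K) <= kl_div p q.
Proof.
move=> K0 p0 q0 pq K1; rewrite /kl_div.
apply: (@le_trans _ _ (\sum_a \sum_b p b * K b a * ln (p b / q b))).
  apply: ler_sum => a _; rewrite /push.
  apply: (le_trans (@log_sum R B (fun b => p b * K b a) (fun b => q b * K b a) _ _ _)).
  - by move=> b; exact: mulr_ge0.
  - by move=> b; exact: mulr_ge0.
  - by move=> b /eqP; rewrite mulf_eq0 => /orP[/eqP/pq->|/eqP->]; rewrite ?mul0r ?mulr0.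
  apply: ler_sum => b _; have [->|kn] := eqVneq (K b a) 0; first by rewrite !mulr0 !mul0r.
  by rewrite -mulf_div divff// mulr1.
rewrite exchange_big/=; apply: ler_sum => b _; rewrite -mulr_suml -mulr_sumr.
by have [->|pn] := eqVneq (p b) 0; rewrite ?mul0r// K1// mulr1.
Qed.

End Chains.

(** * The polarized walk *)

Section Walk.
Variables (R : realType) (n : nat) (w : spins n -> R).
Hypothesis n_gt0 : (0 < n)%N.
Hypothesis w_gt0 : forall x, 0 < w x.
Implicit Types (x y z : spins n) (T S A N : {set 'I_n}) (G : spins n -> R).

Let Z := \sum_x w x.
Let nu x := w x / Z.
Let Z0 : 0 < Z. Proof. exact: spins_pos. Qed.
Let nu0 x : 0 < nu x. Proof. by rewrite divr_gt0. Qed.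
Let nu1 : \sum_x nu x = 1. Proof. by rewrite -mulr_suml divff ?gt_eqF. Qed.
Let nR : 0 < n%:R :> R. Proof. by rewrite ltr0n. Qed.
Let nRn : n%:R != 0 :> R. Proof. exact: lt0r_neq0. Qed.
Let P := pol_walk nu.

(** The total weight of the configurations that the up-operator can reach from
    [T], the configuration [T] itself counting once per absent coordinate. *)
Definition up_weight G T : R :=
  \sum_(i | i \notin T) (w (sp T) * G (sp T) + w (sp (i |: T)) * G (sp (i |: T))).

Definition up_total T : R := \sum_(i | i \notin T) (w (sp T) + w (sp (i |: T))).

Lemma up_total_gt0 T i : i \notin T -> 0 < up_total T.
Proof.
move=> iT; rewrite /up_total (bigD1 i)//= ltr_pwDl// ?addr_gt0//.
by apply: sumr_ge0 => j _; rewrite addr_ge0// ltW.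
Qed.

Lemma push_nuE T : push nu (Dpol R (n := n)) T = up_total T / (n%:R * Z).
Proof.
rewrite /push Dpol_adj -/(up_total T).
have -> : \sum_(i | i \notin T) (nu (sp T) + nu (sp (i |: T))) = up_total T / Z.
  by rewrite mulr_suml; apply: eq_bigr => i _; rewrite mulrDl.
by rewrite invfM mulrCA.
Qed.

Lemma Upol_sum G T : \sum_y Upol nu T y * G y = up_weight G T / up_total T.
Proof.
rewrite /Upol /bayes push_nuE.
transitivity ((\sum_y (w y * G y) * Dpol R y T) * (n%:R / up_total T)).
  rewrite mulr_suml; apply: eq_bigr => y _; rewrite invfM invrK /nu.
  have -> : w y / Z * Dpol R y T * ((up_total T)^-1 * (n%:R * Z)) * G y =
     (w y * G y * Dpol R y T * (n%:R / up_total T)) * (Z / Z) by ring.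
  by rewrite divff ?mulr1 ?gt_eqF.
by rewrite Dpol_adj mulrACA mulVf// mul1r.
Qed.

Lemma walk_sum G x :
  \sum_y P x y * G y = n%:R^-1 * \sum_i (up_weight G (plus x :\ i) / up_total (plus x :\ i)).
Proof.
rewrite -(Dpol_sum x (fun T => up_weight G T / up_total T)).
under [RHS]eq_bigr do rewrite -Upol_sum mulr_sumr.
rewrite exchange_big/=; apply: eq_bigr => y _; rewrite /P /pol_walk /kcomp mulr_suml.
by apply: eq_bigr => T _; rewrite mulrA.
Qed.

Lemma Upol_ge0 T y : 0 <= Upol nu T y.
Proof.
rewrite /Upol /bayes divr_ge0//; first by rewrite mulr_ge0 ?Dpol_ge0// ltW.
by apply: sumr_ge0 => x _; rewrite mulr_ge0 ?Dpol_ge0// ltW.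
Qed.

Lemma Upol_total T i : i \notin T -> \sum_y Upol nu T y = 1.
Proof.
move=> iT; transitivity (\sum_y Upol nu T y * 1); first by apply: eq_bigr => y _; rewrite mulr1.
rewrite (Upol_sum (fun=> 1)) /up_weight; under eq_bigr do rewrite !mulr1.
by rewrite divff// gt_eqF// (up_total_gt0 iT).
Qed.

Lemma setD1_in (T : {set 'I_n}) i : i \notin T :\ i.
Proof. by rewrite !inE eqxx. Qed.

Lemma walk_stochastic : stochastic P.
Proof.
split=> [x y|x].
  by apply: sumr_ge0 => T _; rewrite mulr_ge0 ?Dpol_ge0 ?Upol_ge0.
transitivity (\sum_y P x y * 1); first by apply: eq_bigr => y _; rewrite mulr1.
rewrite walk_sum; under eq_bigr => i _.
  rewrite /up_weight; under eq_bigr do rewrite !mulr1.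
  rewrite divff ?gt_eqF ?(up_total_gt0 (setD1_in _ _))//; over.
by rewrite sumr_const card_ord mulVf.
Qed.

Lemma walk_kl rho mu : contracts rho w -> is_prob mu ->
  kl_div (push mu P) nu <= (1 - rho / n%:R) * kl_div mu nu.
Proof.
move=> cw pm; apply: (le_trans _ (contracts_kl n_gt0 w_gt0 cw pm)).
have -> : push mu P = push (push mu (Dpol R (n := n))) (Upol nu).
  apply/funext => y; rewrite /push /P /pol_walk /kcomp.
  under [RHS]eq_bigr do rewrite mulr_suml.
  rewrite [RHS]exchange_big/=; apply: eq_bigr => x _; rewrite mulr_sumr.
  by apply: eq_bigr => T _; rewrite mulrA.
have sp0 (f : spins n -> R) T : (forall x, 0 <= f x) -> 0 <= push f (Dpol R (n := n)) T.
  by move=> f0; apply: sumr_ge0 => x _; rewrite mulr_ge0 ?Dpol_ge0.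
have full T : push nu (Dpol R (n := n)) T = 0 -> forall x, Dpol R x T = 0.
  move=> h x; have hx z : 0 <= nu z * Dpol R z T by rewrite mulr_ge0 ?Dpol_ge0// ltW.
  by have /eqP := sum_eq0_ge0 hx h x; rewrite mulf_eq0 gt_eqF//= => /eqP.
have inv : nu = push (push nu (Dpol R (n := n))) (Upol nu).
  apply/funext => y; rewrite /push -[LHS]mulr1 -(Dpol_total R n_gt0 y) mulr_sumr.
  apply: eq_bigr => T _; rewrite /Upol /bayes -/(push nu (Dpol R (n := n)) T).
  have [z|z] := eqVneq (push nu (Dpol R (n := n)) T) 0; last by rewrite [RHS]mulrC divfK.
  by rewrite (full _ z y) mulr0 z !mul0r.
rewrite [X in kl_div _ X <= _]inv; case: pm => m0 m1; apply: data_processing.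
- by move=> T y; exact: Upol_ge0.
- by move=> T; exact: sp0.
- by move=> T; apply: sp0 => x; exact: ltW.
- by move=> T /full h; rewrite /push big1// => x _; rewrite h mulr0.
move=> T; have [->|Tn] := eqVneq T [set: 'I_n].
  by rewrite /push Dpol_adj big_pred0 ?mulr0 ?eqxx// => i; rewrite inE.
move=> _; have [i iT] : exists i, i \notin T.
  apply/existsP; rewrite -negb_forall; apply: contra Tn => /forallP h.
  by apply/eqP/setP => i; rewrite inE h.
exact: Upol_total iT.
Qed.

Lemma chain_kl rho x t : 0 <= 1 - rho / n%:R -> contracts rho w ->
  kl_div (chain_law P x t) nu <= (1 - rho / n%:R) ^+ t * - ln (nu x).
Proof.
move=> r0 cw; elim: t => [|t IH].
  rewrite expr0 mul1r /kl_div (bigD1 x)//= /chain_law /= /dirac_mass eqxx mul1r div1r.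
  rewrite big1 ?addr0 ?lnV ?posrE// => y; rewrite eq_sym => /negbTE->.
  by rewrite mul0r.
apply: (le_trans (walk_kl cw (chain_law_prob x t walk_stochastic))).
by rewrite exprS -mulrA ler_wpM2l.
Qed.

(** ** Warm starts *)

(** The stationary law can be tiny at the starting point, so the entropy must be
   brought down to a polynomial first. Read a configuration as a multiset of
   [n] letters; each step replaces a uniformly random letter. Except with
   small probability every replacement is nearly the best possible one, and
   then, as long as [N] and [c] blanks are the letters renewed so far, some
   nearly optimal [A] contains all renewed letters: this is preserved because
   the base weight satisfies an exchange property. When all letters are
   renewed, the configuration is [A] itself. *)

Variables (om : nat -> R) (lam : 'I_n -> R) (C q : R).
Hypothesis om_gt0 : forall k, 0 < om k.
Hypothesis om_exch : forall a b, (a < b)%N -> om a * om b <= om a.+1 * om b.-1.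
Hypothesis lam_gt0 : forall i, 0 < lam i.
Definition base_weight T : R := om #|T| * \prod_(i in T) lam i.
Let bw := base_weight.
Hypothesis C0 : 0 < C.
Hypothesis q0 : 0 < q.
Hypothesis bw_le : forall x, bw (plus x) <= w x.
Hypothesis w_le : forall x, w x <= C * bw (plus x).

Let pr0 T : 0 < \prod_(j in T) lam j. Proof. exact: prodr_gt0. Qed.
Let bw0 T : 0 < bw T. Proof. exact: mulr_gt0. Qed.

Lemma bw_add T i : i \notin T -> bw (i |: T) = om #|T|.+1 * (lam i * \prod_(j in T) lam j).
Proof. by move=> iT; rewrite /bw /base_weight cardsU1 iT add1n big_setU1. Qed.

Lemma bw_del T i : i \in T -> bw T = om #|T :\ i|.+1 * (lam i * \prod_(j in T :\ i) lam j).
Proof. by move=> iT; rewrite -bw_add ?setD1_in// finset.setD1K. Qed.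

(** The configurations that the up-operator can reach from [T]. *)
Definition up_target T S := S = T \/ exists2 i, i \notin T & S = i |: T.

(** A blank is inserted in place of the redrawn letter. If [A] is full, the
    symmetric exchange moves some [i] from [A] to the current set; log-concavity
    pays for the change of sizes, and the products over letters do not change. *)
Lemma exchange_blank T A N c : N \subset T -> (c + #|T| < n)%N ->
  N \subset A -> (c + #|A| <= n)%N ->
  exists A' S, [/\ N \subset A', (c.+1 + #|A'| <= n)%N, up_target T S &
    bw A * bw T <= bw A' * bw S].
Proof.
move=> NT cT NA cA; have [h|h] := leqP (c.+1 + #|A|) n.
  by exists A, T; split=> //; left.
have TA : (#|T| < #|A|)%N by rewrite -(ltn_add2l c); exact: leq_trans cT h.
have [i iA iT] : exists2 i, i \in A & i \notin T.
  by apply/subsetPn; apply/negP => /subset_leq_card; rewrite leqNgt TA.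
have cD : (#|A :\ i|.+1 = #|A|)%N by rewrite [RHS](cardsD1 i) iA.
exists (A :\ i), (i |: T); split.
- apply/fintype.subsetP => j jN; rewrite !inE (fintype.subsetP NA)// andbT.
  by apply: contraNneq iT => <-; exact: (fintype.subsetP NT).
- by rewrite addSnnS cD.
- by right; exists i.
rewrite bw_add// (bw_del iA) cD.
have := om_exch TA; rewrite -cD /= => /(ler_wpM2r (ltW (mulr_gt0 (pr0 (T)) (mulr_gt0 (lam_gt0 i) (pr0 (A :\ i)))))).
rewrite /bw /base_weight; set a := om _; set b := om _; set p1 := \prod_(j in T) _.
set p2 := \prod_(j in A :\ i) _; set o3 := om _; set o4 := om _; lra.
Qed.

Lemma exchange_letter T A N c j : j \notin T -> N \subset T -> (c + #|T| < n)%N ->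
  N \subset A -> (c + #|A| <= n)%N ->
  exists A' S, [/\ j |: N \subset A', (c + #|A'| <= n)%N, up_target T S &
    bw A * bw (j |: T) <= bw A' * bw S].
Proof.
move=> jT NT cT NA cA; have [jA|jA] := boolP (j \in A).
  exists A, (j |: T); split=> //; last by right; exists j.
  by rewrite finset.subUset finset.sub1set jA.
have [AT|/subsetPn[i iA iT]] := boolP (A \subset T).
  have cAT := subset_leq_card AT.
  exists (j |: A), T; split.
  - by rewrite finset.setUS.
  - by rewrite cardsU1 jA add1n addnS; apply: leq_ltn_trans cT; rewrite leq_add2l.
  - by left.
  rewrite !bw_add//.
  have h : (#|A| < #|T|.+1)%N by [].
  have := om_exch h; rewrite /= => /(ler_wpM2r (ltW (mulr_gt0 (pr0 (A)) (mulr_gt0 (lam_gt0 j) (pr0 (T)))))).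
  rewrite /bw /base_weight; set a := om _; set b := om _; set p1 := \prod_(j in A) _.
  set p2 := \prod_(j in T) _; set o3 := om _; set o4 := om _; lra.
have cD : (#|A :\ i|.+1 = #|A|)%N by rewrite [RHS](cardsD1 i) iA.
have jD : j \notin A :\ i by rewrite inE negb_and jA orbT.
exists (j |: (A :\ i)), (i |: T); split.
- apply: finset.setUS; apply/fintype.subsetP => k kN; rewrite !inE (fintype.subsetP NA)// andbT.
  by apply: contraNneq iT => <-; exact: (fintype.subsetP NT).
- by rewrite cardsU1 jD add1n cD.
- by right; exists i.
rewrite (bw_del iA) !bw_add//; lra.
Qed.

Definition good_up T S := forall S', up_target T S' -> q * w (sp S') <= w (sp S).

Let ratio := q / C.

Lemma good_transfer T A A' S S' : good_up T S -> up_target T S' ->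
  bw A * bw S <= bw A' * bw S' -> ratio * bw A <= bw A'.
Proof.
move=> g tS h; have h1 := g S' tS.
have h2 : q * bw S' <= C * bw S.
  have b1 := bw_le (sp S'); have b2 := w_le (sp S); rewrite !spK in b1 b2.
  exact: le_trans (ler_wpM2l (ltW q0) b1) (le_trans h1 b2).
rewrite -(ler_pM2r (bw0 S')); apply: le_trans h.
have h3 : ratio * bw S' <= bw S.
  by rewrite /ratio mulrAC ler_pdivrMr// [leRHS]mulrC.
rewrite mulrAC mulrC; apply: ler_wpM2l => //; exact: ltW.
Qed.

Definition eta : R := 2 * n%:R * q.

Let bad th t x : R := \sum_(y | bw (plus y) < th) chain_law P x t y.

Lemma bad_le1 th t x : bad th t x <= 1.
Proof.
have [c0 c1] := chain_law_prob x t walk_stochastic.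
by rewrite /bad -c1 [leRHS](bigID (fun y => bw (plus y) < th))/= lerDl sumr_ge0.
Qed.

Lemma bad_step th t x : bad th t.+1 x = \sum_y P x y * bad th t y.
Proof.
rewrite /bad; under eq_bigr do rewrite chain_law_first.
by rewrite exchange_big/=; apply: eq_bigr => y _; rewrite mulr_sumr.
Qed.

(** Replacements worse than [q] times the best one have total mass at most
    [eta]. *)
Lemma up_split G T M i0 : i0 \notin T -> (forall y, G y <= 1) -> 0 <= M ->
  (forall S, up_target T S -> good_up T S -> G (sp S) <= M) ->
  up_weight G T / up_total T <= M + eta.
Proof.
move=> i0T G1 M0 gM; have W0 := up_total_gt0 i0T.
rewrite ler_pdivrMr//.
have tgW S : up_target T S -> w (sp S) <= up_total T.
  have h i : i \notin T -> w (sp T) + w (sp (i |: T)) <= up_total T.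
    move=> iT; rewrite /up_total (bigD1 i)//= lerDl sumr_ge0// => j _.
    by rewrite addr_ge0// ltW.
  have wW y := ltW (w_gt0 y).
  by move=> [->|[i iT ->]]; [apply: le_trans (h _ i0T)|apply: le_trans (h _ iT)]; rewrite ?lerDl ?lerDr.
have one S : up_target T S -> w (sp S) * G (sp S) <= M * w (sp S) + q * up_total T.
  move=> tS; have [g|/asboolP ng] := pselect (good_up T S).
    rewrite mulrC; apply: (@le_trans _ _ (M * w (sp S))).
      by rewrite ler_wpM2r ?gM// ltW.
    by rewrite lerDl mulr_ge0// ltW.
  have [S' tS' lt] : exists2 S', up_target T S' & w (sp S) < q * w (sp S').
    apply: contrapT => h; move: ng => /asboolP; apply => S' tS'.
    by rewrite leNgt; apply/negP => lt; apply: h; exists S'.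
  apply: (@le_trans _ _ (w (sp S))); first by rewrite ler_piMr// ltW.
  apply: (le_trans (ltW lt)); apply: (@le_trans _ _ (q * up_total T)).
    by rewrite ler_wpM2l ?tgW// ltW.
  by rewrite lerDr mulr_ge0// ltW.
rewrite /up_weight.
apply: (@le_trans _ _ (\sum_(i | i \notin T) (M * (w (sp T) + w (sp (i |: T))) + 2 * (q * up_total T)))).
  apply: ler_sum => i iT; have := one T (or_introl erefl).
  have := one (i |: T) (or_intror (ex_intro2 _ _ i iT erefl)); lra.
rewrite big_split/= -mulr_sumr -/(up_total T) [leRHS]mulrDl lerD2l sumr_const.
rewrite -[leLHS]mulr_natl /eta.
have : #|[pred i | i \notin T]|%:R <= n%:R :> R.
  by rewrite ler_nat -[leqRHS](card_ord n) max_card.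
set k := _%:R => kn; have qW : 0 <= q * up_total T by rewrite mulr_ge0// ltW.
by have := ler_wpM2r qW kn; lra.
Qed.

Let decay : R := 1 - n%:R^-1.

Lemma old_token_count k a c m : (a <= k)%N -> (c + k <= m)%N ->
  (m - (a + c) <= k - a + (c + k < m)%N * (m - k))%N.
Proof. by move=> ak ck; case: ltnP => h /=; lia. Qed.

(** Induction on the number of steps: a step redraws an old letter with
    probability at least (number of old letters) / [n], whence the decay. *)
Lemma renewal t x N c A th :
  N \subset plus x -> (c + #|plus x| <= n)%N -> N \subset A -> (c + #|A| <= n)%N ->
  th <= bw A ->
  bad (ratio ^+ t * th) t x <= (n - (#|N| + c))%:R * decay ^+ t + t%:R * eta.
Proof.
have r0 : 0 < ratio by rewrite divr_gt0.
have dec0 : 0 <= decay by rewrite subr_ge0 invf_le1// ler1n.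
have et0 : 0 <= eta by apply: mulr_ge0; [exact: mulr_ge0|exact: ltW].
elim: t x N c A th => [|t IH] x N c A th NS cS NA cA thA.
  rewrite !expr0 !mul1r mulr1 mul0r addr0.
  have [o0|o0] := posnP (n - (#|N| + c)); last first.
    by apply: (le_trans (bad_le1 _ _ _)); rewrite ler1n.
  rewrite o0; have cN := subset_leq_card NS; have cN' := subset_leq_card NA.
  have o1 : (n <= #|N| + c)%N by rewrite -subn_eq0 o0.
  have eS : N = plus x.
    by apply/eqP; rewrite eqEcard NS -(leq_add2r c) (leq_trans _ o1)// addnC.
  have eA : N = A.
    by apply/eqP; rewrite eqEcard NA -(leq_add2r c) (leq_trans _ o1)// addnC.
  rewrite /bad big1// => y lt; rewrite /chain_law /= /dirac_mass.
  by case: eqP => // e; move: lt; rewrite -e -eS eA ltNge thA.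
set th' := ratio ^+ t.+1 * th.
set o : R := (n - (#|N| + c))%:R.
(* [dc i] is 1 if redrawing coordinate [i] renews an old letter: either [i] is an
   old plus, or [i] is minus and can be taken for one of the old blanks. *)
pose dc (i : 'I_n) : nat := (((i \in plus x) && (i \notin N)) + ((i \notin plus x) && (c + #|plus x| < n)))%N.
have step i : up_weight (bad th' t) (plus x :\ i) / up_total (plus x :\ i) <=
    (o - (dc i)%:R) * decay ^+ t + t%:R * eta + eta.
  pose T := plus x :\ i.
  have [Ni [ci [NT cT NiA ciA cnt]]] : exists (Ni : {set 'I_n}) (ci : nat), [/\ Ni \subset T, (ci + #|T| < n)%N,
      Ni \subset A, (ci + #|A| <= n)%N & (#|Ni| + ci + 1 = #|N| + c + dc i)%N].
    have cN := subset_leq_card NS.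
    have [iS|iS] := boolP (i \in plus x).
      have cD : (#|T|.+1 = #|plus x|)%N by rewrite [RHS](cardsD1 i) iS.
      have [iN|iN] := boolP (i \in N).
        exists (N :\ i), c; split=> //.
        - exact: finset.setSD.
        - by rewrite -addnS cD.
        - by apply: fintype.subset_trans NA; exact: finset.subD1set.
        - by rewrite /dc iS iN (cardsD1 i N) iN /= !addn0 !(addnC _ 1%N).
      exists N, c; split=> //; last by rewrite /dc iS iN /= addn0.
        by rewrite subsetD1 NS iN.
      by rewrite -addnS cD.
    have TE : T = plus x by rewrite /T setD1_notin.
    have [lt|ge] := boolP (c + #|plus x| < n)%N.
      exists N, c; rewrite TE; split=> //.
      by rewrite /dc (negbTE iS) lt /= add0n.
    have ltx : (#|plus x| < n)%N.
      rewrite -[leqRHS]card_ord -cardsT; apply: proper_card.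
      by rewrite properE finset.subsetT/=; apply/subsetPn; exists i; first by rewrite inE.
    have c_gt0 : (0 < c)%N.
      rewrite lt0n; apply: contraTneq ltx => c00; rewrite -leqNgt.
      by move: ge; rewrite c00 add0n -leqNgt.
    exists N, c.-1; rewrite TE; split=> //.
    - by rewrite -addSn prednK//.
    - by apply: leq_trans cA; rewrite leq_add2r leq_pred.
    - by rewrite /dc (negbTE iS) (negbTE ge) /= !addn0 -addnA addn1 prednK.
  have hle : (#|N| + c + dc i <= n)%N.
    rewrite -cnt addn1; apply: leq_ltn_trans cT.
    by rewrite addnC leq_add2l subset_leq_card.
  have oE (N' : {set 'I_n}) c' : (#|N'| + c' = #|Ni| + ci + 1)%N ->
      (#|N'| + c' <= n)%N -> (n - (#|N'| + c'))%:R = o - (dc i)%:R :> R.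
    move=> e _; rewrite e cnt subnDA natrB// leq_subRL//.
    by apply: leq_trans hle; rewrite leq_addr.
  have M0 : 0 <= (o - (dc i)%:R) * decay ^+ t + t%:R * eta.
    apply: addr_ge0; apply: mulr_ge0; rewrite ?ler0n ?exprn_ge0//.
    rewrite subr_ge0 /o ler_nat leq_subRL//.
    by apply: leq_trans hle; rewrite leq_addr.
  apply: (@up_split (bad th' t) (plus x :\ i) ((o - (dc i)%:R) * decay ^+ t + t%:R * eta) i) => //; first exact: setD1_in.
    by move=> y; exact: bad_le1.
  move=> S tS gS; have [A' [N' [c' [NA' cA' N'S c'S [tA cn]]]]] : exists (A' N' : {set 'I_n}) (c' : nat),
      [/\ N' \subset A', (c' + #|A'| <= n)%N, N' \subset S, (c' + #|S| <= n)%N &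
         ratio * bw A <= bw A' /\ (#|N'| + c' = #|Ni| + ci + 1)%N].
    case: (tS) => [SE|[j jT SE]].
      have [A' [S' [h1 h2 h3 h4]]] := exchange_blank NT cT NiA ciA.
      exists A', Ni, ci.+1; rewrite SE; split=> //; split; last by rewrite addnS addn1.
      by apply: (good_transfer gS h3); rewrite SE.
    have [A' [S' [h1 h2 h3 h4]]] := exchange_letter jT NT cT NiA ciA.
    exists A', (j |: Ni), ci; rewrite SE; split=> //.
    - exact: finset.setUS.
    - by rewrite cardsU1 jT add1n addnS.
    split; first by apply: (good_transfer gS h3); rewrite SE.
    rewrite cardsU1; have -> : j \notin Ni by apply: contra jT; exact: (fintype.subsetP NT).
    by rewrite add1n addSn addn1.
  have th'E : th' = ratio ^+ t * (ratio * th) by rewrite /th' exprSr mulrA.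
  rewrite th'E -(oE N' c')//; last first.
    by apply: leq_trans c'S; rewrite addnC leq_add2l subset_leq_card.
  apply: (IH (sp S) N' c' A') => //; rewrite ?spK//.
  by apply: le_trans tA; rewrite ler_pM2l.
rewrite bad_step walk_sum.
apply: (@le_trans _ _ (n%:R^-1 * \sum_i ((o - (dc i)%:R) * decay ^+ t + t%:R * eta + eta))).
  by rewrite ler_wpM2l ?invr_ge0// ler_sum.
have dsum : o <= \sum_i (dc i)%:R.
  rewrite -natr_sum /o ler_nat /dc big_split/=.
  have -> : (\sum_i ((i \in plus x) && (i \notin N)) = #|plus x| - #|N|)%N.
    rewrite -(cardsDS NS) -sum1_card [RHS]big_mkcond/=; apply: eq_bigr => i _.
    by rewrite !inE andbC; case: ifP.
  have -> : (\sum_i ((i \notin plus x) && (c + #|plus x| < n)%N) = (c + #|plus x| < n)%N * (n - #|plus x|))%N.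
    have -> : (n - #|plus x| = \sum_(i < n) (i \notin plus x))%N.
      have -> : (n - #|plus x| = #|~: plus x|)%N.
        apply/eqP; rewrite -(eqn_add2l #|plus x|) cardsC card_ord subnKC//.
        by rewrite -[leqRHS](card_ord n) max_card.
      rewrite -sum1_card [LHS]big_mkcond/=; apply: eq_bigr => i _.
      by rewrite inE; case: ifP.
    rewrite big_distrr/=; apply: eq_bigr => i _.
    by case: (i \notin _); case: (_ < _)%N.
  by apply: old_token_count => //; exact: subset_leq_card.
rewrite !big_split/= -mulr_suml sumrB !sumr_const card_ord.
set s := \sum_i _ in dsum *.
have -> : n%:R^-1 * ((o *+ n - s) * decay ^+ t + t%:R * eta *+ n + eta *+ n) =
   (o - s / n%:R) * decay ^+ t + t.+1%:R * eta.
  rewrite -natr1 -[o *+ n]mulr_natr -[t%:R * eta *+ n]mulr_natr -[eta *+ n]mulr_natr.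
  by field.
rewrite lerD2r exprS mulrA ler_wpM2r ?exprn_ge0// /decay mulrBr mulr1 lerD2l lerN2.
by rewrite ler_wpM2r// invr_ge0 ltW.
Qed.

End Walk.

(** * Mixing time *)

Lemma Dpol_one (R : realType) (x : spins 1) T : Dpol R x T = (T == finset.set0)%:R.
Proof.
rewrite DpolE invr1 mul1r big_ord1; congr ((_ == _)%:R).
by apply/setP => i; rewrite !inE (ord1 i) eqxx.
Qed.

(** On one spin the up-step ignores the current state, so the walk is stationary
    after one step. *)
Lemma walk_one (R : realType) (nu : spins 1 -> R) x y :
  \sum_z nu z = 1 -> pol_walk nu x y = nu y.
Proof.
move=> nu1; rewrite /pol_walk /kcomp (bigD1 finset.set0)//= big1 ?addr0 => [|T /negbTE T0].
  rewrite Dpol_one eqxx mul1r /Upol /bayes /push Dpol_one eqxx mulr1.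
  have -> : \sum_a nu a * Dpol R a finset.set0 = 1.
    by rewrite -nu1; apply: eq_bigr => z _; rewrite Dpol_one eqxx mulr1.
  by rewrite divr1.
by rewrite Dpol_one T0 mul0r.
Qed.

Lemma half_le_ln (R : realType) (y : R) : 2 <= y -> 2^-1 <= ln y.
Proof.
move=> y2; have yp : 0 < y by lra.
rewrite -ler_expR lnK ?posrE//; apply: le_trans y2.
have := expR_ge1Dx (- 2^-1 : R); rewrite expRN => hh.
rewrite -[leLHS]invrK -[leRHS]invrK lef_pV2 ?posrE ?invr_gt0 ?expR_gt0//.
by apply: le_trans hh; lra.
Qed.

Section MixingTime.
Variables (R : realType) (n : nat) (J : 'M[R]_n) (h : 'cV[R]_n) (gamma : R).
Hypothesis n_gt0 : (0 < n)%N.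
Hypothesis Jpsd : psd J.
Hypothesis gamma0 : 0 <= gamma.
Hypothesis Jnorm : opnorm J < 2^-1.
Implicit Types (x y z : spins n).

Let w := ising_weight J h gamma.
Let nu := ising J h gamma.
Let rho := 1 - 2 * opnorm J.
Let P := pol_walk nu.

Lemma ising_gt0 x : 0 < nu x.
Proof. by rewrite divr_gt0 ?weight_gt0//; apply: spins_pos => z; exact: weight_gt0. Qed.

Lemma ising_total : \sum_x nu x = 1.
Proof.
rewrite -mulr_suml divff// lt0r_neq0//.
by apply: spins_pos => z; exact: weight_gt0.
Qed.

Lemma nrm2_sg x : nrm2 (sg R x) = n%:R.
Proof.
rewrite /nrm2 -[in RHS](card_ord n) -sum1_card natr_sum; apply: eq_bigr => i _.
by rewrite /sg; case: (x i); rewrite ?sqrrN expr1n.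
Qed.

Let g i := h i 0.
Let bw := base_weight (size_weight gamma g) (fun i => expR (2 * g i)).
Let C : R := expR (n%:R / 4).

Let bw_le x : bw (plus x) <= w x.
Proof.
rewrite /w weight_split /bw /base_weight -repulsionE//.
have q0 := psd_qf_ge0 Jpsd (sg R x).
rewrite ler_peMr//; first by rewrite mulr_ge0 ?expR_ge0.
by rewrite -[leLHS]expR0 ler_expR; lra.
Qed.

(* On spin vectors the interaction is between 0 and [opnorm J * n]. *)
Let w_le x : w x <= C * bw (plus x).
Proof.
rewrite /w weight_split /bw /base_weight -repulsionE// mulrC.
apply: ler_wpM2r; first by rewrite mulr_ge0 ?expR_ge0.
have := opnorm_quad J (sg R x); rewrite nrm2_sg ler_expR => hq.
have hn : 0 <= n%:R :> R by exact: ler0n.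
have hJ := ltW Jnorm; have := ler_wpM2r hn hJ; lra.
Qed.

(** The initial entropy [y ^ 13] is multiplied by [(1 - rho / n) ^ t], which is at
    most [y ^ - 16]. *)
Lemma warm_mixing x t (y : R) : (1 < n)%N -> 2 <= y -> 
  - ln (nu x) <= y ^+ 13 -> 16 * (n%:R * ln y) <= rho * t%:R ->
  2 * tv_dist (chain_law P x t) nu ^+ 2 <= y^-1 ^+ 3.
Proof.
move=> n1 y2 hx ht.
have nR : 0 < n%:R :> R by rewrite ltr0n.
have n2 : 2 <= n%:R :> R by rewrite ler_nat.
have [o0 hJ] := (opnorm_ge0 J, Jnorm).
have y0 : 0 < y by lra.
have r0 : 0 < rho by rewrite /rho; lra.
have r1 : rho <= 1 by rewrite /rho; lra.
have d0 : 0 <= 1 - rho / n%:R by rewrite subr_ge0 ler_pdivrMr//; lra.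
have wp z : 0 < w z by exact: weight_gt0.
have st := walk_stochastic n_gt0 wp.
apply: (le_trans (pinsker (chain_law_prob x t st) ising_gt0 ising_total)).
apply: (le_trans (chain_kl n_gt0 wp x t d0 (ising_contracts n_gt0 h Jpsd gamma0 Jnorm))).
have e1 : (1 - rho / n%:R) ^+ t <= y^-1 ^+ 16.
  apply: (@le_trans _ _ (expR (- (rho / n%:R)) ^+ t)).
    by rewrite lerXn2r ?nnegrE ?expR_ge0// expR_ge1Dx.
  rewrite -expRM_natl.
  have -> : y^-1 ^+ 16 = expR (16%:R * - ln y).
    by rewrite expRM_natl expRN lnK ?posrE.
  rewrite ler_expR !mulrN lerN2.
  have -> : t%:R * (rho / n%:R) = rho * t%:R / n%:R by ring.
  by rewrite ler_pdivlMr//; lra.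
have l0 : 0 <= - ln (nu x).
  rewrite oppr_ge0 ln_le0// -ising_total (bigD1 x)//= lerDl sumr_ge0// => z _.
  exact/ltW/ising_gt0.
apply: (le_trans (ler_wpM2r l0 e1)).
have yi : 0 <= y^-1 ^+ 16 by rewrite exprn_ge0// invr_ge0 ltW.
apply: (le_trans (ler_wpM2l yi hx)).
have -> : y^-1 ^+ 16 * y ^+ 13 = y^-1 ^+ 3 by field; exact: lt0r_neq0.
exact: lexx.
Qed.

Lemma ln_poly_le (y : R) : 2 <= y -> 128 * y ^+ 5 + 4 * y ^+ 3 + 2 * y <= y ^+ 13.
Proof.
move=> y2; have y1 : 1 <= y by lra.
have p2 : 4 <= y ^+ 2 by nra.
have p4 : 16 <= y ^+ 4 by (have -> : y ^+ 4 = y ^+ 2 * y ^+ 2 by ring); nra.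
have p8 : 256 <= y ^+ 8 by (have -> : y ^+ 8 = y ^+ 4 * y ^+ 4 by ring); nra.
have y5 : 0 <= y ^+ 5 by rewrite exprn_ge0//; lra.
have y3 : 0 <= y ^+ 3 by rewrite exprn_ge0//; lra.
have h1 : y ^+ 3 <= y ^+ 5 by (have -> : y ^+ 5 = y ^+ 3 * y ^+ 2 by ring); nra.
have h2 : y <= y ^+ 5.
  by (have -> : y ^+ 5 = y * y ^+ 4 by ring); nra.
have -> : y ^+ 13 = y ^+ 5 * y ^+ 8 by ring.
nra.
Qed.

(** Run for [3 n ln y] steps, where [y = n / eps], to renew all letters; the
    law is then warm except with probability [eps / 2]. *)
Lemma mixing_time eps x t : 0 < eps < 1 ->
  20 * (rho^-1 * n%:R * ln (n%:R / eps)) <= t%:R ->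
  tv_dist (chain_law P x t) nu <= eps.
Proof.
move=> /andP[e0 e1] ht.
have nR : 0 < n%:R :> R by rewrite ltr0n.
have [o0 hJ] := (opnorm_ge0 J, Jnorm).
have r0 : 0 < rho by rewrite /rho; lra.
have r1 : rho <= 1 by rewrite /rho; lra.
have [n1|n1] := leqP n 1.
  have {n1} n1 : n = 1%N by apply/eqP; rewrite eqn_leq n1.
  have t0 : (0 < t)%N.
    rewrite -(ltr_nat R); apply: lt_le_trans ht; rewrite !mulr_gt0 ?invr_gt0//.
    by rewrite n1 ln_gt0// div1r invf_gt1.
  suff -> : tv_dist (chain_law P x t) nu = 0 by exact: ltW.
  rewrite /tv_dist big1 ?mulr0// => y _.
  suff -> : chain_law P x t y = nu y by rewrite subrr normr0.
  case: t t0 {ht} => // t _; rewrite chain_lawS.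
  have wp z : 0 < w z by exact: weight_gt0.
  have [_ l1] := chain_law_prob x t (walk_stochastic n_gt0 wp).
  rewrite -[RHS]mul1r -l1 mulr_suml; apply: eq_bigr => z _; congr (_ * _).
  have : \sum_x nu x = 1 := ising_total.
  by rewrite /P; move: nu z y; rewrite n1 => nu' z y; exact: walk_one.
have n2 : 2 <= n%:R :> R by rewrite ler_nat.
pose y := n%:R / eps; have y2 : 2 <= y by rewrite ler_pdivlMr//; nra.
have ny : n%:R = eps * y by rewrite /y mulrC divfK ?gt_eqF.
have nle : n%:R <= y by rewrite ny; nra.
rewrite -/y in ht; set Lg := ln y in ht.
have yp : 0 < y by lra.
have Ly : Lg <= y by exact/ltW/ln_sublinear.
have L2 : 2^-1 <= Lg by exact: half_le_ln.
have nL0 : 0 <= n%:R * Lg by rewrite mulr_ge0//; lra.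
(* [t0] steps for the renewal of all letters, [t1] for the contraction. *)
pose t0 := (Num.truncn (3 * (n%:R * Lg))).+1.
have t0lo : 3 * (n%:R * Lg) < t0%:R by exact: truncnS_gt.
have t0hi : t0%:R <= 3 * (n%:R * Lg) + 1.
  rewrite /t0 -[_.+1%:R]natr1 lerD2r truncn_le.
  exact: mulr_ge0.
have t0p : 0 < t0%:R :> R by rewrite ltr0n.
have nLy : n%:R * Lg <= y ^+ 2.
  by rewrite expr2; apply: ler_pM => //; lra.
have t0y : t0%:R <= 4 * y ^+ 2 by apply: (le_trans t0hi); nra.
have htr : 20 * (n%:R * Lg) <= rho * t%:R.
  have := ler_wpM2l (ltW r0) ht.
  have -> // : rho * (20 * (rho^-1 * n%:R * Lg)) = 20 * (n%:R * Lg).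
  by field; exact: lt0r_neq0.
have t0t : (t0 <= t)%N.
  rewrite -(ler_nat R); apply: (le_trans t0hi).
  have : rho * t%:R <= t%:R by rewrite ler_piMl.
  nra.
pose t1 := (t - t0)%N; have tE : t = (t0 + t1)%N by rewrite subnKC.
have t1E : t1%:R = t%:R - t0%:R :> R by rewrite natrB.
have ht1 : 16 * (n%:R * Lg) <= rho * t1%:R.
  rewrite t1E mulrBr; have : rho * t0%:R <= t0%:R by rewrite ler_piMl// ltW.
  nra.
(* With this threshold the bad replacements have total probability [eps / 4]. *)
pose q := eps / (8 * n%:R * t0%:R).
have q0 : 0 < q by rewrite divr_gt0// !mulr_gt0.
have wp z : 0 < w z by exact: weight_gt0.
have om0 k : 0 < size_weight gamma g k by exact: expR_gt0.
have lam0 i : 0 < expR (2 * g i) by exact: expR_gt0.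
have C0 : 0 < C by exact: expR_gt0.
have [A _ Amax] := @arg_maxP _ R _ (finset.set0 : {set 'I_n}) xpredT bw isT.
have bA0 : 0 < bw A by rewrite mulr_gt0// prodr_gt0.
(* [A] has maximal base weight, and no letter is renewed at the start. *)
have := renewal n_gt0 wp om0 (size_weight_exch gamma0 g) lam0 C0 q0 bw_le w_le t0 (x := x)
  (finset.sub0set _) (_ : (0 + #|plus x| <= n)%N) (finset.sub0set A) (_ : (0 + #|A| <= n)%N) (lexx (bw A)).
have cle (T : {set 'I_n}) : (0 + #|T| <= n)%N by rewrite add0n -[leqRHS](card_ord n) max_card.
move=> /(_ (cle _) (cle _)); rewrite cards0 addn0 subn0.
set th := _ * bw A => badb.
have {}badb : \sum_(z | bw (plus z) < th) chain_law P x t0 z <= eps / 2.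
  apply: (le_trans badb).
  have -> : t0%:R * eta n q = eps / 4 by rewrite /eta /q; field; rewrite !lt0r_neq0.
  have dec : (1 - n%:R^-1) ^+ t0 <= y^-1 ^+ 3.
    apply: (@le_trans _ _ (expR (- n%:R^-1) ^+ t0)).
      rewrite lerXn2r ?nnegrE ?expR_ge0// ?expR_ge1Dx//.
      by rewrite subr_ge0 invf_le1//; lra.
    rewrite -expRM_natl.
    have -> : y^-1 ^+ 3 = expR (3%:R * - Lg) by rewrite expRM_natl expRN lnK ?posrE.
    by rewrite ler_expR !mulrN lerN2 ler_pdivlMr//; lra.
  have := ler_wpM2l (ltW nR) dec.
  have -> : n%:R * y^-1 ^+ 3 = eps * y^-1 ^+ 2 by rewrite ny; field; exact: lt0r_neq0.
  have yi : y^-1 <= 2^-1 by rewrite lef_pV2 ?posrE.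
  have yi0 : 0 < y^-1 by rewrite invr_gt0.
  have b2 : y^-1 ^+ 2 <= 4^-1 by nra.
  by have := ler_wpM2l (ltW e0) b2; lra.
have good z : th <= bw (plus z) -> tv_dist (chain_law P z t1) nu <= eps / 2.
  move=> hz; have wz := le_trans hz (bw_le z).
  have rat0 : 0 < q / C by rewrite divr_gt0.
  have th0 : 0 < th by rewrite mulr_gt0// exprn_gt0.
  have Zle : \sum_x w x <= 2 ^+ n * (C * bw A).
    apply: (@le_trans _ _ (\sum_(x : spins n) C * bw A)).
      apply: ler_sum => u _; apply: (le_trans (w_le u)); rewrite ler_pM2l//.
      exact: Amax.
    by rewrite sumr_const card_ffun card_bool card_ord -[leLHS]mulr_natl natrX.
  have Z0 : 0 < \sum_x w x by exact: spins_pos.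
  have lnu : - ln (nu z) <= y ^+ 13.
    rewrite -lnV ?posrE ?ising_gt0// /nu /ising invf_div.
    apply: (@le_trans _ _ (ln (2 ^+ n * C * (C / q) ^+ t0))).
      have Cq0 : 0 < (C / q) ^+ t0 by rewrite exprn_gt0// divr_gt0.
      rewrite ler_ln ?posrE; last 2 first.
      - by rewrite divr_gt0// wp.
      - by rewrite mulr_gt0// mulr_gt0// exprn_gt0.
      rewrite ler_pdivrMr//; apply: (le_trans Zle).
      apply: (@le_trans _ _ (2 ^+ n * C * (C / q) ^+ t0 * th)); last first.
        apply: ler_wpM2l => //; apply: mulr_ge0; last by rewrite exprn_ge0// divr_ge0// ltW.
        by rewrite mulr_ge0 ?exprn_ge0// ltW.
      have -> : 2 ^+ n * C * (C / q) ^+ t0 * th = 2 ^+ n * C * bw A * (C / q * (q / C)) ^+ t0.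
        by rewrite (exprMn _ (C / q)) /th; set a1 := (C / q) ^+ _; set a2 := (q / C) ^+ _; ring.
      have -> : C / q * (q / C) = 1 by field; rewrite !lt0r_neq0.
      by rewrite expr1n mulr1 mulrA.
    have Cq : 0 < C / q by rewrite divr_gt0.
    have e2 : 0 < 2 ^+ n :> R by exact: exprn_gt0.
    have p1 : 2 ^+ n * C \in Num.pos by rewrite posrE mulr_gt0.
    have p2 : (C / q) ^+ t0 \in Num.pos by rewrite posrE exprn_gt0.
    rewrite (lnM p1 p2) (lnM e2 C0) (@lnXn R t0 _ Cq) (@lnXn R n 2)//.
    rewrite ln_divE// /C expRK -[ln 2 *+ n]mulr_natl -[(_ - ln q) *+ t0]mulr_natl.
    have l2 : ln 2 <= 1 :> R.
      have := @le_ln1Dx R 1; have -> : 1 + 1 = 2 :> R by ring.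
      by apply; apply: lt_trans ltr01; rewrite oppr_lt0.
    have lq : - ln q <= 8 * y * t0%:R.
      rewrite -lnV ?posrE//; have -> : q^-1 = 8 * y * t0%:R.
        by rewrite /q /y; field; rewrite !lt0r_neq0.
      by apply/ltW/ln_sublinear; apply: mulr_gt0 => //; exact: mulr_gt0.
    have yq : 8 * y * t0%:R <= 32 * y ^+ 3 by have := ler_wpM2l (ltW yp) t0y; lra.
    have y3 : 0 <= y ^+ 3 by rewrite exprn_ge0// ltW.
    have a1 : t0%:R * (n%:R / 4 - ln q) <= t0%:R * (y + 32 * y ^+ 3).
      by rewrite ler_pM2l//; lra.
    have a2 : t0%:R * (y + 32 * y ^+ 3) <= 4 * y ^+ 2 * (y + 32 * y ^+ 3).
      by rewrite ler_wpM2r//; lra.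
    have a3 := ler_wpM2l (ltW nR) l2.
    by have := ln_poly_le y2; lra.
  have := warm_mixing (x := z) (t := t1) n1 y2 lnu ht1.
  have t0' : 0 <= tv_dist (chain_law P z t1) nu by rewrite mulr_ge0 ?invr_ge0// sumr_ge0.
  have ey : 2 * y^-1 <= eps.
    by rewrite ler_pdivrMr// -ny.
  have yi : y^-1 <= 2^-1 by rewrite lef_pV2 ?posrE.
  have yi0 : 0 < y^-1 by rewrite invr_gt0.
  set a := tv_dist _ _ in t0' *; set b := y^-1 in ey yi yi0 * => h3.
  rewrite -(@ler_sqr _ a) ?nnegrE ?divr_ge0 ?(ltW e0)//.
  have h4 : b ^+ 3 <= b ^+ 2 / 2 by (have -> : b ^+ 3 = b ^+ 2 * b by ring); have := sqr_ge0 b; nra.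
  nra.
have [l0 l1] := chain_law_prob x t0 (walk_stochastic n_gt0 wp).
have -> : tv_dist (chain_law P x t) nu =
    tv_dist (fun u => \sum_z chain_law P x t0 z * chain_law P z t1 u) nu.
  by rewrite /tv_dist tE; congr (_ * _); apply: eq_bigr => u _; rewrite chain_law_add.
apply: (le_trans (tv_mix _ _ (conj l0 l1))).
rewrite (bigID (fun z => bw (plus z) < th))/=.
have -> : eps = eps / 2 + eps / 2 by lra.
apply: lerD.
  apply: le_trans badb; apply: ler_sum => z _; apply: ler_piMr; first exact: l0.
  apply: tv_le1; first exact/chain_law_prob/walk_stochastic.
  by split=> [u|]; [exact/ltW/ising_gt0|exact: ising_total].
apply: (@le_trans _ _ (\sum_(z | ~~ (bw (plus z) < th)) chain_law P x t0 z * (eps / 2))).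
  by apply: ler_sum => z; rewrite -leNgt => /good hz; apply: ler_wpM2l; first exact: l0.
rewrite -mulr_suml; apply: ler_piMl; first by rewrite divr_ge0// ltW.
rewrite -l1 [leRHS](bigID (fun z => bw (plus z) < th))/= lerDr; apply: sumr_ge0 => z _.
exact: l0.
Qed.

End MixingTime.

(** * Executing programs *)

Section Execution.
Variables (R : realType) (E : pred (store R)).
Implicit Types (c : cmd) (k : seq cmd) (s : store R).

Definition halted t (cf : config R) : R := \sum_(o <- runs t cf | nilp o.2.1 && E o.2.2) o.1.

Lemma halted0 t s : halted t ([::], s) = (E s)%:R.
Proof.
rewrite /halted; elim: t => [|t IH] /=; first by rewrite big_cons big_nil/=; case: (E s); rewrite ?addr0.
by rewrite cats0 big_map/=; under eq_bigr do rewrite mul1r.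
Qed.

Lemma haltedS t cf : halted t.+1 cf = \sum_(o <- cstep cf) o.1 * halted t o.2.
Proof.
rewrite /halted/= big_flatten/= big_map; apply: eq_bigr => o _.
by rewrite big_map/= mulr_sumr.
Qed.

(** Running times enter as horizons after which the probability no longer changes,
    so they can be enlarged freely and differ between branches. *)
Definition final k s r (v : R) := forall t, (r <= t)%N -> halted t (k, s) = v.

Lemma final_mono k s r r' v : (r <= r')%N -> final k s r v -> final k s r' v.
Proof. by move=> rr f t rt; apply: f; apply: leq_trans rt. Qed.

Lemma final_nil s r : final [::] s r (E s)%:R.
Proof. by move=> t _; exact: halted0. Qed.

Lemma final_det c k s r v k' s' : cstep (c :: k, s) = [:: (1, (k', s'))] ->
  final k' s' r v -> final (c :: k) s r.+1 v.
Proof.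
move=> st f [//|t] rt; rewrite haltedS st big_cons big_nil addr0 mul1r.
exact: f.
Qed.

Lemma final_flip p c1 c2 k s r v1 v2 : 0 <= reval s p <= 1 ->
  final (c1 :: k) s r v1 -> final (c2 :: k) s r v2 ->
  final (Flip p c1 c2 :: k) s r.+1 (reval s p * v1 + (1 - reval s p) * v2).
Proof.
move=> /andP[p0 p1] f1 f2 [//|t] rt; rewrite haltedS /= !big_cons big_nil addr0/=.
by rewrite f1// f2// (min_idPr p1) (max_idPr p0).
Qed.

End Execution.

(** Continuation passing makes these two judgments compose: [det c s B s'] says
    that [c] deterministically turns the memory [s] into [s'] in time [B],
    whatever is executed and observed afterwards. *)
Definition det (R : realType) c (s : store R) B s' :=
  forall E k r v, final E k s' r v -> final E (c :: k) s (r + B) v.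

Definition runs_to (R : realType) c (s : store R) B (Q : store R -> Prop) :=
  exists2 s', Q s' & det c s B s'.

Section Rules.
Variable R : realType.
Implicit Types (c : cmd) (s : store R) (B : nat) (Q : store R -> Prop).

Lemma runs_to_le c s B B' Q Q' : (B <= B')%N -> (forall s', Q s' -> Q' s') ->
  runs_to c s B Q -> runs_to c s B' Q'.
Proof.
move=> BB QQ [s' /QQ q d]; exists s' => // E k r v /d.
by apply: final_mono; rewrite leq_add2l.
Qed.

Lemma runs_to_istore a e v s Q :
  Q (Store (upd (imem s) a (ieval s e) (ieval s v)) (rmem s)) ->
  runs_to (IStore a e v) s 1 Q.
Proof. by move=> q; eexists; first exact: q; move=> E k r w f; rewrite addn1; apply: final_det f. Qed.

Lemma runs_to_rstore a e v s Q :
  Q (Store (imem s) (upd (rmem s) a (ieval s e) (reval s v))) ->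
  runs_to (RStore a e v) s 1 Q.
Proof. by move=> q; eexists; first exact: q; move=> E k r w f; rewrite addn1; apply: final_det f. Qed.

Lemma runs_to_seq c1 c2 s B1 B2 Q1 Q : runs_to c1 s B1 Q1 ->
  (forall s', Q1 s' -> runs_to c2 s' B2 Q) -> runs_to (Seq c1 c2) s (B1 + B2).+1 Q.
Proof.
move=> [s1 q1 d1] /(_ _ q1) [s2 q2 d2]; exists s2 => // E k r v f.
rewrite addnS; apply: final_det => //=.
by rewrite [(B1 + _)%N]addnC addnA; exact/d1/d2.
Qed.

Lemma runs_to_while b c (I : nat -> store R -> Prop) B :
  (forall m s, I m.+1 s -> beval s b /\ runs_to c s B (I m)) ->
  (forall s, I 0%N s -> ~~ beval s b) ->
  forall m s, I m s -> runs_to (While b c) s (m * B.+1).+1 (I 0%N).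
Proof.
move=> IS I0; elim=> [|m IH] s im.
  exists s => // E k r v f; rewrite mul0n addn1.
  by apply: (final_det _ f) => /=; rewrite (negbTE (I0 _ im)).
have [bs [s1 /IH[s2 q2 d2] d1]] := IS _ _ im; exists s2 => // E k r v f.
rewrite addnS; apply: (@final_det _ _ _ _ _ _ _ [:: c, While b c & k] s) => /=.
  by rewrite bs.
(* Each iteration pays one unit for the test. *)
have -> : (r + m.+1 * B.+1)%N = ((r + (m * B.+1).+1) + B)%N by rewrite mulSn; lia.
exact/d1/d2.
Qed.

Lemma final_seq (E : pred (store R)) c1 c2 k s r v :
  final E [:: c1, c2 & k] s r v -> final E (Seq c1 c2 :: k) s r.+1 v.
Proof. exact: final_det. Qed.

Lemma final_runs_to (E : pred (store R)) c k s B Q r v : runs_to c s B Q ->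
  (forall s', Q s' -> final E k s' r v) -> final E (c :: k) s (r + B) v.
Proof. by move=> [s' q d] f; apply/d/f. Qed.

End Rules.

(** * Binary sum trees *)

Definition reg k : iexp := ILoad 4 (ICst k).
Definition set_reg k e : cmd := IStore 4 (ICst k) e.
Definition dbl e : iexp := IAdd e e.
Definition inc e : iexp := IAdd e (ICst 1).
Definition size_cell : iexp := ILoad 0 (ICst 0).

(** Register 0, the cursor, is the only integer that tree routines modify. *)
Definition climb a : cmd :=
  While (BILe (ICst 2) (reg 0))
    (Seq (set_reg 0 (IHalf (reg 0)))
      (RStore a (reg 0) (RAdd (RLoad a (dbl (reg 0))) (RLoad a (inc (dbl (reg 0))))))).

Definition set_leaf a k e : cmd :=
  Seq (set_reg 0 (IAdd size_cell k)) (Seq (RStore a (reg 0) e) (climb a)).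

Definition descend a : cmd :=
  While (BILe (inc (reg 0)) size_cell)
    (Flip (RMul (RLoad a (dbl (reg 0))) (RInv (RLoad a (reg 0))))
      (set_reg 0 (dbl (reg 0))) (set_reg 0 (inc (dbl (reg 0))))).

Definition sample a : cmd := Seq (set_reg 0 (ICst 1)) (descend a).

Section Trees.
Variables (R : realType) (n : nat).
Hypothesis n_gt1 : (1 < n)%N.
Implicit Types (s : store R) (A l : nat -> R) (u v : nat).

(** Bounds the length of a path from the root to a leaf. *)
Definition depth := (trunc_log 2 n).+1.

Definition node A u := A u = A u.*2 + A u.*2.+1.

(** A tree of partial sums in the layout of binary heaps: the root is cell 1, the
    children of [u] are [2 u] and [2 u + 1], and the leaves are the cells [n] to
    [2 n - 1], for any [n]. *)
Definition heap A l : Prop :=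
  (forall j, (j < n)%N -> A (n + j)%N = l j) /\ (forall u, (0 < u < n)%N -> node A u).

Lemma depth_le u m : (2 ^ m <= u)%N -> (u < n.*2)%N -> (m <= depth)%N.
Proof.
move=> h1 h2; have := leq_ltn_trans h1 h2; have := trunc_log_ltn n (isT : (1 < 2)%N).
move=> h3 h4.
have h5 : (2 ^ m < 2 ^ depth.+1)%N.
  by apply: (leq_trans h4); rewrite expnS mul2n leq_double ltnW.
by rewrite ltn_exp2l// in h5.
Qed.

Definition same_ints s s' := forall a k, (a, k) != (4%N, 0%N) -> imem s' a k = imem s a k.
Definition same_reals a s s' := forall b, b != a -> rmem s' b = rmem s b.

Lemma same_ints_trans s1 s2 s3 : same_ints s1 s2 -> same_ints s2 s3 -> same_ints s1 s3.
Proof. by move=> h1 h2 a k ak; rewrite h2// h1. Qed.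

Lemma same_ints_cursor s v r : same_ints s (Store (upd (imem s) 4 0 v) r).
Proof. by move=> a k; rewrite xpair_eqE /= /upd => /negbTE ->. Qed.

(* The nodes that may be wrong are the proper ancestors of the cursor. *)
Definition climbing a l (s0 : store R) m s :=
  let v := imem s 4 0 in
  [/\ same_ints s0 s, same_reals a s0 s, (2 ^ m <= v < 2 ^ m.+1)%N /\ (v < n.*2)%N,
      forall j, (j < n)%N -> rmem s a (n + j)%N = l j &
      forall u, (0 < u < n)%N -> ~ (exists i, u = v %/ 2 ^ i.+1)%N -> node (rmem s a) u].

Lemma climb_step a l s0 m s : climbing a l s0 m.+1 s ->
  runs_to (Seq (set_reg 0 (IHalf (reg 0)))
      (RStore a (reg 0) (RAdd (RLoad a (dbl (reg 0))) (RLoad a (inc (dbl (reg 0))))))) s 3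
    (climbing a l s0 m).
Proof.
move=> [iS rS [/andP[v1 v2] vn] lf nd]; set v := imem s 4 0 in v1 v2 vn nd.
have h2 : v./2 = (v %/ 2)%N by rewrite divn2.
have vp : (2 ^ m <= v./2 < 2 ^ m.+1)%N.
  by rewrite h2 leq_divRL// ltn_divLR// -!expnSr v1.
have v0 : (0 < v./2)%N by case/andP: vp => + _; apply: leq_trans; rewrite expn_gt0.
have vn2 : (v./2 < n)%N by rewrite -ltn_double; apply: leq_ltn_trans vn; rewrite -[leqRHS]odd_double_half leq_addl.
apply: (@runs_to_seq _ _ _ _ 1 1 (fun s' => s' = Store (upd (imem s) 4 0 v./2) (rmem s))).
  exact: runs_to_istore.
move=> _ ->; apply: runs_to_rstore; set s' := Store _ _.
have e4 : imem s' 4%N 0%N = v./2 by [].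
have updE u : rmem s' a u =
    if u == v./2 then rmem s a v./2.*2 + rmem s a v./2.*2.+1 else rmem s a u.
  rewrite /s' /= /upd eqxx/= !addnn addn1.
  by case: eqP.
split.
- exact/(same_ints_trans iS)/same_ints_cursor.
- by move=> b ba; rewrite -(rS _ ba)/= /upd (negbTE ba).
- rewrite e4; split=> //; apply: (ltn_trans vn2); rewrite -addnn -[X in (X < _)%N]addn0 ltn_add2l.
  exact: ltnW.
- by move=> j jn; rewrite updE gtn_eqF ?lf// ltn_addr.
move=> u /andP[u0 un] nu; rewrite e4 in nu.
have c1 : (u.*2 == v./2) = false.
  apply/eqP => h; apply: nu; exists 0%N; rewrite expn1 -h -muln2 mulnK//.
have c2 : (u.*2.+1 == v./2) = false.
  apply/eqP => h; apply: nu; exists 0%N; rewrite expn1 -h divn2 /= uphalf_double//.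
rewrite /node !updE c1 c2; case: eqP => [->//|uv].
apply: nd; first by rewrite u0.
move=> [[|i] ui]; first by apply: uv; rewrite ui expn1 h2.
by apply: nu; exists i; rewrite ui h2 -divnMA -expnS.
Qed.

Lemma climb_runs a l s : (0 < imem s 4 0 < n.*2)%N ->
  (forall j, (j < n)%N -> rmem s a (n + j)%N = l j) ->
  (forall u, (0 < u < n)%N -> ~ (exists i, u = imem s 4 0 %/ 2 ^ i.+1)%N -> node (rmem s a) u) ->
  runs_to (climb a) s (4 * depth).+1
    (fun s' => [/\ same_ints s s', same_reals a s s' & heap (rmem s' a) l]).
Proof.
move=> /andP[v0 vn] lf nd; set v := imem s 4 0 in v0 vn nd.
pose m := trunc_log 2 v.
have vm : (2 ^ m <= v < 2 ^ m.+1)%N by rewrite trunc_logP// trunc_log_ltn.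
have ini : climbing a l s m s by split.
apply: (runs_to_le _ _ (runs_to_while (I := climbing a l s) (B := 3) _ _ ini)); first last.
- by move=> s' q; case: q => _ _ [/andP[_ h] _] _ _ /=; rewrite -ltnNge.
- move=> k s' q; split; last exact: climb_step.
  by case: q => _ _ [/andP[h _] _] _ _ /=; apply: leq_trans h; rewrite expnS leq_pmulr// expn_gt0.
- move=> s1 [h1 h2 [/andP[_ h3] _] h4 h5]; split=> //; split=> // u u0.
  apply: h5 => // -[i ui]; case/andP: u0; rewrite ui divn_small// (leq_trans h3)//.
  by rewrite leq_exp2l.
by rewrite ltnS mulnC leq_mul2l; apply: (depth_le (u := v)) => //; case/andP: vm.
Qed.

Lemma set_leaf_runs a k e s l : imem s 0 0 = n -> (ieval s k < n)%N -> heap (rmem s a) l ->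
  (forall v, ieval (Store (upd (imem s) 4 0 v) (rmem s)) k = ieval s k) ->
  (forall v, reval (Store (upd (imem s) 4 0 v) (rmem s)) e = reval s e) ->
  runs_to (set_leaf a k e) s (4 * depth + 5)
    (fun s' => [/\ same_ints s s', same_reals a s s' &
       heap (rmem s' a) (fun j => if j == ieval s k then reval s e else l j)]).
Proof.
move=> sn kn [lf nd] kE eE; set j0 := ieval s k in kn kE *.
have -> : (4 * depth + 5)%N = (1 + (1 + (4 * depth).+1).+1).+1 by lia.
pose s1 := Store (upd (imem s) 4 0 (n + j0)%N) (rmem s).
apply: (runs_to_seq (Q1 := fun s' => s' = s1)).
  by apply: runs_to_istore; rewrite /s1 /= sn.
move=> _ ->; pose s2 := Store (imem s1) (upd (rmem s) a (n + j0)%N (reval s e)).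
apply: (runs_to_seq (Q1 := fun s' => s' = s2)).
  by apply: runs_to_rstore; rewrite eE.
move=> _ ->.
have e4 : imem s2 4%N 0%N = (n + j0)%N by [].
have updE u : rmem s2 a u = if u == (n + j0)%N then reval s e else rmem s a u.
  by rewrite /s2/= /upd eqxx.
have i2 : same_ints s s2 by exact: same_ints_cursor.
have r2 : same_reals a s s2 by move=> b ba; rewrite /s2 /= /upd (negbTE ba).
have := @climb_runs a (fun j => if j == j0 then reval s e else l j) s2.
have h1 : (0 < imem s2 4 0 < n.*2)%N.
  rewrite e4 addn_gt0 (ltnW n_gt1)/= -addnn ltn_add2l//.
move=> /(_ h1) [].
- by move=> j jn; rewrite updE eqn_add2l; case: eqP => // _; rewrite lf.
- move=> u /andP[u0 un] nu; rewrite e4 in nu.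
  have c0 : (u == (n + j0)%N) = false by rewrite ltn_eqF// ltn_addr.
  have c1 : (u.*2 == (n + j0)%N) = false.
    by apply/eqP => h; apply: nu; exists 0%N; rewrite expn1 -h -muln2 mulnK.
  have c2 : (u.*2.+1 == (n + j0)%N) = false.
    by apply/eqP => h; apply: nu; exists 0%N; rewrite expn1 -h divn2 /= uphalf_double.
  by rewrite /node !updE c0 c1 c2; apply: nd; rewrite u0.
move=> s' [i3 r3 hp] d; exists s' => //; split=> //.
  exact: same_ints_trans i3.
by move=> b ba; rewrite r3// r2.
Qed.

(** ** Sampling a leaf *)

(** The sum of [F] over the leaves below [v]; fuel [m >= n - v] suffices, since a
    child has a larger index than its parent. *)
Fixpoint subtree m (F : nat -> R) v : R :=
  if (n <= v)%N then F (v - n)%N else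
  if m is m'.+1 then subtree m' F v.*2 + subtree m' F v.*2.+1 else 0.

Lemma subtree_fuel m m' F v : (0 < v)%N -> (n <= v + m)%N -> (n <= v + m')%N ->
  subtree m F v = subtree m' F v.
Proof.
elim: m m' v => [|m IH] m' v v0 h h'.
  by rewrite addn0 in h; case: m' h' => [|m'] _ /=; rewrite h.
have [nv|vn] := leqP n v; first by case: m' h' => [|m'] _ /=; rewrite nv.
case: m' h' => [|m'] h' /=; first by rewrite addn0 leqNgt vn in h'.
by rewrite leqNgt vn/= !(IH m')// -addnn; lia.
Qed.

Lemma subtree_leaf m F j : subtree m F (n + j)%N = F j.
Proof. by case: m => [|m] /=; rewrite leq_addr addKn. Qed.

(** Summing the node equations over all inner nodes telescopes: every cell but the
    root is the child of exactly one inner node. *)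
Lemma root_total A : (forall u, (0 < u < n)%N -> node A u) -> A 1%N = \sum_(j < n) A (n + j)%N.
Proof.
move=> nd; apply: (@addIr _ (\sum_(2 <= u < n) A u)).
rewrite -big_ltn; last by lia.
have -> : \sum_(1 <= u < n) A u = \sum_(2 <= u < n.*2) A u.
  rewrite (eq_big_nat _ _ (F2 := fun u => A u.*2 + A u.*2.+1)); last by move=> u /nd.
  have : (0 < n)%N by lia.
  elim: (n) => [//|[|m] IH] _; first by rewrite !big_geq.
  rewrite big_nat_recr//= IH// [m.+2.*2]doubleS.
  by rewrite [RHS]big_nat_recr//= [in RHS]big_nat_recr//= addrA.
rewrite (big_cat_nat _ (n := n))//=; [|lia..].
rewrite addrC; congr (_ + _).
rewrite -[X in \sum_(X <= _ < _) _]add0n big_addn big_mkord -addnn addnK.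
by apply: eq_bigr => j _; rewrite addnC.
Qed.

Lemma subtree_root F : subtree n F 1 = \sum_(j < n) F j.
Proof.
rewrite (root_total (A := subtree n F)) => [|u /andP[u0 un]].
  by apply: eq_bigr => j _; rewrite subtree_leaf.
rewrite /node {1}(subtree_fuel (m' := n.-1.+1))//; try lia.
by rewrite /= leqNgt un/= !(subtree_fuel (m := n.-1) (m' := n))//; lia.
Qed.

Lemma heap_subtree A l u : heap A l -> (0 < u < n.*2)%N -> A u = subtree n l u.
Proof.
move=> [lf nd] hu; have : (n <= u + n)%N by exact: leq_addl.
move: {2 3}n => m; elim: m u hu => [|m IH] u /andP[u0 u2] h.
all: have [nu|un] := leqP n u.
- by rewrite /= nu -lf ?subnKC//; lia.
- lia.
- by rewrite /= nu -lf ?subnKC//; lia.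
- by rewrite /= leqNgt un/= nd ?u0// !IH//; lia.
Qed.

Lemma subtreeS F v : (0 < v < n)%N -> subtree n F v = subtree n F v.*2 + subtree n F v.*2.+1.
Proof.
move=> /andP[v0 vn]; rewrite {1}(subtree_fuel (m' := n.-1.+1))//; try lia.
by rewrite /= leqNgt vn/= !(subtree_fuel (m := n.-1) (m' := n))//; lia.
Qed.

Lemma subtree_ge0 m F v : (v < n.*2)%N -> (forall j, (j < n)%N -> 0 <= F j) -> 0 <= subtree m F v.
Proof.
move=> v2 F0; elim: m v v2 => [|m IH] v v2 /=; case: leqP => // h; try by apply: F0; lia.
by rewrite addr_ge0// IH//; lia.
Qed.

Section Sampling.
Variables (E : pred (store R)) (k : seq cmd) (s : store R) (a r : nat) (l f : nat -> R).
Hypothesis sn : imem s 0 0 = n.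
Hypothesis hp : heap (rmem s a) l.
Hypothesis l0 : forall j, (j < n)%N -> 0 <= l j.
Hypothesis leaf_final : forall s' j, (j < n)%N ->
  same_ints s s' -> rmem s' = rmem s -> imem s' 4 0 = (n + j)%N -> final E k s' r (f j).

(* Multiplying the value at a node by the weight of its subtree keeps the claim
   true, and inductive, below nodes of weight 0. *)
Let descent s' m v : (0 < v < n.*2)%N -> (n <= v * 2 ^ m)%N ->
  same_ints s s' -> rmem s' = rmem s -> imem s' 4 0 = v ->
  exists2 x, final E (descend a :: k) s' (r + m * 3).+1 x
    & x * rmem s a v = subtree n (fun j => l j * f j) v.
Proof.
have exit m' v' s1 : (n <= v' < n.*2)%N -> same_ints s s1 -> rmem s1 = rmem s ->
    imem s1 4 0 = v' -> exists2 x, final E (descend a :: k) s1 (r + m' * 3).+1 x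
      & x * rmem s a v' = subtree n (fun j => l j * f j) v'.
  move=> /andP[nv v2] iS rS e4; have jn : (v' - n < n)%N by lia.
  have vE : (n + (v' - n) = v')%N by rewrite subnKC.
  exists (f (v' - n)%N); last first.
    have := proj1 hp _ jn; have := subtree_leaf n (fun j => l j * f j) (v' - n)%N.
    by rewrite vE => -> ->; rewrite mulrC.
  apply: (final_mono (r := r.+1)); first by rewrite ltnS leq_addr.
  apply: (@final_det _ _ _ _ _ _ _ k s1) => /=.
    by rewrite e4 iS// sn addn1 ltnNge nv.
  by apply: leaf_final => //; rewrite e4.
elim: m v s' => [|m IH] v s1 /andP[v0 v2] nm iS rS e4.
  by apply: exit => //; rewrite v2 andbT -[v]muln1.
have [nv|vn] := leqP n v; first by apply: exit => //; rewrite nv.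
have child u c : (u = v.*2 \/ u = v.*2.+1) ->
    c = IStore 4 (ICst 0) (if u == v.*2 then dbl (reg 0) else inc (dbl (reg 0))) ->
    exists2 x, final E [:: c, descend a & k] s1 (r + m * 3).+2 x
      & x * rmem s a u = subtree n (fun j => l j * f j) u.
  move=> uv cE; pose s2 := Store (upd (imem s1) 4 0 u) (rmem s1).
  have [|||||x fx xA] := IH u s2.
  - by lia.
  - by apply: (leq_trans nm); rewrite expnS mulnA leq_mul2r; lia.
  - exact/(same_ints_trans iS)/same_ints_cursor.
  - by [].
  - by [].
  exists x => //; apply: final_det fx; rewrite cE/= /s2.
  have -> // : ieval s1 (if u == v.*2 then dbl (reg 0) else inc (dbl (reg 0))) = u.
  by case: uv => ->; rewrite ?eqxx ?eqn_leq ?ltnn ?andbF /= e4 ?addn1 addnn.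
have [x1 f1 x1A] := child _ _ (or_introl erefl) erefl.
have [x2 f2 x2A] := child _ _ (or_intror erefl) erefl.
rewrite eqxx in f1; rewrite eqn_leq ltnn /= in f2.
pose p := RMul (RLoad a (dbl (reg 0))) (RInv (RLoad a (reg 0))).
have pE : reval s1 p = rmem s a v.*2 / rmem s a v by rewrite /= rS e4 addnn.
have A0 u : (0 < u < n.*2)%N -> 0 <= rmem s a u.
  by move=> hu; rewrite (heap_subtree hp hu); apply: subtree_ge0 => //; case/andP: hu.
have nd : rmem s a v = rmem s a v.*2 + rmem s a v.*2.+1 by apply: (proj2 hp); rewrite v0.
have a1 : 0 <= rmem s a v.*2 by apply: A0; lia.
have a2 : 0 <= rmem s a v.*2.+1 by apply: A0; lia.
have p01 : 0 <= reval s1 p <= 1.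
  rewrite pE; have [av|av] := eqVneq (rmem s a v) 0; first by rewrite av invr0 mulr0 lexx ler01.
  have avp : 0 < rmem s a v by rewrite lt0r av nd addr_ge0.
  by rewrite divr_ge0 ?(ltW avp)// ler_pdivrMr// mul1r nd lerDl.
exists (reval s1 p * x1 + (1 - reval s1 p) * x2).
  have -> : (r + m.+1 * 3 = (r + m * 3).+3)%N by rewrite mulSn; lia.
  apply: (@final_det _ _ _ _ _ _ _ [:: Flip p (set_reg 0 (dbl (reg 0))) (set_reg 0 (inc (dbl (reg 0)))),
     descend a & k] s1).
    by rewrite /= e4 iS// sn addn1 vn.
  exact: final_flip.
rewrite subtreeS ?v0// -x1A -x2A pE; have [av|av] := eqVneq (rmem s a v) 0.
  have [-> ->] : rmem s a v.*2 = 0 /\ rmem s a v.*2.+1 = 0 by split; lra.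
  by rewrite av !mulr0 addr0.
have -> : rmem s a v.*2.+1 = rmem s a v - rmem s a v.*2 by rewrite nd addrC addKr.
by field.
Qed.

(** The product form of the conclusion also covers a tree of total weight 0, where
    the quotients computed by the program are arbitrary. *)
Lemma final_sample :
  exists2 x, final E (sample a :: k) s (r + (3 * depth + 3)) x
    & x * (\sum_(j < n) l j) = \sum_(j < n) l j * f j.
Proof.
pose s1 := Store (upd (imem s) 4 0 1%N) (rmem s).
have [|||//|//|x fx xA] := @descent s1 depth 1.
- by lia.
- by rewrite mul1n ltnW// trunc_log_ltn.
- exact: same_ints_cursor.
exists x; last by rewrite -(subtree_root l) -(subtree_root (fun j => l j * f j)) -xA (heap_subtree hp)//; lia.
have -> : (r + (3 * depth + 3) = (r + depth * 3).+3)%N by lia.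
by apply: final_seq; apply: final_det fx.
Qed.

End Sampling.

End Trees.

(** * The data structure of the sampler *)

(** The leaf of coordinate [j] is 0 if [j] is plus, and otherwise
    [1 + exp (2 theta j)], the weight of the two outcomes of the up-step at [j]
    relative to the weight of leaving [j] minus. *)
Definition refresh k : cmd :=
  set_leaf 3 k (RMul (ROfNat (ISub (ICst 1) (ILoad 1 k)))
    (RAdd (ROfNat (ICst 1)) (RExp (RAdd (RLoad 2 k) (RLoad 2 k))))).

Definition row_end : iexp := ILoad 2 (inc (reg 1)).
Definition col : iexp := ILoad 3 (reg 2).
Definition coef : rexp := RLoad 5 (ICst 0).

Definition scatter : cmd :=
  Seq (set_reg 2 (ILoad 2 (reg 1)))
    (While (BILe (inc (reg 2)) row_end)
      (Seq (Seq (RStore 2 col (RAdd (RLoad 2 col) (RMul coef (RLoad 1 (reg 2)))))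
                (refresh col))
           (set_reg 2 (inc (reg 2))))).

(** The change [2 (b - spin)] of the spin vanishes if the spin has the value [b]
    already, so no test is needed. *)
Definition set_spin (b : bool) : cmd :=
  let diff := RAdd (ROfNat (ICst b)) (ROpp (ROfNat (ILoad 1 (reg 1)))) in
  Seq (RStore 5 (ICst 0) (RAdd diff diff))
    (Seq (Seq (IStore 1 (reg 1) (ICst b)) (refresh (reg 1))) scatter).

(** Array 4 holds a tree with all leaves equal to 1, for the uniform choice of the
    down-step; array 3 the tree of up-step weights. *)
Definition step : cmd :=
  let e := RExp (RAdd (RLoad 2 (reg 1)) (RLoad 2 (reg 1))) in
  Seq (sample 4)
    (Seq (set_reg 1 (ISub (reg 0) size_cell))
      (Seq (set_spin false)
        (Seq (sample 3)
          (Seq (set_reg 1 (ISub (reg 0) size_cell))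
            (Flip (RMul e (RInv (RAdd (ROfNat (ICst 1)) e)))
               (set_spin true) (set_reg 0 (ICst 0))))))).

(** The local fields start at the external field and receive the contribution of
    each spin in turn. *)
Definition init : cmd :=
  let spin := ROfNat (ILoad 1 (reg 1)) in
  Seq (set_reg 1 (ICst 0))
    (Seq (While (BILe (inc (reg 1)) size_cell)
           (Seq (RStore 2 (reg 1) (RLoad 0 (reg 1)))
             (Seq (refresh (reg 1))
               (Seq (set_leaf 4 (reg 1) (ROfNat (ICst 1))) (set_reg 1 (inc (reg 1)))))))
      (Seq (set_reg 1 (ICst 0))
        (While (BILe (inc (reg 1)) size_cell)
          (Seq (RStore 5 (ICst 0) (RAdd (RAdd spin spin) (ROpp (ROfNat (ICst 1)))))
            (Seq scatter (set_reg 1 (inc (reg 1)))))))).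

Section RowPointers.
Variables (n : nat) (sz : 'I_n -> nat).

Definition rowptr r := (\sum_(i < n | (i < r)%N) sz i)%N.

Lemma rowptrS (i : 'I_n) : rowptr i.+1 = (rowptr i + sz i)%N.
Proof.
rewrite /rowptr (bigD1 i)//= addnC; congr addn; apply: eq_bigl => k.
by rewrite ltnS leq_eqVlt -val_eqE; case: ltngtP.
Qed.

Lemma rowptr_sumn r : (r <= n)%N -> rowptr r = sumn (take r [seq sz i | i <- enum 'I_n]).
Proof.
elim: r => [_|r IH rn]; first by rewrite take0 /rowptr big_pred0.
rewrite (rowptrS (Ordinal rn))/= IH; last exact: ltnW.
have sE : size [seq sz i | i <- enum 'I_n] = n by rewrite size_map size_enum_ord.
rewrite (take_nth 0%N) ?sE// sumn_rcons; congr addn.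
by rewrite (nth_map (Ordinal rn)) ?size_enum_ord//; congr sz; apply/val_inj; rewrite /= nth_enum_ord.
Qed.

Lemma nth_flatten_row (T : Type) (x0 : T) (F : 'I_n -> seq T) (i : 'I_n) p :
  (forall k, size (F k) = sz k) -> (p < sz i)%N ->
  nth x0 (flatten [seq F k | k <- enum 'I_n]) (rowptr i + p)%N = nth x0 (F i) p.
Proof.
move=> Fs ps; set ss := [seq F k | k <- enum 'I_n].
have sss : size ss = n by rewrite size_map size_enum_ord.
have ssi : nth [::] ss i = F i.
  by rewrite (nth_map i) ?size_enum_ord// nth_ord_enum.
rewrite -(cat_take_drop i ss) flatten_cat (drop_nth [::]) ?sss// ssi /=.
have -> : rowptr i = size (flatten (take i ss)).
  rewrite size_flatten rowptr_sumn; last exact: ltnW.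
  rewrite /shape map_take /ss -map_comp; congr (sumn (take _ _)).
  by apply: eq_map => k; rewrite /= Fs.
by rewrite nth_cat ltnNge leq_addr/= addKn nth_cat Fs ps.
Qed.

End RowPointers.

Section DataStructure.
Variables (R : realType) (n : nat) (Q : 'M[R]_n) (h : 'cV[R]_n).
Hypothesis n_gt1 : (1 < n)%N.
Hypothesis Qsym : forall i j, Q i j = Q j i.
Implicit Types (s : store R) (x y : spins n) (T : nat) (th : 'I_n -> R).

Let deg i := size (nbrs Q i).
Let rp := rowptr deg.

Record static T s : Prop := Static {
  static_n : imem s 0 0 = n;
  static_T : imem s 0 1 = T;
  static_ptr : forall r, (r <= n)%N -> imem s 2 r = rp r;
  static_col : forall (i : 'I_n) p, (p < deg i)%N -> imem s 3 (rp i + p)%N = nth i (nbrs Q i) p;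
  static_field : forall i : 'I_n, rmem s 0 i = h i 0;
  static_val : forall (i : 'I_n) p, (p < deg i)%N -> rmem s 1 (rp i + p)%N = Q i (nth i (nbrs Q i) p)
}.

Definition spins_at x s := forall i : 'I_n, imem s 1 i = x i :> nat.
Definition fields_at th s := forall i : 'I_n, rmem s 2 i = th i.

Definition leaf s j : R := (1 - imem s 1 j)%N%:R * (1 + expR (rmem s 2 j + rmem s 2 j)).

(** The fields [th] are a parameter, since they lag behind the spins during an
    update; the leaves always agree with the current spins and fields. *)
Record valid T x th s : Prop := Valid {
  valid_static : static T s;
  valid_spins : spins_at x s;
  valid_fields : fields_at th s;
  valid_leaves : heap n (rmem s 3) (leaf s);
  valid_uniform : heap n (rmem s 4) (fun=> 1)
}.

Lemma input_static x T : static T (input Q h x T).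
Proof.
split=> //.
- by move=> r rn; rewrite /= nth_mkseq.
- move=> i p pi; rewrite /= (nth_flatten_row (sz := deg)) => [||//]; last by move=> k; rewrite size_map.
  by rewrite (nth_map i).
- by move=> i; rewrite /= (nth_map i) ?size_enum_ord// nth_ord_enum.
- move=> i p pi; rewrite /= (nth_flatten_row (sz := deg)) => [||//]; last by move=> k; rewrite size_map.
  by rewrite (nth_map i).
Qed.

Lemma input_spins x T : spins_at x (input Q h x T).
Proof. by move=> i; rewrite /= (nth_map i) ?size_enum_ord// nth_ord_enum. Qed.

Lemma static_frame T s s' :
  (forall a k, a != 1%N -> a != 4%N -> imem s' a k = imem s a k) ->
  rmem s' 0%N = rmem s 0%N -> rmem s' 1%N = rmem s 1%N -> static T s -> static T s'.
Proof.
move=> iS r0 r1 [h1 h2 h3 h4 h5 h6]; split.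
- by rewrite iS.
- by rewrite iS.
- by move=> r rn; rewrite iS// h3.
- by move=> i p pi; rewrite iS// h4.
- by move=> i; rewrite r0.
- by move=> i p pi; rewrite r1 h6.
Qed.

Lemma heap_ext (A l l' : nat -> R) : (forall j, (j < n)%N -> l j = l' j) -> heap n A l -> heap n A l'.
Proof. by move=> ll [h1 h2]; split=> // j jn; rewrite h1// ll. Qed.

(** Registers and the scratch coefficient are not part of the represented state. *)
Lemma valid_frame T x th s s' :
  (forall a k, a != 4%N -> imem s' a k = imem s a k) ->
  (forall a, a != 5%N -> rmem s' a = rmem s a) -> valid T x th s -> valid T x th s'.
Proof.
move=> iS rS [h1 h2 h3 h4 h5]; split.
- by apply: static_frame h1 => [a k _|//|//]; [exact: iS|rewrite rS|rewrite rS].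
- by move=> i; rewrite iS.
- by move=> i; rewrite rS.
- by rewrite rS//; apply: heap_ext h4 => j jn; rewrite /leaf iS// rS.
- by rewrite rS.
Qed.

Lemma refresh_runs k s (l : nat -> R) : imem s 0 0 = n -> (ieval s k < n)%N -> heap n (rmem s 3) l ->
  (forall v, ieval (Store (upd (imem s) 4 0 v) (rmem s)) k = ieval s k) ->
  runs_to (refresh k) s (4 * depth n + 5) (fun s' => [/\ same_ints s s', same_reals 3 s s' &
     heap n (rmem s' 3) (fun j => if j == ieval s k then leaf s' j else l j)]).
Proof.
move=> sn kn hp kE; have e1 (s' : store R) : 1%N%:R = 1 :> R by [].
apply: (runs_to_le (leqnn _) _ (set_leaf_runs n_gt1 sn kn hp kE _)) => [s' [h1 h2 h3]|v /=].
  split=> //; apply: heap_ext h3 => j _; case: eqP => // -> /=.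
  by rewrite /leaf h1// h2.
by rewrite !kE.
Qed.

Lemma store_field_runs T x th s k e (i : 'I_n) : valid T x th s -> ieval s k = i ->
  (forall r : nat -> nat -> R, ieval (Store (imem s) r) k = ieval s k) ->
  (forall v (r : nat -> nat -> R), ieval (Store (upd (imem s) 4 0 v) r) k = ieval s k) ->
  runs_to (Seq (RStore 2 k e) (refresh k)) s (4 * depth n + 7) (fun s' =>
    [/\ valid T x (fun j => if j == i then reval s e else th j) s', same_ints s s' &
        forall a, a != 2%N -> a != 3%N -> rmem s' a = rmem s a]).
Proof.
move=> [v1 v2 v3 v4 v5] ki k1 k2.
have -> : (4 * depth n + 7)%N = (1 + (4 * depth n + 5)).+1 by lia.
pose s1 := Store (imem s) (upd (rmem s) 2 i (reval s e)).
apply: (runs_to_seq (Q1 := fun s' => s' = s1)).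
  by apply: runs_to_rstore; rewrite ki.
move=> _ ->; have k1i : ieval s1 k = i by rewrite k1.
apply: (runs_to_le (leqnn _) _ (refresh_runs (l := leaf s) _ _ _ _)).
- move=> s' [h1 h2 h3]; split=> //.
  + have h13 a k' : a != 4%N -> imem s' a k' = imem s a k'.
      by move=> a4; rewrite h1// xpair_eqE (negbTE a4).
    split.
    * apply: static_frame v1 => [a k' _|//|//]; [exact: h13|by rewrite h2|by rewrite h2].
    * by move=> j; rewrite h13.
    * by move=> j; rewrite h2//= /upd eqxx/= val_eqE; case: eqP => // _; rewrite v3.
    * apply: heap_ext h3 => j jn; rewrite k1i; case: eqP => // /eqP ji.
      by rewrite /leaf h13// h2//= /upd eqxx/= (negbTE ji).
    * by rewrite h2.
  + by move=> a a2 a3; rewrite h2//= /upd (negbTE a2).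
- exact: static_n v1.
- by rewrite k1i.
- exact: v4.
- by move=> v; rewrite k2 k1.
Qed.

Variable D : nat.
Hypothesis deg_le : forall i, (deg i <= D)%N.

Let entry_cost := (4 * depth n + 10)%N.

Lemma scatter_runs T x th s (i : 'I_n) : valid T x th s -> imem s 4 1 = i ->
  runs_to scatter s (D * entry_cost + 3) (fun s' =>
    valid T x (fun j => th j + rmem s 5 0 * (if j != i then Q i j else 0)) s' /\ imem s' 4 1 = i).
Proof.
move=> vs s1i; set c := rmem s 5 0.
(* The fields after the first [p] entries of row [i]. *)
pose thp p j := th j + c * (if j \in take p (nbrs Q i) then Q i j else 0).
pose I m s' := exists2 p, (p + m = deg i)%N &
  [/\ valid T x (thp p) s', imem s' 4 1 = i, imem s' 4 2 = (rp i + p)%N & rmem s' 5 0 = c].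
have -> : (D * entry_cost + 3)%N = (1 + (D * entry_cost).+1).+1 by lia.
pose s0 := Store (upd (imem s) 4 2 (rp i)) (rmem s).
apply: (runs_to_seq (Q1 := fun s' => s' = s0)).
  apply: runs_to_istore; rewrite /s0 /= s1i (static_ptr (valid_static vs))//.
  exact: ltnW.
move=> _ ->; have I0 : I (deg i) s0.
  exists 0%N => //; rewrite addn0; split=> //.
  have [||a1 a2 a3 a4 a5] := valid_frame (s' := s0) _ _ vs => //.
    by move=> a k a4; rewrite /= /upd (negbTE a4).
  by split=> // j; rewrite a3 /thp take0 mulr0 addr0.
have := runs_to_while (R := R) (b := BILe (inc (reg 2)) row_end) (I := I) (B := entry_cost.-1) _ _ I0.
set body := (X in Seq _ X).
move=> rt; apply: (runs_to_le _ _ (rt _ _ _)).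
- by rewrite ltnS leq_mul.
- move=> s' [p]; rewrite addn0 => pd [h1 h2 _ _]; split=> //.
  case: h1 => a1 a2 a3 a4 a5; split=> // j.
  rewrite a3 /thp pd take_size mem_filter mem_enum andbT; congr (_ + _ * _).
  by case: eqP => //= _; case: eqP.
- move=> m s' [p pd [h1 h2 h3 h4]].
  have pi : (p < deg i)%N by rewrite -pd addnS ltnS leq_addr.
  have st := valid_static h1.
  set j := nth i (nbrs Q i) p.
  have colE : ieval s' col = j by rewrite /= h3 (static_col st).
  split.
    by rewrite /= h2 h3 !addn1 (static_ptr st)// /rp rowptrS -addnS leq_add2l.
  have -> : entry_cost.-1 = ((4 * depth n + 7) + 1).+1 by rewrite /entry_cost; lia.
  apply: (runs_to_seq (store_field_runs _ h1 colE _ _)) => // s2 [g1 g2 g3].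
  apply: runs_to_istore; exists p.+1; first by rewrite addSnnS.
  split.
  + apply: (valid_frame (s := s2)) => [a k a4|//|]; first by rewrite /= /upd (negbTE a4).
    case: g1 => a1 a2 a3 a4 a5; split=> // j'.
    rewrite a3 /=; set e0 := (X in if _ then X else _).
    have -> : e0 = thp p j + c * Q i j.
      have -> : e0 = rmem s' 2 (ieval s' col) + rmem s' 5 0 * rmem s' 1 (imem s' 4 2) by [].
      by rewrite colE h3 h4 (valid_fields h1) (static_val st).
    have ju : uniq (nbrs Q i) by rewrite filter_uniq// enum_uniq.
    rewrite /thp (take_nth i pi) mem_rcons inE -/j.
    case: eqP => [->|//].
    have -> : (j \in take p (nbrs Q i)) = false.
      apply/negbTE; have : uniq (take p.+1 (nbrs Q i)) by rewrite take_uniq.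
      by rewrite (take_nth i pi) rcons_uniq => /andP[].
    by rewrite mulr0 addr0.
  + by rewrite /= -h2 -(g2 4%N 1%N).
  + by rewrite /= /upd /= g2// h3 addn1 addnS.
  + by rewrite /= g3.
- move=> s' [p]; rewrite addn0 => pd [h1 h2 h3 h4].
  by rewrite /= h2 h3 !addn1 (static_ptr (valid_static h1))// /rp rowptrS pd ltnn.
Qed.

Definition local_field x j : R := h j 0 + \sum_(k | k != j) Q j k * sg R x k.

Definition represents T x s := valid T x (local_field x) s.

Definition put x i b : spins n := [ffun j => if j == i then b else x j].

Lemma local_field_put x i b j : local_field (put x i b) j =
  local_field x j + ((b%:R - (x i)%:R) + (b%:R - (x i)%:R)) * (if j != i then Q i j else 0).
Proof.
rewrite /local_field -addrA; congr (_ + _); case: eqVneq => [->|ji] /=.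
  rewrite mulr0 addr0; apply: eq_bigr => k ki; congr (_ * _).
  by rewrite /sg ffunE (negbTE ki).
rewrite (bigD1 i) 1?eq_sym//= [in RHS](bigD1 i) 1?eq_sym//= addrAC; congr (_ + _).
  by rewrite /sg ffunE eqxx Qsym; case: b; case: (x i) => /=; ring.
apply: eq_bigr => k /andP[_ ki]; congr (_ * _).
by rewrite /sg ffunE (negbTE ki).
Qed.

Let flip_cost := (D * entry_cost + entry_cost + 3)%N.

Lemma set_spin_runs T x s (i : 'I_n) b : represents T x s -> imem s 4 1 = i ->
  runs_to (set_spin b) s flip_cost (represents T (put x i b)).
Proof.
move=> vs s1i.
have -> : flip_cost = (1 + ((4 * depth n + 7) + (D * entry_cost + 3)).+1).+1.
  by rewrite /flip_cost /entry_cost; lia.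
set c : R := (b%:R - (x i)%:R) + (b%:R - (x i)%:R).
pose s1 := Store (imem s) (upd (rmem s) 5 0 c).
apply: (runs_to_seq (Q1 := fun s' => s' = s1)).
  by apply: runs_to_rstore; rewrite /= s1i (valid_spins vs).
move=> _ ->.
have v1 : represents T x s1.
  by apply: valid_frame vs => // a a5; rewrite /= /upd (negbTE a5).
apply: (runs_to_seq (Q1 := fun s' =>
  [/\ valid T (put x i b) (local_field x) s', imem s' 4 1 = i & rmem s' 5 0 = c])).
  have -> : (4 * depth n + 7)%N = (1 + (4 * depth n + 5)).+1 by lia.
  pose s2 := Store (upd (imem s1) 1 i b) (rmem s1).
  apply: (runs_to_seq (Q1 := fun s' => s' = s2)).
    by apply: runs_to_istore; rewrite /= s1i.
  move=> _ ->; have k1i : ieval s2 (reg 1) = i by [].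
  case: v1 => a1 a2 a3 a4 a5.
  apply: (runs_to_le (leqnn _) _ (refresh_runs (l := leaf s1) _ _ _ _)) => //.
  + move=> s' [h1 h2 h3]; split; [|by rewrite h1|by rewrite h2//= /upd].
    have h13 a k' : a != 4%N -> a != 1%N -> imem s' a k' = imem s1 a k'.
      move=> a4' a1'; rewrite h1 ?xpair_eqE ?(negbTE a4')//.
      by rewrite /= /upd (negbTE a1').
    split.
    * by apply: static_frame a1 => [a k' ? ?||]; [exact: h13|rewrite h2|rewrite h2].
    * move=> j; rewrite h1//= /upd eqxx/= val_eqE ffunE.
      by case: eqP => // _; rewrite -(a2 j).
    * by move=> j; rewrite h2// -a3.
    * apply: heap_ext h3 => j jn; rewrite k1i; case: eqP => // /eqP ji.
      by rewrite /leaf h1//= h2// /upd eqxx/= (negbTE ji).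
    * by rewrite h2.
  + exact: static_n a1.
  + by rewrite k1i.
move=> s3 [w1 w2 w3]; apply: (runs_to_le (leqnn _) _ (scatter_runs w1 w2)).
move=> s' [] [a1 a2 a3 a4 a5] _; split=> // j.
by rewrite a3 local_field_put w3.
Qed.

End DataStructure.

(** * One step and the initialization *)

Section Sampler.
Variables (R : realType) (n : nat) (Q : 'M[R]_n) (h : 'cV[R]_n).
Hypothesis n_gt1 : (1 < n)%N.
Hypothesis Qsym : forall i j, Q i j = Q j i.
Variable D : nat.
Hypothesis deg_le : forall i, (size (nbrs Q i) <= D)%N.
Variable w : spins n -> R.
Hypothesis w_gt0 : forall x, 0 < w x.
Hypothesis w_flip : forall (S : {set 'I_n}) j, j \notin S ->
  w (sp (j |: S)) = w (sp S) * expR (local_field Q h (sp S) j + local_field Q h (sp S) j).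
Implicit Types (s : store R) (x y : spins n) (T : nat) (S : {set 'I_n}) (E : pred (store R)).

Let P := pol_walk (fun x => w x / \sum_y w y).
Let flip_cost := (D * (4 * depth n + 10) + (4 * depth n + 10) + 3)%N.

(* The tree lemmas index leaves by natural numbers. *)
Let at_site (F : 'I_n -> R) (j : nat) : R := if insub j is Some i then F i else 0.

Let at_siteE F (i : 'I_n) : at_site F i = F i.
Proof. by rewrite /at_site valK. Qed.

Lemma put_true S j : put (sp S) j true = sp (j |: S).
Proof. by apply/ffunP => i; rewrite !ffunE !inE; case: eqP. Qed.

Lemma put_false x i : put x i false = sp (plus x :\ i).
Proof. by apply/ffunP => j; rewrite !ffunE !inE; case: eqP. Qed.

Definition up_step : cmd :=
  let e := RExp (RAdd (RLoad 2 (reg 1)) (RLoad 2 (reg 1))) in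
  Seq (sample 3)
    (Seq (set_reg 1 (ISub (reg 0) size_cell))
      (Flip (RMul e (RInv (RAdd (ROfNat (ICst 1)) e)))
         (set_spin true) (set_reg 0 (ICst 0)))).

Lemma represents_frame T x s s' :
  (forall a k, a != 4%N -> imem s' a k = imem s a k) -> rmem s' = rmem s ->
  represents Q h T x s -> represents Q h T x s'.
Proof. by move=> iS rS; apply: valid_frame => // a _; rewrite rS. Qed.

Lemma same_ints_off s s' a k : same_ints s s' -> a != 4%N -> imem s' a k = imem s a k.
Proof. by move=> iS a4; rewrite iS// xpair_eqE (negbTE a4). Qed.

Lemma final_site E c k T x s s' r v (i : 'I_n) : represents Q h T x s ->
  same_ints s s' -> rmem s' = rmem s -> imem s' 4 0 = (n + i)%N ->
  (forall s2, represents Q h T x s2 -> imem s2 4 1 = i -> final E (c :: k) s2 r v) ->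
  final E (Seq (set_reg 1 (ISub (reg 0) size_cell)) c :: k) s' r.+2 v.
Proof.
move=> vs iS rS e4 f; apply: final_seq; apply: final_det => //=; apply: f.
  apply: represents_frame vs => // a k0 a4.
  by rewrite /= /upd (negbTE a4)/= (same_ints_off _ iS).
by rewrite /= /upd /= e4 (same_ints_off _ iS)// (static_n (valid_static vs)) addKn.
Qed.

(** Relative to the weight of [S], the leaves add up to [up_total]. Coordinates
    of [S] have leaf 0, hence are drawn with probability 0. *)
Lemma final_up_step E k T S s r (v : spins n -> R) i : i \notin S ->
  represents Q h T (sp S) s ->
  (forall y s', represents Q h T y s' -> final E k s' r (v y)) ->
  final E (up_step :: k) s (r + (flip_cost + 3 * depth n + 7)) (up_weight w v S / up_total w S).
Proof.
move=> iS vs fk.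
pose e j := expR (local_field Q h (sp S) j + local_field Q h (sp S) j).
pose p j := e j / (1 + e j).
have e0 j : 0 < e j by exact: expR_gt0.
have e1 j : 0 < 1 + e j by rewrite addr_gt0.
pose F j := p j * v (sp (j |: S)) + (1 - p j) * v (sp S).
have lE (j : 'I_n) : leaf s j = if j \notin S then 1 + e j else 0.
  rewrite /leaf (valid_spins vs) (valid_fields vs) ffunE.
  by case: (j \in S); rewrite ?mul0r ?mul1r.
have l0 j : (j < n)%N -> 0 <= leaf s j.
  by move=> jn; rewrite mulr_ge0// addr_ge0// expR_ge0.
have [|X fX XE] := final_sample n_gt1 (E := E)
  (k := Seq (set_reg 1 (ISub (reg 0) size_cell))
      (Flip (RMul (RExp (RAdd (RLoad 2 (reg 1)) (RLoad 2 (reg 1))))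
         (RInv (RAdd (ROfNat (ICst 1)) (RExp (RAdd (RLoad 2 (reg 1)) (RLoad 2 (reg 1)))))))
         (set_spin true) (set_reg 0 (ICst 0))) :: k)
  (r := (r + flip_cost).+3) (f := at_site F) (static_n (valid_static vs)) (valid_leaves vs) l0.
  move=> s' j jn sI sR e4; rewrite -[j]/(val (Ordinal jn)) at_siteE.
  apply: (final_site (i := Ordinal jn) vs sI sR e4) => s2 v2 s2j.
  have pE : reval s2 (RMul (RExp (RAdd (RLoad 2 (reg 1)) (RLoad 2 (reg 1))))
         (RInv (RAdd (ROfNat (ICst 1)) (RExp (RAdd (RLoad 2 (reg 1)) (RLoad 2 (reg 1))))))) =
      p (Ordinal jn).
    by rewrite /= s2j (valid_fields v2 (Ordinal jn)).
  rewrite /F -pE; apply: final_flip.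
  - by rewrite pE divr_ge0 ?(ltW (e0 _)) ?(ltW (e1 _))//= ler_pdivrMr// mul1r lerDr.
  - apply: (final_runs_to (set_spin_runs n_gt1 Qsym deg_le true v2 s2j)) => s3.
    by rewrite put_true; exact: fk.
  - apply: (final_mono (r := r.+1)); first by rewrite /flip_cost addnS addnS ltnS leq_addr.
    apply: final_det => //=; apply: fk; apply: represents_frame v2 => // a k0 a4.
    by rewrite /= /upd (negbTE a4).
have -> : up_weight w v S / up_total w S = X.
  have wS := w_gt0 (sp S).
  have uE : up_total w S = w (sp S) * \sum_(j < n) leaf s j.
    rewrite /up_total big_mkcond mulr_sumr; apply: eq_bigr => j _; rewrite lE.
    by case: ifP => jS; rewrite ?mulr0// w_flip// mulrDr mulr1.
  have vE : up_weight w v S = w (sp S) * \sum_(j < n) leaf s j * at_site F j.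
    rewrite /up_weight big_mkcond mulr_sumr; apply: eq_bigr => j _; rewrite lE at_siteE.
    case: ifP => jS; rewrite ?mul0r ?mulr0// w_flip// /F /p -/(e j).
    by field; rewrite gt_eqF.
  have u0 := up_total_gt0 w_gt0 iS.
  by rewrite vE -XE mulrCA -uE mulfK// gt_eqF.
have -> : (r + (flip_cost + 3 * depth n + 7) = ((r + flip_cost).+3 + (3 * depth n + 3)).+1)%N by lia.
exact: final_seq.
Qed.

Definition step_cost := (2 * flip_cost + 6 * depth n + 14)%N.

Lemma final_step E k T x s r (v : spins n -> R) : represents Q h T x s ->
  (forall y s', represents Q h T y s' -> final E k s' r (v y)) ->
  final E (step :: k) s (r + step_cost) (\sum_y P x y * v y).
Proof.
move=> vs fk.
pose F i := up_weight w v (plus x :\ i) / up_total w (plus x :\ i).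
have [||X fX XE] := final_sample n_gt1 (E := E)
  (k := Seq (set_reg 1 (ISub (reg 0) size_cell)) (Seq (set_spin false) up_step) :: k)
  (r := (r + (flip_cost + 3 * depth n + 7) + flip_cost).+3) (f := at_site F)
  (static_n (valid_static vs)) (valid_uniform vs).
- by [].
- move=> s' i ilt sI sR e4; rewrite -[i]/(val (Ordinal ilt)) at_siteE.
  apply: (final_site (i := Ordinal ilt) vs sI sR e4) => s2 v2 s2i; apply: final_seq.
  apply: (final_runs_to (set_spin_runs n_gt1 Qsym deg_le false v2 s2i)) => s3.
  rewrite put_false => v3; apply: (final_up_step (i := Ordinal ilt)) v3 fk.
  by rewrite !inE eqxx.
have -> : \sum_y P x y * v y = X.
  rewrite walk_sum//; last by exact: ltnW.
  have nR : n%:R != 0 :> R by rewrite pnatr_eq0 -lt0n ltnW.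
  have -> : X = n%:R^-1 * (X * \sum_(j < n) 1).
    by rewrite sumr_const card_ord mulrCA mulVf// mulr1.
  rewrite XE; congr (_ * _); apply: eq_bigr => i _.
  by rewrite at_siteE mul1r.
have -> : (r + step_cost = ((r + (flip_cost + 3 * depth n + 7) + flip_cost).+3 + (3 * depth n + 3)).+1)%N.
  by rewrite /step_cost; set f := flip_cost; set d := depth n; clearbody f d; lia.
exact: final_seq.
Qed.

(** ** Initialization *)

Let row_cost := (D * (4 * depth n + 10) + 3)%N.
Definition init_cost := (n * (8 * depth n + 16) + n * (row_cost + 6) + 7)%N.

Lemma init_runs x T : runs_to init (input Q h x T) init_cost (represents Q h T x).
Proof.
(* The first loop has treated the coordinates below [p], the other leaves are 0. *)
pose I1 m s := exists2 p, (p + m = n)%N &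
  [/\ imem s 4 1 = p, static Q h T s /\ spins_at x s,
      forall i : 'I_n, (i < p)%N -> rmem s 2 i = h i 0,
      heap n (rmem s 3) (fun j => if (j < p)%N then leaf s j else 0) &
      heap n (rmem s 4) (fun j => (j < p)%N%:R)].
pose part p i := h i 0 + \sum_(k < n | (k < p)%N) (if k != i then Q k i * sg R x k else 0).
pose I2 m s := exists2 p, (p + m = n)%N & imem s 4 1 = p /\ valid Q h T x (part p) s.
have -> : init_cost = (1 + ((n * (8 * depth n + 16)).+1 + (1 + (n * (row_cost + 6)).+1).+1).+1).+1.
  by rewrite /init_cost; lia.
set s0 := input Q h x T.
apply: (runs_to_seq (Q1 := I1 n)).
  apply: runs_to_istore; exists 0%N => //; split=> //.
  - split; last exact: input_spins.
    by apply: (static_frame (s := s0)) (input_static _ _ _ _) => // a k a1 a4; rewrite /= /upd (negbTE a4).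
  - by split=> // u _; rewrite /node /= addr0.
  - by split=> // u _; rewrite /node /= addr0.
move=> s1 is1; apply: (runs_to_seq (Q1 := I1 0%N)).
  have -> : (8 * depth n + 16 = (8 * depth n + 15).+1)%N by lia.
  apply: runs_to_while is1 => [m s [p pm [p1 [st sp] fl hp lv]]|s [p]]; last first.
    by rewrite addn0 => pn [p1 [st _] _ _ _]; rewrite /= p1 (static_n st) pn addn1 ltnn.
  have pn : (p < n)%N by rewrite -pm addnS ltnS leq_addr.
  split; first by rewrite /= p1 (static_n st) addn1.
  have -> : (8 * depth n + 15 = (1 + ((4 * depth n + 5) + ((4 * depth n + 5) + 1).+1).+1).+1)%N by lia.
  pose s2 := Store (imem s) (upd (rmem s) 2 p (h (Ordinal pn) 0)).
  apply: (runs_to_seq (Q1 := fun s' => s' = s2)).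
    by apply: runs_to_rstore; rewrite /s2 /= p1 (static_field st (Ordinal pn)).
  move=> _ ->; have r1 : ieval s2 (reg 1) = p by [].
  apply: (runs_to_seq (refresh_runs n_gt1 _ _ (hp : heap n (rmem s2 3) _) _)) => //.
  - exact: static_n st.
  - by rewrite r1.
  move=> s3 [i3 q3 h3].
  have r13 : ieval s3 (reg 1) = p by rewrite /= i3.
  have lv3 : heap n (rmem s3 4) (fun j => (j < p)%N%:R) by rewrite q3.
  apply: (runs_to_seq (set_leaf_runs n_gt1 _ _ lv3 _ _)) => //.
  - by rewrite i3//; exact: static_n st.
  - by rewrite r13.
  move=> s4 [i4 q4 h4]; apply: runs_to_istore; exists p.+1; first by rewrite addSnnS.
  have off a k : a != 4%N -> imem s4 a k = imem s a k.
    by move=> a4; rewrite (same_ints_off _ i4 a4) (same_ints_off _ i3 a4).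
  split.
  - by rewrite /= /upd /= i4// -[X in (X + 1)%N]/(ieval s3 (reg 1)) r13 addn1.
  - split; last by move=> i; rewrite /= /upd /= off.
    apply: static_frame st => [a k a1 a4||]; first by rewrite /= /upd (negbTE a4)/= off.
      by rewrite /= q4// q3.
    by rewrite /= q4// q3.
  - move=> i; rewrite ltnS /= q4// q3//= /upd eqxx/=; case: eqP => [ip _|/eqP ip].
      by congr (h _ 0); apply/val_inj.
    by rewrite leq_eqVlt (negbTE ip)/=; exact: fl.
  - rewrite /= q4//; apply: heap_ext h3 => j jn; rewrite r1.
    have l3 : leaf s3 j = leaf (Store (upd (imem s4) 4 1 (imem s4 4 1 + 1)%N) (rmem s4)) j.
      by rewrite /leaf /= /upd /= i4// q4.
    transitivity (if (j < p.+1)%N then leaf s3 j else 0); last by rewrite l3.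
    rewrite ltnS [(j <= p)%N]leq_eqVlt; case: eqP => [//|/eqP jp /=]; case: ifP => // _.
    by rewrite l3 /leaf /= /upd /= off// q4// q3//= /upd eqxx /= (negbTE jp).
  - rewrite /=; apply: heap_ext h4 => j jn; rewrite r13 ltnS [(j <= p)%N]leq_eqVlt.
    by case: eqP.
move=> s2 [p]; rewrite addn0 => {p}-> [_ [st sp] fl hp lv].
apply: (runs_to_seq (Q1 := I2 n)).
  apply: runs_to_istore; exists 0%N => //; split=> //.
  have vs : valid Q h T x (part 0%N) s2.
    split=> //.
    - by move=> i; rewrite fl// /part big_pred0 ?addr0.
    - by apply: heap_ext hp => j ->.
    - by apply: heap_ext lv => j ->.
  by apply: valid_frame vs => // a k a4; rewrite /= /upd (negbTE a4).
move=> s3 is3; have -> : (row_cost + 6 = (row_cost + 5).+1)%N by lia.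
apply: (runs_to_le (leqnn _) _ (runs_to_while (I := I2) (B := (row_cost + 5)%N) _ _ is3)).
- move=> s' [p]; rewrite addn0 => {p}-> [_ [a1 a2 a3 a4 a5]]; split=> // i.
  rewrite a3 /part /local_field; congr (_ + _); rewrite [RHS]big_mkcond/=.
  apply: eq_big => [k|k _]; first by rewrite ltn_ord.
  by rewrite Qsym.
- move=> m s [p pm [p1 vs]].
  have pn : (p < n)%N by rewrite -pm addnS ltnS leq_addr.
  split; first by rewrite /= p1 (static_n (valid_static vs)) addn1.
  have -> : (row_cost + 5 = (1 + (row_cost + 1).+1).+1.+1)%N by lia.
  apply: (runs_to_le (leqnSn _) (fun _ q => q)).
  pose s4 := Store (imem s) (upd (rmem s) 5 0 (sg R x (Ordinal pn))).
  apply: (runs_to_seq (Q1 := fun s' => s' = s4)).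
    apply: runs_to_rstore; rewrite /s4 /= p1 (valid_spins vs (Ordinal pn)) /sg.
    by case: (x _) => /=; congr (Store _ (upd _ _ _ _)); ring.
  move=> _ ->; have v4 : valid Q h T x (part p) s4.
    by apply: valid_frame vs => // a a5; rewrite /= /upd (negbTE a5).
  apply: (runs_to_seq (scatter_runs n_gt1 deg_le v4 (p1 : imem s4 4 1 = Ordinal pn))).
  move=> s5 [v5 p5]; apply: runs_to_istore; exists p.+1; first by rewrite addSnnS.
  split; first by rewrite /= /upd /= p5 addn1.
  have v5' : valid Q h T x (part p.+1) s5.
    case: v5 => a1 a2 a3 a4 a5; split=> // j; rewrite a3 /part -addrA; congr (_ + _).
    rewrite [in RHS](bigD1 (Ordinal pn))//= addrC; congr (_ + _).
      by rewrite eq_sym; case: ifP => _; rewrite ?mulr0// mulrC.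
    by apply: eq_bigl => k; rewrite ltnS [(k <= p)%N]leq_eqVlt -val_eqE /=; case: ltngtP.
  by apply: valid_frame v5' => // a k a4; rewrite /= /upd (negbTE a4).
- move=> s' [p]; rewrite addn0 => {p}-> [p1 vs].
  by rewrite /= p1 (static_n (valid_static vs)) addn1 ltnn.
Qed.

End Sampler.

(** * The sampler *)

Section Chain.
Variables (R : realType) (n : nat) (J : 'M[R]_n) (h : 'cV[R]_n) (gamma : R).
Hypothesis n_gt1 : (1 < n)%N.
Hypothesis Jpsd : psd J.
Implicit Types (s : store R) (x y : spins n) (S : {set 'I_n}) (T : nat) (E : pred (store R)).

Let n_gt0 : (0 < n)%N. Proof. exact: ltnW. Qed.
Let Q := Qmat J gamma.
Let w := ising_weight J h gamma.
Let P := pol_walk (ising J h gamma).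
Let D := maxn 1 (row_degree Q).

Lemma Qmat_sym i j : Q i j = Q j i.
Proof. by case: Jpsd => Js _; rewrite /Q !mxE -[in LHS]Js mxE. Qed.

Let delta (j a : 'I_n) : R := (a == j)%:R.

Let qf_delta H j v : qf H (delta j) v = \sum_b H j b * v b.
Proof.
rewrite /qf (bigD1 j)//= /delta eqxx mul1r [X in _ + X]big1 ?addr0// => a /negbTE ->.
by rewrite mul0r.
Qed.

(** The diagonal of [J] and the square of the magnetization contribute constants
    that cancel, so only the off-diagonal entries of [Q] enter the local field. *)
Lemma ising_weight_add S j : j \notin S ->
  w (sp (j |: S)) = w (sp S) * expR (local_field Q h (sp S) j + local_field Q h (sp S) j).
Proof.
move=> jS; rewrite /w !weightE// -expRD; congr expR.
set u := sg R (sp S).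
have uj : u j = -1 by rewrite /u /sg ffunE (negbTE jS).
have uE : sg R (sp (j |: S)) = fun a => u a + 2 * delta j a.
  apply/funext => a; rewrite /u /sg /delta !ffunE !inE.
  by case: eqP => [->|_]; rewrite ?(negbTE jS) /= ?mulr0 ?addr0//; ring.
have Hs a b : (fun i k : 'I_n => J i k) a b = (fun i k : 'I_n => J i k) b a.
  by case: Jpsd => Js _; rewrite /= -[in LHS]Js mxE.
have linE : lin (fun i => h i 0) (sp (j |: S)) = lin (fun i => h i 0) (sp S) + 2 * h j 0.
  rewrite /lin uE; under eq_bigr do rewrite mulrDr.
  rewrite big_split/=; congr (_ + _); rewrite (bigD1 j)//= /delta eqxx big1 => [|a /negbTE ->]; last by rewrite !mulr0.
  by rewrite addr0 mulr1 mulrC.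
have sumE : \sum_i (u i + 2 * delta j i) = \sum_i u i + 2.
  rewrite big_split/=; congr (_ + _); rewrite (bigD1 j)//= /delta eqxx big1 ?addr0 ?mulr1//.
  by move=> a /negbTE ->; rewrite mulr0.
rewrite linE uE sumE qfDl !qfDr (qfC u (delta j) Hs) !qf_delta.
have -> : \sum_b J j b * delta j b = J j j.
  rewrite (bigD1 j)//= /delta eqxx mulr1 big1 ?addr0// => a /negbTE ->.
  by rewrite mulr0.
have -> : local_field Q h (sp S) j =
    h j 0 + (\sum_b J j b * u b + J j j) - gamma / n%:R * (\sum_i u i + 1).
  rewrite /local_field -addrA; congr (_ + _).
  rewrite [in RHS](bigD1 j)//= [\sum_i u i](bigD1 j)//= uj.
  set A := \sum_(i | i != j) J j i * u i; set B := \sum_(i | i != j) u i.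
  transitivity (A - gamma / n%:R * B); last by ring.
  rewrite /A /B mulr_sumr -sumrB; apply: eq_bigr => k _.
  by rewrite /Q !mxE mulr1 -/(u k); ring.
by field; rewrite pnatr_eq0 -lt0n n_gt0.
Qed.

Lemma deg_le_row_degree i : (size (nbrs Q i) <= D)%N.
Proof.
rewrite leq_max; apply/orP; right; rewrite /row_degree (bigD1 i)//= leq_max cardE.
apply/orP; left.
apply: uniq_leq_size => [|j]; first by rewrite filter_uniq// enum_uniq.
by rewrite mem_filter => /andP[jP _]; rewrite mem_enum inE.
Qed.

Let w_gt0 x : 0 < w x. Proof. exact: weight_gt0. Qed.

Let step_final := final_step n_gt1 Qmat_sym deg_le_row_degree w_gt0 ising_weight_add.

Let loop : cmd :=
  While (BILe (ICst 1) (ILoad 0 (ICst 1)))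
    (Seq step (IStore 0 (ICst 1) (ISub (ILoad 0 (ICst 1)) (ICst 1)))).

Lemma represents_read T x s : represents Q h T x s -> read_spins n s = x.
Proof.
move=> v; apply/ffunP => i; rewrite ffunE (valid_spins v).
by case: (x i).
Qed.

(** The step counter belongs to the valid states, as [step] must not touch it. *)
Lemma represents_countdown T x s : represents Q h T.+1 x s ->
  represents Q h T x (Store (upd (imem s) 0 1 T) (rmem s)).
Proof. by case=> -[h1 h2 h3 h4 h5 h6] a2 a3 a4 a5; split. Qed.

Lemma final_loop E (e : pred (spins n)) :
  (forall x s, represents Q h 0 x s -> E s = e x) ->
  forall T x s, represents Q h T x s ->
  final E [:: loop] s (T * (step_cost n D + 3)).+1 (\sum_y chain_law P x T y * (e y)%:R).
Proof.
move=> Ee; elim=> [|T IH] x s vs.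
  have -> : \sum_y chain_law P x 0 y * (e y)%:R = (E s)%:R.
    rewrite (bigD1 x)//= big1 ?addr0 => [|y yx]; rewrite /chain_law /= /dirac_mass.
      by rewrite eqxx mul1r (Ee _ _ vs).
    by rewrite eq_sym (negbTE yx) mul0r.
  apply: (@final_det _ _ _ _ _ _ _ [::] s); last exact: final_nil.
  by rewrite /= (static_T (valid_static vs)).
have -> : (T.+1 * (step_cost n D + 3) = (T * (step_cost n D + 3)).+1.+1 + step_cost n D + 1)%N.
  by rewrite mulSn; lia.
have -> : \sum_y chain_law P x T.+1 y * (e y)%:R =
    \sum_y P x y * \sum_z chain_law P y T z * (e z)%:R.
  under [RHS]eq_bigr do rewrite mulr_sumr.
  rewrite exchange_big; apply: eq_bigr => z _; rewrite chain_law_first mulr_suml.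
  by apply: eq_bigr => y _; rewrite mulrA.
rewrite addn1; apply: (@final_det _ _ _ _ _ _ _
  [:: Seq step (IStore 0 (ICst 1) (ISub (ILoad 0 (ICst 1)) (ICst 1))); loop] s).
  by rewrite /= (static_T (valid_static vs)).
apply: final_seq; apply: (step_final vs) => y s' vs'.
apply: final_det => //=; apply: IH.
by rewrite (static_T (valid_static vs')) subn1; exact: represents_countdown.
Qed.

Definition sampler_cost T := (init_cost n D + T * (step_cost n D + 3) + 2)%N.

Lemma final_sampler E (e : pred (spins n)) :
  (forall x s, represents Q h 0 x s -> E s = e x) ->
  forall T x, final E [:: sampler init step] (input Q h x T) (sampler_cost T)
     (\sum_y chain_law P x T y * (e y)%:R).
Proof.
move=> Ee T x.
have -> : sampler_cost T = ((T * (step_cost n D + 3)).+1 + init_cost n D).+1.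
  by rewrite /sampler_cost; lia.
apply: final_seq.
apply: (final_runs_to (init_runs h n_gt1 Qmat_sym deg_le_row_degree x T)) => s vs.
exact: final_loop.
Qed.

Lemma sampler_outputs T x (B : R) : (sampler_cost T)%:R <= B ->
  outputs_within (sampler init step) (input Q h x T) B (chain_law P x T).
Proof.
move=> cB; exists (sampler_cost T); split=> // [|y].
  apply: (etrans (final_sampler (E := predT) (e := predT) _ x (leqnn (sampler_cost T)))) => //.
  under eq_bigr do rewrite mulr1.
  exact: (proj2 (chain_law_prob _ _ (walk_stochastic n_gt0 w_gt0))).
apply: (etrans (final_sampler (E := fun s => read_spins n s == y) (e := fun z => z == y) _ x
  (leqnn (sampler_cost T)))); first by move=> z s /represents_read ->.
rewrite (bigD1 y)//= eqxx mulr1 big1 ?addr0// => z /negbTE ->.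
by rewrite mulr0.
Qed.

Lemma step_implements : implements_chain P (input Q h) init step.
Proof.
pose Rep x : pred (store R) := fun s => `[< exists T, represents Q h T x s >].
exists Rep; split=> [x s /asboolP[T /represents_read]//|x T|x s /asboolP[T vs]].
  exists (init_cost n D).
  have fin := final_runs_to (E := Rep x) (k := [::]) (r := 0%N) (v := 1)
    (init_runs h n_gt1 Qmat_sym deg_le_row_degree x T).
  apply: fin (leqnn _) => s vs.
  have Es : Rep x s by apply/asboolP; exists T.
  by have := @final_nil _ (Rep x) s 0%N; rewrite Es.
exists (step_cost n D) => y.
have RepE z s' : represents Q h T z s' -> Rep y s' = (z == y).
  move=> v; apply/asboolP/eqP => [[T' /represents_read <-]|<-]; last by exists T.
  by rewrite (represents_read v).
have fin := step_final (E := Rep y) (k := [::]) (r := 0%N) (v := fun z => (z == y)%:R) vs.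
apply: (etrans (fin _ _ (leqnn _))); last first.
  rewrite (bigD1 y)//= eqxx mulr1 [X in _ + X]big1 ?addr0// => z /negbTE ->.
  by rewrite mulr0.
by move=> z s' v; rewrite -(RepE _ _ v); exact: final_nil.
Qed.

(** ** Running time *)

Lemma sampler_cost_le T : (sampler_cost T <= 85 * ((n + T) * (D * depth n)))%N.
Proof.
have D1 : (1 <= D)%N by rewrite leq_maxl.
have d1 : (1 <= depth n)%N by [].
set d := depth n in d1 *; set m := (D * d)%N.
have Dm : (D <= m)%N by rewrite leq_pmulr.
have dm : (d <= m)%N by rewrite leq_pmull.
have e1 : (D * (4 * d + 10) = 4 * m + 10 * D)%N by rewrite /m; lia.
have s1 : (step_cost n D + 3 <= 85 * m)%N by rewrite /step_cost -/d e1; lia.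
have i1 : (n * (8 * d + 16) <= n * (24 * m))%N by rewrite leq_mul2l; apply/orP; right; lia.
have i2 : (n * (D * (4 * d + 10) + 3 + 6) <= n * (23 * m))%N.
  by rewrite leq_mul2l e1; apply/orP; right; lia.
have i3 : (9 <= n * (9 * m))%N by apply: (@leq_trans (1 * (9 * 1))) => //; rewrite leq_mul//; lia.
have := leq_mul (leqnn T) s1.
rewrite /sampler_cost /init_cost -/d => t1.
have -> : (85 * ((n + T) * m) = n * (24 * m) + n * (23 * m) + n * (9 * m) + n * (29 * m) + T * (85 * m))%N by lia.
lia.
Qed.

Lemma depth_le_ln : (depth n)%:R <= 4 * ln n%:R :> R.
Proof.
have nR : 0 < n%:R :> R by rewrite ltr0n.
set l := trunc_log 2 n.
have l1 : (1 <= l)%N by rewrite /l trunc_log_gt0.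
have : ln (2 ^+ l) <= ln n%:R :> R.
  rewrite ler_ln ?posrE ?exprn_gt0// -natrX ler_nat.
  exact: trunc_logP.
rewrite (@lnXn R l 2)// -[_ *+ l]mulr_natr.
have l2 := half_le_ln (lexx (2 : R)).
have lR : 1 <= l%:R :> R by rewrite ler1n.
have := ler_wpM2r (ler0n R l) l2.
rewrite /depth -/l -[l.+1%:R]natr1; lra.
Qed.

Lemma sampler_time T :
  (sampler_cost T)%:R <= 340 * ((n + T)%:R * (D%:R * ln n%:R)) :> R.
Proof.
have : ((sampler_cost T)%:R <= (85 * ((n + T) * (D * depth n)))%N%:R :> R).
  by rewrite ler_nat sampler_cost_le.
move/le_trans; apply; rewrite !natrM.
have a0 : 0 <= (n + T)%:R * D%:R :> R by rewrite mulr_ge0.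
have := ler_wpM2l a0 depth_le_ln; lra.
Qed.

End Chain.

Theorem theorem10 (R : realType) :
  (forall (n : nat) (J : 'M[R]_n) (h : 'cV[R]_n) (gamma : R),
     (0 < n)%N -> psd J -> 0 <= gamma -> opnorm J < 2^-1 ->
     entropy_contraction (1 - (1 - 2 * opnorm J) / n%:R)
       (@Dpol R n) (ising J h gamma))
  /\
  (exists C1 : R, 0 < C1 /\
    (forall (n : nat) (J : 'M[R]_n) (h : 'cV[R]_n) (gamma : R),
       (0 < n)%N -> psd J -> 0 <= gamma -> opnorm J < 2^-1 ->
       forall (eps : R), 0 < eps < 1 ->
       forall (x : spins n) (t : nat),
         C1 * ((1 - 2 * opnorm J)^-1 * n%:R * ln (n%:R / eps)) <= t%:R ->
         tv_dist (chain_law (pol_walk (ising J h gamma)) x t)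
           (ising J h gamma) <= eps)
    /\
    (exists (C2 : R) (init step : cmd), 0 < C2 /\
      forall (n : nat) (J : 'M[R]_n) (h : 'cV[R]_n) (gamma : R),
        (1 < n)%N -> psd J -> 0 <= gamma -> opnorm J < 2^-1 ->
        let Q := Qmat J gamma in
        let d : R := (maxn 1 (row_degree Q))%:R in
        [/\ implements_chain (pol_walk (ising J h gamma)) (input Q h) init step,
            forall (x : spins n) (T : nat),
              outputs_within (sampler init step) (input Q h x T)
                (C2 * ((n + T)%:R * (d * ln n%:R)))
                (chain_law (pol_walk (ising J h gamma)) x T)
          & forall (eps : R), 0 < eps < 1 ->
            let T := `|Num.ceil
              (C1 * ((1 - 2 * opnorm J)^-1 * n%:R * ln (n%:R / eps)))|%N in
            forall x : spins n, exists mu : spins n -> R,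
              outputs_within (sampler init step) (input Q h x T)
                (C2 * ((1 - 2 * opnorm J)^-1 * n%:R * d * ln n%:R
                       * ln (n%:R / eps))) mu
              /\ tv_dist mu (ising J h gamma) <= eps])).
Proof.
split=> [n J h gamma n0 Jpsd gamma0 Jn|].
  move=> nu' nu'1 _; apply: (contracts_kl n0 _ (ising_contracts n0 h Jpsd gamma0 Jn) nu'1).
  by move=> x; exact: weight_gt0.
exists 20; split=> //; split=> [n J h gamma n0 Jpsd gamma0 Jn eps eps01 x t ht|].
  exact: mixing_time ht.
(* [8160 = 24 * 340]: the number [T] of steps satisfies [n + T <= 24 * A], where
   [A] is the bound on the mixing time without its constant. *)
exists 8160, init, step; split=> // n J h gamma n1 Jpsd gamma0 Jn Q d.
have n0 : (0 < n)%N by exact: ltnW.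
have nR : 2 <= n%:R :> R by rewrite ler_nat.
have lnn : 0 <= ln n%:R :> R by apply: le_trans (half_le_ln nR); lra.
have d0 : 0 <= d * ln n%:R :> R by exact: mulr_ge0.
split; first exact: step_implements.
  move=> x T; apply: sampler_outputs => //; apply: (le_trans (sampler_time _ _ _ _)) => //.
  by apply: ler_wpM2r; [exact: mulr_ge0|lra].
move=> eps eps01 T x; have [e0 e1] := andP eps01.
have rho0 : 0 < 1 - 2 * opnorm J by lra.
have rho1 : 1 - 2 * opnorm J <= 1 by have := opnorm_ge0 J; lra.
have ri : 1 <= (1 - 2 * opnorm J)^-1 by rewrite invf_ge1.
set A := (1 - 2 * opnorm J)^-1 * n%:R * ln (n%:R / eps).
have ne2 : 2 <= n%:R / eps by rewrite ler_pdivlMr//; nra.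
have L2 := half_le_ln ne2.
have A1 : n%:R <= 2 * A.
  have h1 : n%:R * 2^-1 <= n%:R * ln (n%:R / eps) by apply: ler_wpM2l.
  have h2 : n%:R * ln (n%:R / eps) <= A.
    by rewrite /A -mulrA ler_peMl// mulr_ge0//; lra.
  lra.
have A0 : 0 <= 20 * A by lra.
have TE : T%:R = (Num.ceil (20 * A))%:~R :> R.
  have c0 : 0 <= Num.ceil (20 * A) by rewrite ceil_ge0; apply: lt_le_trans A0; rewrite oppr_lt0.
  by rewrite /T -[_%:R]/((Posz _)%:~R) gez0_abs.
have Tlo : 20 * A <= T%:R by rewrite TE; exact: ceil_ge.
have Thi : T%:R <= 20 * A + 1.
  by rewrite TE; have := ceilB1_lt (20 * A); rewrite intrB; lra.
exists (chain_law (pol_walk (ising J h gamma)) x T); split; last exact: mixing_time Tlo.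
apply: sampler_outputs => //; apply: (le_trans (sampler_time _ _ _ _)) => //.
have nT : (n + T)%:R <= 24 * A by rewrite natrD; lra.
have := ler_wpM2r d0 nT; rewrite -/Q -/d.
have -> : (1 - 2 * opnorm J)^-1 * n%:R * d * ln n%:R * ln (n%:R / eps) = A * (d * ln n%:R).
  by rewrite /A; ring.
lra.
Qed.
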